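(* Assume that $t\mapsto g(t)/t^{q-1}$ is non-increasing on $(0,\infty)$. Let $\Omega\subset\mathbb R^n$ be open. Let $h_1,h_2\in L^g_s(\mathbb R^n)$ with $h_1\le h_2$ a.e. in $\mathbb R^n$. Let $\{u_j\}$ be an increasing sequence of supersolutions of $\mathcal Lu=0$ in $\Omega$ such that $h_1\le u_j\le h_2$ a.e. in $\mathbb R^n$ and $\{u_j\}$ is uniformly locally essentially bounded from above in $\Omega$. If $u_j$ converges to a function $u$ pointwise almost everywhere in $\Omega$, then $u$ is a supersolution of $\mathcal Lu=0$ in $\Omega$.
   Context: Fix $n\in\mathbb N$, $s\in(0,1)$, $\Lambda\ge1$. $G(t)=\int_0^tg$ is a differentiable Young function with $g=G'$ strictly increasing, $G(1)=1$, and $1<p\le q$ with $pG(t)\le tg(t)\le qG(t)$ for $t\ge0$. $k$ measurable with $\Lambda^{-1}\le k(x,y)=k(y,x)\le\Lambda$ a.e. $D^su(x,y)=(u(x)-u(y))/|x-y|^s$. $W^{s,G}_{\mathrm{loc}}(\Omega)$: measurable $u$ with $\int_DG(|u|)+\int_D\int_DG(|D^su|)|x-y|^{-n}dydx<\infty$ for every open $D\Subset\Omega$. $L^g_s(\mathbb R^n)$: measurable $u$ with $g(|u|)$ locally integrable and $\int g(|u(x)|/(1+|x|)^s)(1+|x|)^{-n-s}dx<\infty$. A supersolution of $\mathcal Lu=0$ in $\Omega$ is $u\in W^{s,G}_{\mathrm{loc}}(\Omega)$ with $u_-\in L^g_s(\mathbb R^n)$ and $\int\int g(|D^su|)\frac{D^su}{|D^su|}D^s\varphi\frac{k(x,y)}{|x-y|^n}dydx\ge0$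 for all nonnegative $\varphi\in C_c^\infty(\Omega)$.
   Formalization: The convergence of u_j to u is assumed almost everywhere in R^n instead of only in Ω; otherwise u would be arbitrary outside Ω and the claim fails (e.g. u_j = 0, with u = 0 except u = 1 on a bounded set of positive measure outside Ω). *)

(* Defs.v *)
From HB Require Import structures.
From mathcomp Require Import all_boot all_order all_algebra.
From mathcomp Require Import all_classical all_reals all_analysis.
Set Implicit Arguments. Unset Strict Implicit. Unset Printing Implicit Defensive.
Import Order.TTheory GRing.Theory Num.Theory.
Import numFieldNormedType.Exports.
Local Open Scope classical_set_scope.
Local Open Scope ring_scope.

(* R^n : topology / differential structure on 'rV[R]_n ; measure structure on
   n.-tuple R (product Borel sigma-algebra).  [rv] identifies the two. *)
Section Defs.
Variables (R : realType) (n : nat).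

Definition rv (x : n.-tuple R) : 'rV[R]_n := \row_(i < n) tnth x i.

Definition enorm (x : 'rV[R]_n) : R := Num.sqrt (\sum_(i < n) x ord0 i ^+ 2).

(* mu is (the) Lebesgue measure on R^n: it gives every half-open box its volume
   (this characterizes Lebesgue measure on the Borel sets) *)
Definition is_lebesgue (mu : set (n.-tuple R) -> \bar R) : Prop :=
  forall a b : n.-tuple R, (forall i, tnth a i <= tnth b i) ->
    mu [set x | forall i, tnth a i < tnth x i <= tnth b i] =
    (\prod_(i < n) (tnth b i - tnth a i))%:E.

(* Lebesgue measurability w.r.t. the completion of m: a.e. equal to a
   measurable function *)
Definition lmeas {d} {X : measurableType d} (m : set X -> \bar R)
  (f : X -> R) : Prop :=
  exists f' : X -> R, measurable_fun setT f' /\ {ae m, forall z, f z = f' z}.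

Definition ccont (D Om : set 'rV[R]_n) : Prop :=
  compact (closure D) /\ closure D `<=` Om.

Definition Ds (s : R) (u : 'rV[R]_n -> R) (x y : 'rV[R]_n) : R :=
  (u x - u y) / (enorm (x - y)) `^ s.

Definition ebasis (i : 'I_n) : 'rV[R]_n := delta_mx ord0 i.

Fixpoint pder (l : seq 'I_n) (f : 'rV[R]_n -> R) : 'rV[R]_n -> R :=
  match l with
  | [::] => f
  | i :: l' => fun x => derive (pder l' f) x (ebasis i)
  end.

Definition smooth (f : 'rV[R]_n -> R) : Prop :=
  forall l : seq 'I_n, continuous (pder l f) /\
    (forall i x, derivable (pder l f) x (ebasis i)).

Definition testfun (Om : set 'rV[R]_n) (phi : 'rV[R]_n -> R) : Prop :=
  smooth phi /\
  exists K : set 'rV[R]_n, compact K /\ K `<=` Om /\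
    forall x, ~ K x -> phi x = 0.

Variable mu : set (n.-tuple R) -> \bar R.

Definition Wloc (G : R -> R) (s : R) (Om : set 'rV[R]_n) (u : 'rV[R]_n -> R)
  : Prop :=
  lmeas mu (u \o rv) /\
  forall D : set 'rV[R]_n, open D -> ccont D Om ->
    (\int[mu]_(x in rv @^-1` D) (G `|u (rv x)|)%:E < +oo)%E /\
    (\int[(mu \x mu)%E]_(z in (rv @^-1` D) `*` (rv @^-1` D))
       (G `|Ds s u (rv z.1) (rv z.2)|
          / (enorm (rv z.1 - rv z.2)) ^+ n)%:E < +oo)%E.

Definition Lgs (g : R -> R) (s : R) (u : 'rV[R]_n -> R) : Prop :=
  lmeas mu (u \o rv) /\
  (forall K : set 'rV[R]_n, compact K ->
     (\int[mu]_(x in rv @^-1` K) (g `|u (rv x)|)%:E < +oo)%E) /\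
  (\int[mu]_x (g (`|u (rv x)| / (1 + enorm (rv x)) `^ s)
                 / (1 + enorm (rv x)) `^ (n%:R + s))%:E < +oo)%E.

Definition negpart (u : 'rV[R]_n -> R) : 'rV[R]_n -> R :=
  fun x => Num.max (- u x) 0.

(* g(|t|) t/|t|, with the value 0 at t = 0 *)
Definition gsign (g : R -> R) (t : R) : R := g `|t| * Num.sg t.

Definition supersol (G g : R -> R) (s : R) (k : 'rV[R]_n -> 'rV[R]_n -> R)
  (Om : set 'rV[R]_n) (u : 'rV[R]_n -> R) : Prop :=
  Wloc G s Om u /\ Lgs g s (negpart u) /\
  forall phi : 'rV[R]_n -> R, testfun Om phi -> (forall x, 0 <= phi x) ->
    (0 <= \int[(mu \x mu)%E]_z
       (gsign g (Ds s u (rv z.1) (rv z.2)) * Ds s phi (rv z.1) (rv z.2)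
        * k (rv z.1) (rv z.2) / (enorm (rv z.1 - rv z.2)) ^+ n)%:E)%E.

End Defs.

Definition young_pair (R : realType) (G g : R -> R) : Prop :=
  g 0 = 0 /\ (forall t, 0 < t -> 0 < g t) /\
  (forall a b, 0 <= a -> a <= b -> g a <= g b) /\
  (forall t, 0 <= t -> g x @[x --> t^'+] --> g t) /\
  g x @[x --> +oo] --> +oo /\
  (forall t, 0 <= t ->
     (G t)%:E = (\int[lebesgue_measure]_(x in [set x | (0 <= x <= t)%R]) (g x)%:E)%E).

(* Main.v *)
(* Testing the inequality for [u_j] with [(M - u_j) eta^(m+1)], where [M] is a local upper bound,
   [eta] a cutoff and [m >= q - 1] an integer, gives a Caccioppoli estimate: the local energies
   [\int\int |D u_j| g(|D u_j|) |x-y|^-n] are bounded uniformly in [j], because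
   [h_1 <= u_j <= h_2] controls the tails and [u_0 <= u_j <= M] the local terms. Fatou's lemma puts
   the limit in the local energy space. For a fixed test function [phi], Young's inequality bounds
   the integrands near the diagonal by [d |D u_j| g(|D u_j|) + C(d) |D phi| g(|D phi|)] and away
   from it by a fixed integrable function; Fatou's lemma for the bound minus the integrand then
   gives the inequality for the limit up to an error [O(d)], and [d] is arbitrary.

   The functions [(M - u_j) eta^(m+1)] are not smooth. To reach them, mollify: by Fubini the
   inequality for [phi * rho_e] is an average of the expressions for the translates of [phi],
   so one of these is nonnegative for an arbitrarily small translation; translates converge in
   [L^1], hence almost everywhere along a subsequence, and dominated convergence applies with
   dominating functions whose integrals do not depend on the translation. *)
Require Import Defs.
From HB Require Import structures.
From mathcomp Require Import all_boot all_order all_algebra.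
From mathcomp Require Import all_classical all_reals all_analysis.
From mathcomp Require Import measurable_realfun ring lra.
Import Order.TTheory GRing.Theory Num.Theory.
Import numFieldNormedType.Exports.
Local Open Scope classical_set_scope.
Local Open Scope ring_scope.
Set Implicit Arguments.
Unset Strict Implicit.
Unset Printing Implicit Defensive.

(** * Integrals and null sets *)

(** The hypothesis on g(t)/t^(q-1) is used as g(c t) <= c^m g(t) for c >= 1, with the exponent
    rounded up to an integer [m]. Together with monotonicity this gives Young's inequality for t
    g(t) by distinguishing cases, without conjugate functions, and lets powers of the cutoff pass
    through [g].

    Approximating a nonsmooth test function in the usual way would require its mollifications to
    converge in the nonlinear energy. Selecting translates instead requires only the sign of each
    integral and continuity of translations in L^1. The price is a shape imposed on the dominating
    functions: the kernel is not translation invariant, so it may enter only through its upper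
    bound, and the bound must split into a part in [u] alone and a part in the test function alone,
    the latter with translation invariant integral.

    Three neighbourhoods of a compact set, of radii d, 2d and 3d, recur: the first contains the
    support of the cutoff, the second the supports of its translates, the third separates near pairs
    from far ones. Passing to Borel representatives that vanish on a common null set turns the
    almost everywhere bounds into bounds at every point. *)

Section integral_ae.
Local Open Scope ereal_scope.
Context d (X : measurableType d) (R : realType) (m : {measure set X -> \bar R}).
Implicit Types f g : X -> \bar R.

Import HBNNSimple.

(* Measurability is not available: the integrands of the statement are only measurable for the
   completion of the measure. A simple minorant is cut off on the exceptional null set. *)
Lemma ge0_ae_le_integral f g : (forall x, 0 <= f x) -> (forall x, 0 <= g x) ->
  {ae m, forall x, f x <= g x} -> \int[m]_x f x <= \int[m]_x g x.
Proof.
move=> f0 g0 [N [mN N0 sub]].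
rewrite !ge0_integralTE//; apply: ge_ereal_sup => _ /= [h hf <-].
pose h' := proj_nnsfun h (measurableC mN).
have h'E x : h' x = (h x * \1_(~` N) x)%R by [].
have h'g x : (h' x)%:E <= g x.
  rewrite h'E indicE; have [/set_mem xN|_] := boolP (x \in _).
    rewrite mulr1; apply: le_trans (hf x) _; apply: contrapT => fg.
    by apply: xN; exact: sub.
  by rewrite mulr0.
have -> : sintegral m h = sintegral m h'.
  transitivity (\int[m]_x (h x)%:E); first by rewrite integral_nnsfun// patch_setT.
  transitivity (\int[m]_x (h' x)%:E); last by rewrite integral_nnsfun// patch_setT.
  apply: ge0_ae_eq_integral => //.
  - exact/measurable_EFinP.
  - exact/measurable_EFinP.
  - by move=> x _; rewrite lee_fin.
  - by move=> x _; rewrite lee_fin.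
  exists N; split => // x; apply: contra_notP => xN _.
  by rewrite h'E indicE mem_set// mulr1.
by apply: ereal_sup_ubound; exists h'.
Qed.

Lemma ae_eq_integralT f g : {ae m, forall x, f x = g x} ->
  \int[m]_x f x = \int[m]_x g x.
Proof.
move=> fg; rewrite (integralE _ _ f) (integralE _ _ g).
by congr (_ - _); apply/eqP; rewrite eq_le; apply/andP; split;
  apply: ge0_ae_le_integral => //; apply: filterS fg => x; rewrite ?funeposE ?funenegE => ->.
Qed.

Lemma ge0_le_integralT f g : (forall x, 0 <= f x) -> (forall x, f x <= g x) ->
  \int[m]_x f x <= \int[m]_x g x.
Proof.
move=> f0 fg; apply: ge0_ae_le_integral => //; last exact: aeW.
by move=> x; exact: le_trans (fg x).
Qed.

Lemma limn_einf_ub (u_ : (\bar R)^nat) (c : \bar R) :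
  (forall j, u_ j <= c) -> limn_einf u_ <= c.
Proof.
move=> uc; rewrite limn_einf_lim; apply: lime_le; first exact: is_cvg_einfs.
apply: nearW => j; apply: le_trans (uc j).
by apply: ereal_inf_lbound; exists j => /=.
Qed.

(* Fatou's lemma for [a_ j - f_ j >= 0]; the excess [kappa] allows the dominating
   functions to lose a little mass in the limit. *)
Lemma fatou_dominated (f_ a_ : nat -> X -> R) (f a : X -> R) (kappa : R) :
  (forall j, measurable_fun setT (f_ j)) -> measurable_fun setT f ->
  (forall j, m.-integrable setT (EFin \o a_ j)) -> m.-integrable setT (EFin \o a) ->
  (forall j x, `|f_ j x| <= a_ j x)%R ->
  {ae m, forall x, (fun j => f_ j x) @ \oo --> f x} ->
  {ae m, forall x, (fun j => a_ j x) @ \oo --> a x} ->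
  (forall j, \int[m]_x (a_ j x)%:E <= \int[m]_x (a x)%:E + kappa%:E) ->
  (forall j, 0 <= \int[m]_x (f_ j x)%:E) ->
  m.-integrable setT (EFin \o f) /\ (- kappa)%:E <= \int[m]_x (f x)%:E.
Proof.
move=> mf_ mf ia_ ia fa cf ca ale f0.
have intf : m.-integrable setT (EFin \o f).
  apply/integrableP; split; first exact/measurable_EFinP.
  have /integrableP[_] := ia; apply: le_lt_trans.
  apply: ge0_ae_le_integral => //; apply: filterS2 cf ca => x cfx cax /=.
  rewrite lee_fin; apply: le_trans (ler_norm _).
  apply: (@ler_cvg_to _ _ _ _ (fun j => `|f_ j x|)%R (fun j => a_ j x) _ _ _ cax).
    exact: cvg_norm.
  exact: nearW.
have intf_ j : m.-integrable setT (EFin \o f_ j).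
  apply: le_integrable (ia_ j) => //; first exact/measurable_EFinP.
  by move=> x _ /=; rewrite lee_fin; exact: le_trans (fa _ _) (ler_norm _).
split => //.
pose g_ j x := (a_ j x - f_ j x)%:E.
have g0 j x : 0 <= g_ j x.
  by rewrite lee_fin subr_ge0; exact: le_trans (ler_norm _) (fa _ _).
have mg j : measurable_fun setT (g_ j).
  apply/measurable_EFinP; apply: measurable_funB => //.
  by apply/measurable_EFinP; exact: measurable_int (ia_ j).
have := fatou m measurableT mg (fun j x _ => g0 j x).
have -> : \int[m]_x limn_einf (g_ ^~ x) = \int[m]_x (a x - f x)%:E.
  apply: ae_eq_integralT; apply: filterS2 cf ca => x cfx cax.
  suff /cvg_limn_einf_sup[-> _] : (g_ ^~ x) @ \oo --> (a x - f x)%:E by [].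
  by apply: cvg_EFin; [exact: nearW|exact: cvgB].
under eq_integral do rewrite EFinB.
rewrite integralB//.
(* Since [0 <= \int f_ j], each [\int (a_ j - f_ j)] is at most [\int a + kappa]. Fatou bounds
   [\int a - \int f] by the same number, and the finite [\int a] cancels. *)
have le : limn_einf (fun j => \int[m]_x g_ j x) <= \int[m]_x (a x)%:E + kappa%:E.
  apply: limn_einf_ub => j; apply: le_trans (ale j).
  have -> : \int[m]_x g_ j x = \int[m]_x (a_ j x)%:E - \int[m]_x (f_ j x)%:E.
    by rewrite -integralB//; [exact: ia_|exact: intf_].
  rewrite -[X in (_ <= X)%E]adde0 leeD2l// oppe_le0; exact: f0.
move=> /le_trans /(_ le); rewrite -!/(comp _ _).
have fA : \int[m]_x (EFin \o a) x \is a fin_num by exact: integrable_fin_num.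
have fF : \int[m]_x (EFin \o f) x \is a fin_num by exact: integrable_fin_num.
rewrite -[X in X - _](fineK fA) -[X in _ - X](fineK fF) -[X in _ <= X + _](fineK fA).
rewrite -[X in _ -> _ <= X](fineK fF) -EFinB -EFinD !lee_fin; lra.
Qed.

End integral_ae.

Lemma nneseries_geometric_le (R : realType) (a z : R) : 0 <= a -> 0 < z < 1 ->
  (\sum_(0 <= k <oo) (a * z ^+ k)%:E <= (a / (1 - z))%:E)%E.
Proof.
move=> a0 /andP[z0 z1]; apply: lime_le.
  by apply: is_cvg_nneseries => k _ _; rewrite lee_fin mulr_ge0// exprn_ge0// ltW.
apply: nearW => m; rewrite sumEFin lee_fin.
have := @geometric_le_lim R m a z a0 z0; rewrite gtr0_norm// => /(_ z1).
by rewrite /series/=.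
Qed.

Section integrable_real.
Context d (X : measurableType d) (R : realType) (mu : {measure set X -> \bar R}).
Implicit Types f g : X -> R.

Lemma le_integrableT f g : measurable_fun setT f -> (forall x, `|f x| <= g x) ->
  mu.-integrable setT (EFin \o g) -> mu.-integrable setT (EFin \o f).
Proof.
move=> mf fg; apply: le_integrable => //; first exact/measurable_EFinP.
by move=> x _; rewrite /= lee_fin; exact: le_trans (fg x) (ler_norm _).
Qed.

Lemma integrableDT f g : mu.-integrable setT (EFin \o f) -> mu.-integrable setT (EFin \o g) ->
  mu.-integrable setT (EFin \o (fun x => f x + g x)).
Proof. by move=> If Ig; apply: eq_integrable (integrableD measurableT If Ig). Qed.

Lemma integrableZT c f : mu.-integrable setT (EFin \o f) ->
  mu.-integrable setT (EFin \o (fun x => c * f x)).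
Proof. by move=> If; apply: eq_integrable (integrableZl measurableT c If). Qed.

End integrable_real.

(** * Lebesgue measure on tuples *)

Section tuple_space.
Context (R : realType) (n : nat).
Local Notation T := (n.-tuple R).

Definition tadd (x h : T) : T := [tuple tnth x i + tnth h i | i < n].

Lemma rv_tadd x h : rv (tadd x h) = rv x + rv h.
Proof. by apply/rowP => i; rewrite !mxE tnth_mktuple. Qed.

Definition tof (v : 'rV[R]_n) : T := [tuple v ord0 i | i < n].

Lemma tofK v : rv (tof v) = v.
Proof. by apply/rowP => i; rewrite mxE tnth_mktuple. Qed.

Definition box (a b : T) : set T := [set x | forall i, tnth a i < tnth x i <= tnth b i].

Definition boxes : set (set T) :=
  [set A | exists a b, (forall i, tnth a i <= tnth b i) /\ A = box a b].

Lemma measurable_forall d (X : measurableType d) (P : 'I_n -> set X) :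
  (forall i, measurable (P i)) -> measurable [set x | forall i, P i x].
Proof.
move=> mP; have -> : [set x | forall i, P i x] = \bigcap_(i in [set: 'I_n]) P i.
  by apply/seteqP; split => [x Px i _|x Px i]; exact: Px.
by apply: fin_bigcap_measurable.
Qed.

Lemma measurable_box a b : measurable (box a b).
Proof.
apply: measurable_forall => i.
rewrite (_ : (fun x : T => _) = (@tnth n R ^~ i) @^-1` `]tnth a i, tnth b i]); last first.
  by apply/seteqP; split => x; rewrite /= in_itv.
by rewrite -[X in measurable X]setTI; apply: measurable_tnth.
Qed.

Lemma boxes_setI : setI_closed boxes.
Proof.
move=> _ _ [a [b [ab ->]]] [c [d [cd ->]]].
pose lo := [tuple Num.max (tnth a i) (tnth c i) | i < n].
(* The maximum with [lo] makes the box degenerate, hence empty, when the two boxes are disjoint, so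
   that the intersection stays in the class. *)
pose hi := [tuple Num.max (tnth lo i) (Num.min (tnth b i) (tnth d i)) | i < n].
exists lo, hi; split => [i|]; first by rewrite [tnth hi i]tnth_mktuple le_max lexx.
apply/seteqP; split => [x [xab xcd] i|x xlh].
  rewrite [tnth hi i]tnth_mktuple [tnth lo i]tnth_mktuple gt_max le_max le_min.
  by move: (xab i) (xcd i) => /andP[-> ->] /andP[-> ->]; rewrite orbT.
have xlhi i : [/\ tnth a i < tnth x i, tnth c i < tnth x i,
    tnth x i <= tnth b i & tnth x i <= tnth d i].
  have := xlh i; rewrite [tnth hi i]tnth_mktuple [tnth lo i]tnth_mktuple => /andP[lox].
  rewrite le_max leNgt lox/= le_min => /andP[-> ->].
  by move: lox; rewrite gt_max => /andP[-> ->].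
by split => i; have [H1 H2 H3 H4] := xlhi i; apply/andP.
Qed.

Definition cbox (k : nat) : set T := box [tuple (- k%:R) | i < n] [tuple k%:R | i < n].

Lemma cboxes k : boxes (cbox k).
Proof.
eexists _, _; split; last reflexivity.
by move=> i; rewrite !tnth_mktuple; apply: le_trans (ler0n _ _); rewrite oppr_le0.
Qed.

Lemma tuple_bounded (x : T) : exists k : nat, forall i, `|tnth x i| < k%:R.
Proof.
exists (Num.truncn (\sum_(i < n) `|tnth x i|)).+1 => i.
apply: le_lt_trans (truncnS_gt _).
by rewrite (bigD1 i)//= lerDl sumr_ge0.
Qed.

Lemma bigcup_cbox : \bigcup_k cbox k = setT.
Proof.
apply/seteqP; split => // x _; have [k xk] := tuple_bounded x.
exists k => // i; rewrite !tnth_mktuple.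
by have := xk i; rewrite ltr_norml => /andP[-> /ltW ->].
Qed.

Lemma measurable_boxes : @measurable _ T = <<s boxes >>.
Proof.
apply/seteqP; split; last first.
  apply: smallest_sub; first exact: sigma_algebra_measurable.
  by move=> _ [a [b [_ ->]]]; exact: measurable_box.
have mid : @measurable_fun _ _ (g_sigma_algebraType boxes) T setT id.
  apply/measurable_fun_tnthP => i; apply: (measurability (@ocitv R)) => //.
  move=> _ [_ [[c d] _ <-] <-]; rewrite setTI.
  (* A slab [c < x_i <= d] is a countable union of boxes whose other sides grow with [k];
     [Num.max c d] covers the empty interval. *)
  pose a (k : nat) : T := [tuple if j == i then c else - k%:R | j < n].
  pose b (k : nat) : T := [tuple if j == i then Num.max c d else k%:R | j < n].
  rewrite (_ : _ @^-1` _ = \bigcup_k box (a k) (b k)); last first.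
    apply/seteqP; split => [x /=|x [k _ xk] /=].
      rewrite in_itv/= => xcd; have [k xk] := tuple_bounded x.
      exists k => // j; rewrite !tnth_mktuple; case: eqP => [->|_].
        by rewrite le_max; move: xcd => /andP[-> ->]; rewrite orbT.
      by have := xk j; rewrite ltr_norml => /andP[-> /ltW ->].
    have := xk i; rewrite !tnth_mktuple eqxx le_max in_itv/= => /andP[cx].
    by rewrite cx (leNgt _ c) cx.
  apply: bigcupT_measurable => k; apply: sub_sigma_algebra.
  exists (a k), (b k); split => // j; rewrite !tnth_mktuple; case: eqP => _.
    by rewrite le_max lexx.
  by apply: le_trans (ler0n _ _); rewrite oppr_le0.
by move=> A mA; have := mid measurableT A mA; rewrite setTI preimage_id.
Qed.

Lemma measurable_taddl (x : T) : measurable_fun setT (tadd x).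
Proof.
apply/measurable_fun_tnthP => i; rewrite (_ : _ \o _ = fun h : T => tnth x i + tnth h i).
  by apply: measurable_funD => //; exact: measurable_tnth.
by apply/funext => h /=; rewrite tnth_mktuple.
Qed.

Lemma measurable_tadd : measurable_fun setT (fun z : T * T => tadd z.1 z.2).
Proof.
apply/measurable_fun_tnthP => i.
rewrite (_ : _ \o _ = fun z : T * T => tnth z.1 i + tnth z.2 i).
  by apply: measurable_funD; apply: (measurableT_comp (measurable_tnth i)).
by apply/funext => h /=; rewrite tnth_mktuple.
Qed.

Lemma measurable_taddr (h : T) : measurable_fun setT (tadd ^~ h).
Proof.
have -> : tadd ^~ h = (fun z : T * T => tadd z.1 z.2) \o (fun x => (x, h)) by [].
by apply: measurableT_comp; [exact: measurable_tadd|exact: measurable_pair2].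
Qed.

Lemma tadd_box (a b h : T) : tadd ^~ h @^-1` box a b =
  box (tadd a [tuple - tnth h i | i < n]) (tadd b [tuple - tnth h i | i < n]).
Proof.
by apply/seteqP; split => x xab i; have := xab i; rewrite !tnth_mktuple ltrBlDr lerBrDr.
Qed.

Variable mu : {sigma_finite_measure set T -> \bar R}.
Hypothesis mu_leb : is_lebesgue mu.

(** A translated box has the same volume. Boxes are stable under intersection, generate the
    sigma-algebra and exhaust the space with finite measure, so the pushforward under the
    translation coincides with [mu]. *)
Lemma mu_translate (h : T) (A : set T) : measurable A -> mu (tadd ^~ h @^-1` A) = mu A.
Proof.
have mh : isMeasurableFun _ _ T T (tadd ^~ h).
  by constructor; exact: measurable_taddr.
pose th : {mfun T >-> T} := HB.pack (tadd ^~ h) mh.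
move=> mA; rewrite -[LHS]/(pushforward mu th A).
apply: (@measure_unique _ _ _ boxes cbox) => //.
- exact: measurable_boxes.
- exact: boxes_setI.
- exact: cboxes.
- exact: bigcup_cbox.
- move=> _ [a [b [ab ->]]]; rewrite /= /pushforward tadd_box !mu_leb//.
    by congr EFin; apply: eq_bigr => i _; rewrite !tnth_mktuple; ring.
  by move=> i; rewrite !tnth_mktuple lerD2r.
- move=> k; rewrite /= /pushforward tadd_box mu_leb ?ltry// => i.
  by rewrite !tnth_mktuple lerD2r; apply: le_trans (ler0n _ _); rewrite oppr_le0.
Qed.

Local Open Scope ereal_scope.

Lemma ge0_integral_translate (h : T) (f : T -> \bar R) : measurable_fun setT f ->
  (forall x, 0 <= f x) -> \int[mu]_x f (tadd x h) = \int[mu]_x f x.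
Proof.
move=> mf f0.
rewrite -[LHS]/(\int[mu]_(x in tadd ^~ h @^-1` setT) (f \o tadd ^~ h) x).
rewrite -(ge0_integral_pushforward (measurable_taddr h))//.
apply: eq_measure_integral; first exact: measurable_taddr.
by move=> ? A mA _; exact: mu_translate.
Qed.

Lemma ge0_integral_translate2 (h : T) (f : T * T -> \bar R) : measurable_fun setT f ->
  (forall z, 0 <= f z) ->
  \int[mu \x mu]_z f (tadd z.1 h, tadd z.2 h) = \int[mu \x mu]_z f z.
Proof.
move=> mf f0; rewrite fubini_tonelli1//; last first.
  apply: (measurableT_comp mf).
  by apply/measurable_fun_pair; apply: (measurableT_comp (measurable_taddr h)).
rewrite fubini_tonelli1// /fubini_F /=.
transitivity (\int[mu]_x \int[mu]_y f (tadd x h, y)).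
  apply: eq_integral => x _; rewrite (ge0_integral_translate h (f := fun y => f (tadd x h, y)))//.
  by apply: (measurableT_comp mf); exact: measurable_pair1.
rewrite (ge0_integral_translate h (f := fun x => \int[mu]_y f (x, y)))//.
- exact: measurable_fun_fubini_tonelli_F.
- by move=> x; exact: integral_ge0.
Qed.

End tuple_space.

(** * Open sets of row vectors are Borel sets of tuples *)

Section borel_tuple.
Context (R : realType) (n : nat).
Local Notation T := (n.-tuple R).

(** The norm of row vectors is the maximum norm; for [n = 0] the right side is vacuous, which is why
    [e] is taken positive. *)
Lemma normr_rvP (v : 'rV[R]_n) (e : R) : 0 < e ->
  `|v| < e <-> forall i, `|v ord0 i| < e.
Proof.
move=> e0; have := @mx_norm_ball R 1 n => /(congr1 (fun b => b 0 e v)).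
rewrite /ball_/= sub0r normrN => <-; split.
  by case=> _ H i; have := H ord0 i; rewrite mxE /ball/= sub0r normrN.
by move=> H; split => // i j; rewrite mxE /ball/= sub0r normrN (ord1 i).
Qed.

Lemma ler_normr_rv (v : 'rV[R]_n) i : `|v ord0 i| <= `|v|.
Proof.
apply/ler_addgt0Pr => e e0; apply: ltW.
by have [+ _] := @normr_rvP v (`|v| + e) (ltr_wpDl (normr_ge0 _) e0); apply; rewrite ltrDl.
Qed.

(** The sigma-algebra on tuples is generated by coordinates, not by open sets. An open set is the
    countable union of the cubes with rational centre and radius [1/(k+1)] that it contains. *)
Lemma measurable_preimage_open (D : set 'rV[R]_n) : open D -> measurable (@rv R n @^-1` D).
Proof.
move=> oD.
pose ob (q : n.-tuple rat) (k : nat) : set T :=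
  [set x | forall i, `|tnth x i - ratr (tnth q i)| < k.+1%:R^-1].
have mob q k : measurable (ob q k).
  apply: measurable_forall => i.
  rewrite (_ : (fun x : T => _) = (@tnth n R ^~ i) @^-1`
     `]ratr (tnth q i) - k.+1%:R^-1, ratr (tnth q i) + k.+1%:R^-1[); last first.
    by apply/seteqP; split => x; rewrite /= in_itv/= ltr_distl.
  by rewrite -[X in measurable X]setTI; apply: measurable_tnth.
pose F (p : n.-tuple rat * nat) : set T :=
  if `[< ob p.1 p.2 `<=` @rv R n @^-1` D >] then ob p.1 p.2 else set0.
have -> : @rv R n @^-1` D = \bigcup_p F p.
  apply/seteqP; split => [x /= Dx|x [p _]]; last first.
    by rewrite /F; case: asboolP => // sub; exact: sub.
  have /nbhs_ballP[e /= e0 eD] : nbhs (rv x) D by move: oD; rewrite openE; exact.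
  have [k kltn] : exists k : nat, k.+1%:R^-1 < e / 2.
    exists (Num.truncn (e / 2)^-1); rewrite invf_plt ?posrE ?divr_gt0//.
    exact: truncnS_gt.
  have /choice[q qP] : forall i, exists q : rat, `|tnth x i - ratr q| < k.+1%:R^-1.
    move=> i; have [|q] := @rat_in_itvoo R (tnth x i - k.+1%:R^-1) (tnth x i + k.+1%:R^-1).
      by rewrite ltrBlDr -addrA ltrDl addr_gt0.
    rewrite in_itv/= => /andP[q1 q2]; exists q.
    by rewrite ltr_distlC q1 q2.
  exists ([tuple q i | i < n], k) => //; rewrite /F asboolT /=.
    by move=> i; rewrite tnth_mktuple.
  move=> y yq; apply: eD; rewrite mx_norm_ball /ball_/=.
  apply/normr_rvP => // i; rewrite !mxE.
  have := yq i; rewrite tnth_mktuple => yqi; have xqi := qP i.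
  rewrite -(subrKA (ratr (q i))); apply: le_lt_trans (ler_normD _ _) _.
  rewrite [ltRHS]splitr ltrD ?(lt_trans xqi)// distrC; exact: lt_trans kltn.
apply: countable_bigcupT_measurable; first exact: countableP.
by move=> p; rewrite /F; case: ifP.
Qed.

Lemma measurable_continuous_rv (f : 'rV[R]_n -> R) : continuous f ->
  measurable_fun setT (f \o @rv R n).
Proof.
move=> cf; apply: (measurability (@RGenOpens.G R)); first exact: RGenOpens.measurableE.
move=> _ [_ [a [b ->]] <-]; rewrite setTI comp_preimage.
apply: measurable_preimage_open; apply: open_comp; last exact: interval_open.
by move=> x _; exact: cf.
Qed.

End borel_tuple.

(** * Continuity of translations in the mean *)

Lemma continuous_prod_ord (R : realType) m (F : 'I_m -> R -> R) :
  (forall i, continuous (F i)) -> continuous (fun d => \prod_(i < m) F i d).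
Proof.
elim: m F => [|m IH] F cF.
  by under eq_fun do rewrite big_ord0; exact: cst_continuous.
under eq_fun do rewrite big_ord_recl.
move=> x; apply: cvgM; first exact: cF.
by apply: (IH (fun i => F (lift ord0 i))) => i; exact: cF.
Qed.

Section translation_continuity.
Context (R : realType) (n : nat).
Local Notation T := (n.-tuple R).
Variable mu : {sigma_finite_measure set T -> \bar R}.
Hypothesis mu_leb : is_lebesgue mu.
Local Open Scope ereal_scope.

Definition osc (f : T -> R) (h : T) := \int[mu]_x (`|f (tadd x h) - f x|)%:E.

(** The property to be propagated: it holds for boxes, is linear and survives dominated limits, so
    it reaches indicators by Dynkin's induction and then integrable functions by simple
    approximation. *)
Definition tcont (f : T -> R) := mu.-integrable setT (EFin \o f) /\
  forall e : R, (0 < e)%R -> exists2 d : R, (0 < d)%R &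
    forall h : T, (`|rv h| < d)%R -> osc f h <= e%:E.

Lemma integrable_mfun (f : T -> R) :
  mu.-integrable setT (EFin \o f) -> measurable_fun setT f.
Proof. by move=> /measurable_int /measurable_EFinP. Qed.

Lemma osc_triangle (f g k : T -> R) h : measurable_fun setT f -> measurable_fun setT g ->
    measurable_fun setT k ->
    (forall x, `|f (tadd x h) - f x| <=
       `|g (tadd x h) - g x| + `|k (tadd x h) - k x|)%R ->
  osc f h <= osc g h + osc k h.
Proof.
move=> mf mg mk fgk; rewrite /osc -ge0_integralD//.
- by apply: ge0_le_integralT => // x; rewrite -EFinD lee_fin; exact: fgk.
- apply/measurable_EFinP; apply: measurableT_comp => //; apply: measurable_funB => //.
  exact: (measurableT_comp mg (measurable_taddr h)).
- apply/measurable_EFinP; apply: measurableT_comp => //; apply: measurable_funB => //.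
  exact: (measurableT_comp mk (measurable_taddr h)).
Qed.

Lemma tcontD f g : tcont f -> tcont g -> tcont (f \+ g)%R.
Proof.
move=> [If cf] [Ig cg]; have Ifg : mu.-integrable setT (EFin \o (f \+ g)%R).
  by rewrite (_ : _ \o _ = (EFin \o f) \+ (EFin \o g))//; exact: integrableD.
split => // e e0; have e20 : (0 < e / 2)%R by rewrite divr_gt0.
have [d1 d10 H1] := cf _ e20; have [d2 d20 H2] := cg _ e20.
exists (Num.min d1 d2); first by rewrite lt_min d10.
move=> h; rewrite lt_min => /andP[hd1 hd2].
apply: (@le_trans _ _ (osc f h + osc g h)).
  apply: osc_triangle; [exact: (integrable_mfun Ifg)|exact: (integrable_mfun If)|exact: (integrable_mfun Ig)|].
  move=> x /=; apply: le_trans (ler_normD _ _); rewrite le_eqVlt; apply/orP; left.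
  by apply/eqP; congr (`|_|)%R; ring.
by rewrite [e]splitr EFinD leeD ?H1 ?H2.
Qed.

Lemma tcontZ c f : tcont f -> tcont (fun x => c * f x)%R.
Proof.
move=> [If cf]; split.
  by rewrite (_ : _ \o _ = fun x => c%:E * (f x)%:E)//; exact: integrableZl.
move=> e e0; have c0 : (0 < `|c| + 1)%R by rewrite ltr_wpDl.
have [d d0 H] := cf (e / (`|c| + 1))%R (divr_gt0 e0 c0).
exists d => // h hd.
have -> : osc (fun x => c * f x)%R h = `|c|%:E * osc f h.
  rewrite /osc -ge0_integralZl_EFin//.
  - by apply: eq_integral => x _; rewrite -mulrBr normrM EFinM.
  - apply/measurable_EFinP; apply: measurableT_comp => //; apply: measurable_funB => //.
      exact: (measurableT_comp (integrable_mfun If) (measurable_taddr h)).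
    exact: integrable_mfun.
apply: (@le_trans _ _ (`|c|%:E * (e / (`|c| + 1))%:E)).
  by apply: lee_wpmul2l => //; exact: H.
rewrite -EFinM lee_fin mulrA ler_pdivrMr// mulrDr mulr1 mulrC lerDl; exact: ltW.
Qed.

Lemma tcont_sum I (r : seq I) (F : I -> T -> R) : (forall i, tcont (F i)) ->
  tcont (fun x => \sum_(i <- r) F i x)%R.
Proof.
move=> cF; elim: r => [|i r IH].
  under eq_fun do rewrite big_nil.
  split; first exact: integrable0.
  move=> e e0; exists 1%R => // h _; rewrite /osc.
  by under eq_integral do rewrite subrr normr0; rewrite integral0 lee_fin ltW.
by under eq_fun do rewrite big_cons; exact: tcontD.
Qed.

(** The oscillation of [f] is at most that of [g N] plus twice the L^1 distance of [f] and [g N],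
    since translating both leaves their distance unchanged. Dominated convergence makes that
    distance small. *)
Lemma tcont_lim (g : nat -> T -> R) (f phi : T -> R) : (forall k, tcont (g k)) ->
  measurable_fun setT f -> mu.-integrable setT (EFin \o phi) ->
  (forall k x, `|g k x| <= phi x)%R -> (forall x, (g ^~ x) @ \oo --> f x) -> tcont f.
Proof.
move=> cg mf Iphi gphi gf.
have mg k : measurable_fun setT (g k) by apply: integrable_mfun; have [] := cg k.
have [||||| If cvg0 _] := @dominated_convergence _ _ _ mu setT measurableT
   (fun k x => (g k x)%:E) (EFin \o f) (EFin \o phi).
- by move=> k; exact/measurable_EFinP.
- exact/measurable_EFinP.
- by apply: aeW => x _; apply: cvg_EFin; [exact: nearW|exact: gf].
- by [].
- by apply: aeW => x k _ /=; rewrite lee_fin.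
split => // e e0; have e40 : (0 < e / 4)%R by rewrite divr_gt0.
move: cvg0 => /fine_cvgP[/= fin /cvgr0_norm_lt /(_ _ e40) small].
have [N [finN smallN]] : exists N : nat,
    \int[mu]_x `|(g N x)%:E - (f x)%:E| \is a fin_num /\
    (`|fine (\int[mu]_x `|(g N x)%:E - (f x)%:E|)| < e / 4)%R.
  by near \oo => N; exists N; split; near: N.
have gfN : \int[mu]_x (`|g N x - f x|)%:E <= (e / 4)%:E.
  under eq_integral do rewrite -abse_EFin EFinB.
  by rewrite -(fineK finN) lee_fin; exact: le_trans (ler_norm _) (ltW smallN).
have [_ /(_ _ e40)[d d0 Hd]] := cg N.
exists d => // h hd.
have mgf : measurable_fun setT (fun x => `|g N x - f x|%R).
  by apply: measurableT_comp => //; exact: measurable_funB.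
have mosc : measurable_fun setT (fun x => `|g N (tadd x h) - g N x|%R).
  apply: measurableT_comp => //; apply: measurable_funB => //.
  exact: (measurableT_comp (mg N) (measurable_taddr h)).
have mgfh : measurable_fun setT (fun x => `|g N (tadd x h) - f (tadd x h)|%R).
  exact: (measurableT_comp mgf (measurable_taddr h)).
apply: (@le_trans _ _ (\int[mu]_x (`|g N (tadd x h) - f (tadd x h)|)%:E +
   (osc (g N) h + \int[mu]_x (`|g N x - f x|)%:E))).
  rewrite /osc -!ge0_integralD//; try exact/measurable_EFinP.
  - apply: ge0_le_integralT => // x; rewrite -!EFinD lee_fin.
    rewrite (_ : (f _ - f x = - (g N (tadd x h) - f (tadd x h)) +
      ((g N (tadd x h) - g N x) + (g N x - f x)))%R); last by ring.
    apply: le_trans (ler_normD _ _) _; rewrite normrN lerD2l.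
    exact: ler_normD.
  - by move=> x _; rewrite adde_ge0.
  - by apply: emeasurable_funD; exact/measurable_EFinP.
rewrite (ge0_integral_translate mu_leb h (f := fun x => (`|g N x - f x|)%:E))//; last first.
  exact/measurable_EFinP.
apply: (@le_trans _ _ ((e / 4)%:E + ((e / 4)%:E + (e / 4)%:E))).
  by apply: leeD => //; apply: leeD => //; exact: Hd.
by rewrite -!EFinD lee_fin; lra.
Unshelve. all: by end_near. Qed.

Lemma mu_box_lt_pinfty (a b : T) : (forall i, tnth a i <= tnth b i)%R -> mu (box a b) < +oo.
Proof. by move=> ab; rewrite mu_leb// ltry. Qed.

Lemma integrable_indic_fin (A : set T) : measurable A -> mu A < +oo ->
  mu.-integrable setT (EFin \o \1_A).
Proof.
move=> mA Afin; apply/integrableP; split; first exact/measurable_EFinP.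
by under eq_integral do rewrite /= ger0_norm//; rewrite integral_indic// setIT.
Qed.

(* [box a b] and its translates all lie between an inner and an outer box. *)
Lemma tcont_box (a b : T) : (forall i, tnth a i <= tnth b i)%R -> tcont \1_(box a b).
Proof.
move=> ab; split; first exact: integrable_indic_fin (measurable_box _ _) (mu_box_lt_pinfty ab).
move=> e e0.
pose out d := (\prod_(i < n) (tnth b i + d - (tnth a i - d)))%R.
(* Volume of the shrunken box. The maximum keeps the factor nonnegative where a side is shorter than
   [2 * d]. *)
pose inn d := (\prod_(i < n) (Num.max (tnth a i + d) (tnth b i - d) - (tnth a i + d)))%R.
have cont : continuous (fun d => out d - inn d)%R.
  move=> x; apply: cvgB; apply: continuous_prod_ord => i {}x; apply: cvgB.
  - by apply: cvgD; [exact: cvg_cst|exact: cvg_id].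
  - by apply: cvgB; [exact: cvg_cst|exact: cvg_id].
  - apply: (@continuous_max _ _ (fun d => tnth a i + d)%R (fun d => tnth b i - d)%R).
      by apply: cvgD; [exact: cvg_cst|exact: cvg_id].
    by apply: cvgB; [exact: cvg_cst|exact: cvg_id].
  - by apply: cvgD; [exact: cvg_cst|exact: cvg_id].
have out0 : (out 0 - inn 0 = 0)%R.
  apply/eqP; rewrite subr_eq0; apply/eqP; apply: eq_bigr => i _.
  by rewrite !addr0 !subr0 (max_idPr (ab i)).
have /cvgr0_norm_lt /(_ e e0) /nbhs_ballP[d /= d0 Hd] :
    (out x - inn x)%R @[x --> 0%R] --> 0%R by rewrite -[X in _ --> X]out0; exact: cont.
exists (d / 2)%R => [|h hd]; first by rewrite divr_gt0.
set d' := (d / 2)%R in hd.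
have d'0 : (0 < d')%R by rewrite divr_gt0.
have {Hd} : (`|out d' - inn d'| < e)%R.
  apply: Hd; rewrite /ball/= sub0r normrN gtr0_norm// /d' ltr_pdivrMr//.
  by rewrite ltr_pMr// ltr1n.
move=> /(le_lt_trans (ler_norm _)) oie.
have hi i : (`|tnth h i| < d')%R.
  by apply: le_lt_trans hd; have := ler_normr_rv (rv h) i; rewrite mxE.
pose ao := [tuple tnth a i - d' | i < n]%R; pose bo := [tuple tnth b i + d' | i < n]%R.
pose ai := [tuple tnth a i + d' | i < n]%R.
pose bi := [tuple Num.max (tnth a i + d') (tnth b i - d') | i < n]%R.
have muo : mu (box ao bo) = (out d')%:E.
  rewrite mu_leb; last by move=> i; rewrite !tnth_mktuple; have := ab i; lra.
  by congr EFin; apply: eq_bigr => i _; rewrite !tnth_mktuple.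
have mui : mu (box ai bi) = (inn d')%:E.
  rewrite mu_leb; last by move=> i; rewrite !tnth_mktuple le_max lexx.
  by congr EFin; apply: eq_bigr => i _; rewrite !tnth_mktuple.
have inP x : box ai bi x -> forall i, (tnth a i + d' < tnth x i <= tnth b i - d')%R.
  move=> xi i; have := xi i; rewrite !tnth_mktuple => /andP[lo].
  by rewrite le_max leNgt lo /= => ->.
have in_out x y : (forall i, `|tnth y i - tnth x i| < d')%R -> box ai bi x -> box a b y.
  move=> yx /inP xi i; have := xi i; have := yx i.
  by rewrite ltr_distl => /andP[? ?] /andP[? ?]; apply/andP; split; lra.
have out_in x y : (forall i, `|tnth y i - tnth x i| < d')%R -> box a b y -> box ao bo x.
  move=> yx yi i; have := yi i; have := yx i; rewrite !tnth_mktuple.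
  by rewrite ltr_distl => /andP[? ?] /andP[? ?]; apply/andP; split; lra.
have xx (x : T) i : (`|tnth x i - tnth x i| < d')%R by rewrite subrr normr0.
have xh (x : T) i : (`|tnth (tadd x h) i - tnth x i| < d')%R.
  by rewrite tnth_mktuple addrAC subrr add0r.
(* On the inner box the indicator does not oscillate, and outside the outer box it vanishes together
   with its translate; so the oscillation is at most the difference of the two volumes, which is
   below [e]. *)
suff : osc \1_(box a b) h + mu (box ai bi) <= mu (box ao bo).
  rewrite muo mui -leeBrDr// => /le_trans; apply.
  by rewrite -EFinB lee_fin ltW.
have m1 A : measurable A -> measurable_fun setT (fun x : T => (\1_A x : R)%:E).
  by move=> mA; exact/measurable_EFinP.
have mB := measurable_box a b.
rewrite -(setIT (box ai bi)) -(setIT (box ao bo)) -!integral_indic//; try exact: measurable_box.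
rewrite /osc -ge0_integralD//; last 2 first.
- apply/measurable_EFinP; apply: measurableT_comp => //; apply: measurable_funB => //.
  by apply: (measurableT_comp _ (measurable_taddr h)).
- by apply: m1; exact: measurable_box.
apply: ge0_le_integralT => x; rewrite -EFinD lee_fin; first by rewrite addr_ge0.
rewrite [\1_(box ai bi) x]indicE; case: (boolP (x \in box ai bi)) => [/set_mem xin|_].
  have Bx := in_out _ _ (xx x) xin; have Bxh := in_out _ _ (xh x) xin.
  by rewrite !indicE !mem_set// ?subrr ?normr0 ?add0r//; exact: out_in Bx.
rewrite addr0 [\1_(box ao bo) x]indicE; case: (boolP (x \in box ao bo)) => [_|/negP xout].
  by rewrite !indicE; do 2 case: (_ \in _); rewrite ?subrr ?normr0 ?subr0 ?sub0r ?normrN ?normr1.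
have Bx : ~ box a b x by move=> Bx; apply: xout; apply/mem_set; exact: out_in Bx.
have Bxh : ~ box a b (tadd x h) by move=> Bx'; apply: xout; apply/mem_set; exact: out_in Bx'.
by rewrite !indicE !memNset// subrr normr0.
Qed.

(** Intersecting with [cbox k] keeps the measures finite, which complements alone would not allow in
    Dynkin's induction. *)
Lemma tcont_indic (A : set T) k : measurable A -> tcont \1_(A `&` cbox k).
Proof.
have cboxP : (forall i, tnth [tuple - k%:R | i < n] i <= tnth [tuple k%:R | i < n] i :> R)%R.
  by move=> i; rewrite !tnth_mktuple; apply: le_trans (ler0n _ _); rewrite oppr_le0.
have cC : tcont \1_(cbox k) by exact: tcont_box.
have mC : measurable (cbox k : set T) by exact: measurable_box.
have [IC _] := cC.
move=> mA; have := mA; rewrite measurable_boxes.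
apply: (dynkin_induction (measurable_boxes R n) (@boxes_setI R n)
  (P := fun A => tcont \1_(A `&` cbox k))); first by rewrite setTI.
- move=> B bB; have [a [b [ab ->]]] := boxes_setI bB (cboxes R n k).
  exact: tcont_box.
- move=> B mB cB; rewrite (_ : \1_(~` B `&` cbox k) =
    (\1_(cbox k) \+ (fun x => -1 * \1_(B `&` cbox k) x))%R).
    by apply: tcontD => //; exact: tcontZ.
  apply/funext => x; rewrite /= !indicE !in_setI in_setC.
  by do 2 case: (_ \in _) => /=; ring.
- move=> F mF tF cF.
  (* The disjoint sets are added one at a time; the countable union is then a limit dominated by the
     indicator of the cube. *)
  pose U m : set T := [set x | exists2 j, (j < m)%N & F j x].
  have mU m : measurable (U m).
    rewrite (_ : U m = \bigcup_(j in `I_m) F j); first exact: bigcup_measurable.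
    by apply/seteqP; split => x [j]; exists j.
  have cU m : tcont \1_(U m `&` cbox k).
    elim: m => [|m IH].
      rewrite (_ : \1_(U 0%N `&` cbox k) = fun x => 0 * \1_(cbox k) x)%R; first exact: tcontZ.
      by apply/funext => x; rewrite mul0r indicE memNset// => -[[]].
    rewrite (_ : \1_(U m.+1 `&` cbox k) =
       \1_(U m `&` cbox k) \+ \1_(F m `&` cbox k))%R; first exact: tcontD.
    apply/funext => x /=; rewrite !indicE !in_setI.
    case: (x \in cbox k); rewrite ?andbF ?addr0// !andbT.
    have [/set_mem Fm|/negP Fm] := boolP (x \in F m).
      rewrite mem_set; last by exists m.
      rewrite memNset ?add0r// => -[j jm Fj].
      by have := tF j m Logic.I Logic.I (ex_intro _ x (conj Fj Fm)) => E; rewrite E ltnn in jm.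
    rewrite addr0; suff -> : (x \in U m.+1) = (x \in U m) by [].
    apply/idP/idP => /set_mem[j jm Fj]; apply/mem_set.
      exists j => //; move: jm; rewrite ltnS leq_eqVlt => /predU1P[E|//].
      by case: Fm; apply/mem_set; rewrite -E.
    by exists j => //; exact: ltnW.
  apply: (@tcont_lim (fun m => \1_(U m `&` cbox k)) _ \1_(cbox k)) => //.
  + by apply: measurable_indic; apply: measurableI => //; exact: bigcupT_measurable.
  + by move=> m x; rewrite !indicE in_setI; do 2 case: (_ \in _); rewrite ?normr0 ?normr1.
  + move=> x; have [[j _ Fj]|nF] := pselect ((\bigcup_j F j) x).
      apply: cvg_near_cst; near=> m; rewrite !indicE !in_setI [in RHS]mem_set; last by exists j.
      by rewrite mem_set//; exists j => //; near: m; exact: nbhs_infty_gt.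
    apply: cvg_near_cst; apply: nearW => m; rewrite !indicE !in_setI.
    have nU : ~ U m x by move=> -[j _ Fj]; apply: nF; exists j.
    by rewrite (memNset nU) (memNset nF).
Unshelve. all: by end_near. Qed.

Import HBNNSimple.

Lemma tcont_integrable (f : T -> R) : (forall x, 0 <= f x)%R ->
  mu.-integrable setT (EFin \o f) -> tcont f.
Proof.
move=> f0 If; have mf := integrable_mfun If.
have mEf : measurable_fun setT (EFin \o f) by exact/measurable_EFinP.
pose s := nnsfun_approx measurableT mEf.
have f0' x : [set: T] x -> 0 <= (EFin \o f) x by rewrite lee_fin.
have sf m x : (s m x <= f x)%R.
  by rewrite -lee_fin /s nnsfun_approxE; exact: le_approx.
have cvs x : (s ^~ x) @ \oo --> f x.
  by have /fine_cvgP[] := cvg_nnsfun_approx measurableT mEf f0' (x := x) Logic.I.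
apply: (@tcont_lim (fun m x => s m x * \1_(cbox m) x)%R _ f) => //.
- move=> m.
  rewrite (_ : (fun x => _) = fun x => \sum_(y <- finmap.enum_fset (fset_set (range (s m))))
      y * \1_(s m @^-1` [set y] `&` cbox m) x)%R.
    apply: tcont_sum => y; apply: tcontZ; apply: tcont_indic.
    exact: measurable_sfunP.
  apply/funext => x; rewrite fimfunE fsbig_finite//= mulr_suml.
  by apply: eq_bigr => y _; rewrite -mulrA indicI.
- move=> m x; rewrite ger0_norm; last by rewrite mulr_ge0.
  apply: le_trans (sf m x); rewrite ler_piMr// indicE; by case: (_ \in _).
- move=> x; rewrite -[f x]mulr1; apply: cvgM; first exact: cvs.
  apply: cvg_near_cst; have [k xk] := tuple_bounded x.
  near=> m; rewrite indicE mem_set// => i; rewrite !tnth_mktuple.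
  have := lt_le_trans (xk i) (_ : k%:R <= m%:R)%R; rewrite ler_nat.
  have km : (k <= m)%N by near: m; exact: nbhs_infty_ge.
  by move=> /(_ km); rewrite ltr_norml => /andP[-> /ltW ->].
Unshelve. all: by end_near. Qed.

(* Along translations chosen with [osc f (h_ k) <= 2^-k] the oscillations are summable. *)
Lemma cvg_translate_ae (f : T -> R) (P : T -> Prop) : (forall x, 0 <= f x)%R ->
    mu.-integrable setT (EFin \o f) ->
    (forall e : R, (0 < e)%R -> exists2 h, P h & (`|rv h| < e)%R) ->
  exists h_ : nat -> T, (forall k, P (h_ k)) /\
    {ae mu, forall x, (fun k => f (tadd x (h_ k))) @ \oo --> f x}.
Proof.
move=> f0 If exP; have [_ tf] := tcont_integrable f0 If; have mf := integrable_mfun If.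
have /choice[h_ hP] : forall k : nat, exists h, P h /\ osc f h <= ((2^-1) ^+ k)%:E.
  move=> k; have [|d d0 Hd] := tf ((2^-1) ^+ k)%R; first by rewrite exprn_gt0.
  by have [h Ph hd] := exP d d0; exists h; split; [|exact: Hd].
exists h_; split; first by move=> k; have [] := hP k.
pose D k x := (`|f (tadd x (h_ k)) - f x|)%R.
have mD k : measurable_fun setT (fun x => (D k x)%:E).
  apply/measurable_EFinP; apply: measurableT_comp => //; apply: measurable_funB => //.
  exact: (measurableT_comp mf (measurable_taddr (h_ k))).
(* A sum of nonnegative functions with summable integrals is finite almost everywhere, and there its
   terms tend to 0. *)
have IS : mu.-integrable setT (fun x => \sum_(0 <= k <oo) (D k x)%:E).
  apply/integrableP; split.
    by apply: ge0_emeasurable_sum => [k x _ _|k _]; [rewrite lee_fin normr_ge0|exact: mD].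
  under eq_integral => x _ do
    (rewrite gee0_abs; last by apply: nneseries_ge0 => k _ _; rewrite lee_fin normr_ge0).
  rewrite integral_nneseries//; last by move=> k x _; rewrite lee_fin normr_ge0.
  apply: (@le_lt_trans _ _ (\sum_(0 <= k <oo) (1 * (2^-1) ^+ k)%:E)).
    apply: lee_nneseries => [k _ _|k _].
      by apply: integral_ge0 => x _; rewrite lee_fin normr_ge0.
    by rewrite mul1r; have [] := hP k.
  apply: le_lt_trans (nneseries_geometric_le _ _) (ltry _) => //.
  by rewrite invr_gt0 ltr0n invf_lt1//= ltr1n.
have := integrable_ae measurableT IS; apply: filterS => x /(_ Logic.I) fS.
have D0 k : (0 <= D k x)%R by exact: normr_ge0.
suff /cvg_series_cvg_0 D_0 : cvgn (series (D ^~ x)).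
  apply/subr_cvg0. apply: norm_cvg0. exact: D_0.
apply: nondecreasing_is_cvgn.
  by apply/nondecreasing_seqP => m; rewrite -subr_ge0 seriesSB D0.
exists (fine (\sum_(0 <= k <oo) (D k x)%:E)) => _ [m _ <-].
rewrite -lee_fin fineK// /series/= -sumEFin.
by apply: nneseries_lim_ge => k _ _; rewrite lee_fin.
Qed.

End translation_continuity.

(** * Mollification *)

Section smooth_bump.
Context (R : realType).

Lemma exprn_expRN_le (y : R) k : 0 <= y -> y ^+ k * expR (- y) <= k`!%:R.
Proof.
move=> y0; rewrite expRN ler_pdivrMr ?expR_gt0//.
case: k => [|k]; first by rewrite expr0 fact0 mul1r -expR0 ler_expR.
rewrite -ler_pdivrMl ?ltr0n ?fact_gt0// mulrC.
by apply: le_trans (expR_ge1Dxn k y0); rewrite lerDr.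
Qed.

Lemma horner_expRN_le (P : {poly R}) :
  exists2 C, 0 <= C & forall y, 0 <= y -> `|P.[y]| * expR (- y) <= C.
Proof.
exists (\sum_(i < size P) `|P`_i| * i`!%:R) => [|y y0].
  by apply: sumr_ge0 => i _; rewrite mulr_ge0.
rewrite horner_coef; apply: le_trans (_ : (\sum_(i < size P) `|P`_i * y ^+ i|) * expR (- y) <= _).
  by rewrite ler_wpM2r ?expR_ge0// ler_norm_sum.
rewrite mulr_suml; apply: ler_sum => i _.
rewrite normrM (ger0_norm (exprn_ge0 _ y0)) -mulrA ler_wpM2l//.
exact: exprn_expRN_le.
Qed.

(** The classical flat function at 0 with a polynomial in [1/t] as parameter: this family is closed
    under differentiation, [dflat] being the effect of the chain rule on the polynomial. *)
Definition flat (P : {poly R}) (t : R) : R :=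
  if 0 < t then P.[t^-1] * expR (- t^-1) else 0.

Definition dflat (P : {poly R}) : {poly R} := (P - P^`()) * 'X^2.

Lemma flat_bounded P : exists2 C, 0 <= C & forall t, `|flat P t| <= C.
Proof.
have [C C0 CP] := horner_expRN_le P; exists C => // t; rewrite /flat.
case: ifP => t0; last by rewrite normr0.
by rewrite normrM (ger0_norm (expR_ge0 _)) CP// invr_ge0 ltW.
Qed.

(** Boundedness for the polynomial [P * 'X^2] gives quadratic decay for [P], hence a vanishing
    derivative at 0. *)
Lemma flat_flat P : exists2 C, 0 <= C & forall t, `|flat P t| <= C * t ^+ 2.
Proof.
have [C C0 CP] := flat_bounded (P * 'X^2); exists C => // t.
have := CP t; rewrite /flat; case: ifP => t0; last by rewrite normr0 mulr_ge0// sqr_ge0.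
rewrite hornerM hornerXn mulrAC exprVn normrM [X in _ * X]gtr0_norm ?invr_gt0 ?exprn_gt0//.
by rewrite ler_pdivrMr ?exprn_gt0.
Qed.

Lemma flatN P t : flat (- P) t = - flat P t.
Proof. by rewrite /flat; case: ifP => _; rewrite ?oppr0// hornerN mulNr. Qed.

Lemma is_derive_flat P (t : R) : is_derive t 1 (flat P) (flat (dflat P) t).
Proof.
have [t0|t0|->] := ltgtP t 0.
- rewrite [flat _ t]/flat ltNge (ltW t0)/=.
  apply: (@near_eq_is_derive _ _ _ (cst 0)); near=> x.
  rewrite /flat ltNge ltW//=; near: x; exact: lt_nbhsl.
- rewrite [flat _ t]/flat t0.
  apply: (@near_eq_is_derive _ R^o R^o (fun t => P.[t^-1] * expR (- t^-1))).
    by near=> x; rewrite /flat ifT//; near: x; exact: lt_nbhsr.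
  have dV : is_derive t 1 (fun x : R => x^-1) (- t ^- 2 *: 1).
    exact: is_deriveV (lt0r_neq0 t0) _.
  have dP : is_derive t 1 (fun x => P.[x^-1]) (P^`().[t^-1] * (- t ^- 2 *: 1)).
    exact: (@is_derive1_comp _ (horner P) (fun x => x^-1)).
  have dE : is_derive t 1 (fun x => expR (- x^-1)) (expR (- t^-1) * (- (- t ^- 2 *: 1))).
    exact: (@is_derive1_comp _ expR (fun x => - x^-1)).
  apply: is_derive_eq (is_deriveM dP dE) _.
  rewrite /dflat hornerM hornerXn hornerD hornerN exprVn /GRing.scale/=; ring.
- have [C C0 CP] := flat_flat P.
  rewrite [flat (dflat P) 0]/flat ltxx.
  have cv : h^-1 *: (flat P (h *: 1 + 0) - flat P 0) @[h --> 0^'] --> (0 : R).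
    have f0 : flat P 0 = 0 by rewrite /flat ltxx.
    apply/cvgr0Pnorm_le => e e0; near=> h.
    have h0 : h != 0 by near: h; exact: nbhs_dnbhs_neq.
    rewrite f0 subr0 addr0 [h *: 1]mulr1 normrM normfV.
    rewrite ler_pdivrMl ?normr_gt0//; apply: le_trans (CP h) _.
    rewrite -(real_normK (num_real h)) expr2 mulrA [leRHS]mulrC ler_pM2r ?normr_gt0//.
    have : `|h| <= e / (C + 1).
      near: h; apply: dnbhs0_le; rewrite divr_gt0// ltr_wpDl//.
    rewrite ler_pdivlMr ?ltr_wpDl// mulrDr mulr1 mulrC => /(le_trans _) -> //.
    by rewrite lerDl.
  by apply: DeriveDef; [apply/cvg_ex; exists 0|exact: cvg_lim cv].
Unshelve. all: by end_near. Qed.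

Lemma bounded_derive_lipschitz (f df : R -> R) (C : R) : (forall t : R, is_derive t 1 f (df t)) ->
  (forall t, `|df t| <= C) -> forall a b, `|f a - f b| <= C * `|a - b|.
Proof.
move=> fdf dfC.
have main a b : a < b -> `|f b - f a| <= C * `|b - a|.
  move=> ab; have [|c _ ->] := @MVT _ f df a b ab (fun x _ => fdf x).
    by apply: derivable_within_continuous => x _; have [] := fdf x.
  by rewrite normrM ler_wpM2r.
move=> a b; have [ab|ab|->] := ltgtP a b; last by rewrite !subrr normr0 mulr0.
  by rewrite distrC (distrC a); exact: main.
exact: main.
Qed.

(** Sums of products are kept as lists because differentiation turns each product into two. Each
    factor vanishes on one side, so the support lies in [[-1, 1]]; the list [[:: (1, 1)]] gives the
    standard bump exp(-2/(1-t^2)). *)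
Definition bump (L : seq ({poly R} * {poly R})) (t : R) : R :=
  \sum_(p <- L) flat p.1 (1 + t) * flat p.2 (1 - t).

Definition dbump (L : seq ({poly R} * {poly R})) :=
  flatten [seq [:: (dflat p.1, p.2); (p.1, - dflat p.2)] | p <- L].

Lemma is_derive_bump L (t : R) : is_derive t 1 (bump L) (bump (dbump L) t).
Proof.
elim: L => [|p L IH].
  rewrite /dbump /bump/= big_nil; under eq_fun do rewrite big_nil.
  exact: is_derive_cst.
have -> : bump (p :: L) = (fun t => flat p.1 (1 + t) * flat p.2 (1 - t)) + bump L.
  by apply/funext => x; rewrite /bump big_cons.
rewrite /dbump /= /bump !big_cons -/(dbump L) -/(bump _ t) addrA.
apply: is_deriveD.
have d1 : is_derive t 1 (fun x => flat p.1 (1 + x)) (flat (dflat p.1) (1 + t) * 1).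
  apply: (@is_derive1_comp _ (flat p.1) (fun x => 1 + x)); first exact: is_derive_flat.
  by apply: is_derive_eq (is_deriveD (is_derive_cst _ _ _) (is_derive_id _ _)) _; rewrite add0r.
have d2 : is_derive t 1 (fun x => flat p.2 (1 - x)) (flat (dflat p.2) (1 - t) * - 1).
  apply: (@is_derive1_comp _ (flat p.2) (fun x => 1 - x)); first exact: is_derive_flat.
  by apply: is_derive_eq (is_deriveB (is_derive_cst _ _ _) (is_derive_id _ _)) _; rewrite sub0r.
apply: is_derive_eq (is_deriveM d1 d2) _.
by rewrite flatN /GRing.scale/=; ring.
Qed.

Lemma bump_bounded L : exists2 C, 0 <= C & forall t, `|bump L t| <= C.
Proof.
elim: L => [|p L [C C0 CP]].
  by exists 0 => // t; rewrite /bump big_nil normr0.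
have [C1 C10 CP1] := flat_bounded p.1; have [C2 C20 CP2] := flat_bounded p.2.
exists (C1 * C2 + C) => [|t]; first by rewrite addr_ge0// mulr_ge0.
rewrite /bump big_cons; apply: le_trans (ler_normD _ _) _.
rewrite lerD //; last exact: CP.
by rewrite normrM ler_pM.
Qed.

Lemma bump_support L t : 1 <= `|t| -> bump L t = 0.
Proof.
move=> t1; rewrite /bump big1// => p _; rewrite /flat.
move: t1; rewrite ler_normr => /orP[t1|t1].
  by rewrite [0 < 1 - t]ltNge subr_le0 t1 mulr0.
by rewrite [0 < 1 + t]ltNge -[1 + t]opprK oppr_le0 opprD addrC subr_ge0 t1 mul0r.
Qed.

Lemma bump1_gt0 t : `|t| < 1 -> 0 < bump [:: (1, 1)] t.
Proof.
rewrite ltr_norml => /andP[t1 t2]; rewrite /bump big_seq1/= /flat.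
have [h1 h2] : 0 < 1 + t /\ 0 < 1 - t by split; lra.
by rewrite h1 h2 -polyC1 !hornerC !mul1r mulr_gt0 ?expR_gt0.
Qed.

End smooth_bump.

(** * Bounded Lipschitz functions and product mollifiers *)

Section bounded_lipschitz.
Context (R : realType) (n : nat).
Implicit Types f g : 'rV[R]_n -> R.

Definition bdd_lip f := exists2 C, 0 <= C &
  (forall x, `|f x| <= C) /\ (forall x y, `|f x - f y| <= C * `|x - y|).

Lemma bdd_lipM f g : bdd_lip f -> bdd_lip g -> bdd_lip (fun x => f x * g x).
Proof.
move=> [C C0 [bf lf]] [D D0 [bg lg]]; exists (2 * (C * D)).
  by rewrite !mulr_ge0.
split=> [x|x y].
  by rewrite normrM (le_trans (ler_pM _ _ (bf x) (bg x)))// ler_peMl ?mulr_ge0// ler1n.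
have -> : f x * g x - f y * g y = f x * (g x - g y) + (f x - f y) * g y by ring.
have -> : 2 * (C * D) * `|x - y| = C * (D * `|x - y|) + C * `|x - y| * D by ring.
by apply: le_trans (ler_normD _ _) _; rewrite lerD// normrM ler_pM.
Qed.

Lemma bdd_lip_cst c : bdd_lip (fun=> c).
Proof.
by exists `|c| => //; split => // x y; rewrite subrr normr0 mulr_ge0.
Qed.

Lemma bdd_lip_prod m (F : 'I_m -> 'rV[R]_n -> R) : (forall i, bdd_lip (F i)) ->
  bdd_lip (fun x => \prod_(i < m) F i x).
Proof.
elim: m F => [|m IH] F HF.
  by under eq_fun do rewrite big_ord0; exact: bdd_lip_cst.
under eq_fun do rewrite big_ord_recl; apply: bdd_lipM; first exact: HF.
by apply: (IH (fun i => F (lift ord0 i))) => i; exact: HF.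
Qed.

Lemma bdd_lip_continuous f : bdd_lip f -> continuous f.
Proof.
move=> [C C0 [_ lf]] x; apply/(@cvgrPdist_le _ _ _ _ (nbhs_filter x)) => e e0.
apply/nbhs_ballP; exists (e / (C + 1)) => [|y]; first by rewrite /= divr_gt0// ltr_wpDl.
rewrite mx_norm_ball /ball_/= ltr_pdivlMr ?ltr_wpDl// mulrDr mulr1 mulrC => /ltW xy; apply: le_trans (lf x y) _.
by apply: le_trans xy; rewrite lerDl.
Qed.

End bounded_lipschitz.

Section mollifier.
Context (R : realType) (n : nat) (eps : R).
Hypothesis eps0 : 0 < eps.

Definition moll1 (k : nat) (t : R) : R :=
  (eps^-1) ^+ k * bump (iter k (@dbump R) [:: (1, 1)]) (eps^-1 * t).

(** The mixed partial derivative with multi-index [m] of a product kernel supported in a cube of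
    radius [eps]. The kernel is not normalised to integral 1, as only the signs of averages
    matter. *)
Definition moll (m : 'I_n -> nat) (v : 'rV[R]_n) : R := \prod_(i < n) moll1 (m i) (v ord0 i).

Lemma is_derive_moll1 k (t : R) : is_derive t 1 (moll1 k) (moll1 k.+1 t).
Proof.
set L := iter k (@dbump R) [:: (1, 1)].
have d1 : is_derive t 1 (fun t => eps^-1 * t) eps^-1.
  apply: is_derive_eq (is_deriveZ eps^-1 (is_derive_id _ _)) _.
  by rewrite /GRing.scale/= mulr1.
have d2 : is_derive t 1 (bump L \o (fun t => eps^-1 * t))
    (bump (dbump L) (eps^-1 * t) * eps^-1).
  by apply: (@is_derive1_comp _ (bump L)); exact: is_derive_bump.
apply: is_derive_eq (is_deriveZ (eps^-1 ^+ k) d2) _.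
by rewrite /moll1 exprS /GRing.scale/= -/L; ring.
Qed.

Lemma moll1_bounded k : exists2 C, 0 <= C & forall t, `|moll1 k t| <= C.
Proof.
have [C C0 HC] := bump_bounded (iter k (@dbump R) [:: (1, 1)]).
exists (`|(eps^-1) ^+ k| * C) => [|t]; first by rewrite mulr_ge0.
by rewrite normrM ler_wpM2l.
Qed.

Lemma moll_bdd_lip m : bdd_lip (moll m).
Proof.
apply: bdd_lip_prod => i.
have [C C0 HC] := moll1_bounded (m i); have [D D0 HD] := moll1_bounded (m i).+1.
exists (C + D); first exact: addr_ge0.
split => [x|x y]; first by apply: le_trans (HC _) _; rewrite lerDl.
apply: le_trans (bounded_derive_lipschitz (@is_derive_moll1 _) HD _ _) _.
apply: ler_pM => //; first by rewrite lerDr.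
by have := ler_normr_rv (x - y) i; rewrite !mxE.
Qed.

Lemma moll_support m v : eps <= `|v| -> moll m v = 0.
Proof.
move=> ev; have [i iv] : exists i, eps <= `|v ord0 i|.
  apply: contrapT => /forallNP H; move: ev; rewrite leNgt => /negP; apply.
  by apply/normr_rvP => // i; rewrite ltNge; apply/negP; exact: H.
rewrite /moll (bigD1 i)//= /moll1 bump_support ?mulr0 ?mul0r//.
by rewrite normrM gtr0_norm ?invr_gt0// ler_pdivlMl// mulr1.
Qed.

Lemma moll_gt0 v : `|v| < eps -> 0 < moll (fun=> 0%N) v.
Proof.
move=> /normr_rvP H; apply: prodr_gt0 => i _; rewrite /moll1 expr0 mul1r; apply: bump1_gt0.
by rewrite normrM gtr0_norm ?invr_gt0// ltr_pdivrMl// mulr1; exact: H.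
Qed.

Lemma moll_ge0 v : 0 <= moll (fun=> 0%N) v.
Proof.
by have [/moll_gt0/ltW//|/(moll_support _)->] := ltP `|v| eps.
Qed.

Lemma is_derive_moll m i v (t : R) :
  is_derive t 1 (fun t => moll m (v + t *: ebasis R i))
    (moll (fun j => (m j + (j == i))%N) (v + t *: ebasis R i)).
Proof.
have E x j : (v + x *: ebasis R i) ord0 j = v ord0 j + x * (j == i)%:R.
  by rewrite !mxE eqxx.
set c := \prod_(j < n | j != i) moll1 (m j) (v ord0 j).
have mE m' x : (forall j, j != i -> m' j = m j) ->
    moll m' (v + x *: ebasis R i) = c * moll1 (m' i) (v ord0 i + x).
  move=> m'm; rewrite /moll (bigD1 i)//= E eqxx mulr1 mulrC; congr (_ * _).
  by apply: eq_bigr => j ji; rewrite E (negbTE ji) mulr0 addr0 m'm.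
have -> : (fun t => moll m (v + t *: ebasis R i)) = (fun x => c *: moll1 (m i) (v ord0 i + x)).
  by apply/funext => x; rewrite mE.
rewrite mE; last by move=> j /negbTE ->; rewrite addn0.
rewrite eqxx addn1.
have d1 : is_derive t 1 (fun t => v ord0 i + t) 1.
  by apply: is_derive_eq (is_deriveD (is_derive_cst _ _ _) (is_derive_id _ _)) _; rewrite add0r.
have d2 : is_derive t 1 (moll1 (m i) \o (fun t => v ord0 i + t))
   (moll1 (m i).+1 (v ord0 i + t) * 1).
  by apply: (@is_derive1_comp _ (moll1 (m i))); exact: is_derive_moll1.
by apply: is_derive_eq (is_deriveZ c d2) _; rewrite mulr1.
Qed.

End mollifier.

(** * Convolution with the mollifier gives test functions *)

Section convolution.
Context (R : realType) (n : nat).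
Local Notation T := (n.-tuple R).
Variable mu : {sigma_finite_measure set T -> \bar R}.
Variable phi : T -> R.
Hypothesis Iphi : mu.-integrable setT (EFin \o phi).

(** The argument is [rv y - x] so that the substitution y = x + h exhibits an average of the
    translates phi(x + h). The price is a minus sign for each derivative. *)
Definition conv (psi : 'rV[R]_n -> R) (x : 'rV[R]_n) : R :=
  \int[mu]_y (phi y * psi (rv y - x)).

Lemma bdd_lip_shift (psi : 'rV[R]_n -> R) x : bdd_lip psi -> bdd_lip (fun v => psi (v - x)).
Proof.
move=> [C C0 [bp lp]]; exists C => //; split=> // y z.
by apply: le_trans (lp _ _) _; rewrite opprB addrA subrK.
Qed.

Lemma measurable_shift (psi : 'rV[R]_n -> R) x : bdd_lip psi ->
  measurable_fun setT (fun y : T => psi (rv y - x)).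
Proof.
move=> /(bdd_lip_shift x) /bdd_lip_continuous /measurable_continuous_rv; exact.
Qed.

Lemma integrable_conv (psi : 'rV[R]_n -> R) x : bdd_lip psi ->
  mu.-integrable setT (fun y => (phi y * psi (rv y - x))%:E).
Proof.
move=> blp; have [C C0 [bp _]] := blp; have mphi := integrable_mfun Iphi.
apply: (@le_integrable _ _ _ mu setT measurableT _ (fun y => C%:E * (EFin \o phi) y)%E).
- by apply/measurable_EFinP; apply: measurable_funM => //; exact: measurable_shift.
- by move=> y _; rewrite /= lee_fin !normrM mulrC ler_wpM2r// (ger0_norm C0).
- exact: integrableZl.
Qed.

Lemma conv_bdd_lip (psi : 'rV[R]_n -> R) : bdd_lip psi -> bdd_lip (conv psi).
Proof.
move=> blp; have [C C0 [bp lp]] := blp; have mphi := integrable_mfun Iphi.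
set I := \int[mu]_y `|phi y|.
have Iabs : mu.-integrable setT (EFin \o (fun y => `|phi y|)).
  by have := integrable_abse Iphi.
have I0 : 0 <= I by apply: Rintegral_ge0.
have key D (f : T -> R) : mu.-integrable setT (EFin \o f) ->
    (forall y, `|f y| <= D * `|phi y|) -> `|\int[mu]_y f y| <= D * I.
  move=> If fD; apply: le_trans (le_normr_Rintegral _ _) _ => //.
  rewrite -RintegralZl//; apply: le_Rintegral => //.
  - by have := integrable_abse If.
  - by have := integrableZl measurableT D Iabs.
exists (C * I); first exact: mulr_ge0.
split=> [x|x y].
  apply: key => [|y]; first exact: integrable_conv.
  by rewrite normrM mulrC ler_wpM2r.
rewrite /conv -RintegralB//; [|exact: integrable_conv..].
rewrite mulrAC; apply: key => [|z].
  have := integrableB measurableT (integrable_conv x blp) (integrable_conv y blp).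
  by apply: eq_integrable => // z _.
rewrite -mulrBr normrM mulrC ler_wpM2r//; apply: le_trans (lp _ _) _.
by rewrite ler_wpM2l// opprB addrC addrA subrK distrC.
Qed.

(** Differentiation under the integral sign along the line x + t e; a bound [D] of the derivative
    gives the integrable majorant [D * |phi|]. *)
Lemma is_derive_conv (psi psi' : 'rV[R]_n -> R) (e x : 'rV[R]_n) :
  bdd_lip psi -> bdd_lip psi' ->
  (forall v (t : R), is_derive t 1 (fun t => psi (v + t *: e)) (psi' (v + t *: e))) ->
  is_derive x e (conv psi) (- conv psi' x).
Proof.
move=> blp blp' dpsi; have [D D0 [bp' _]] := blp'.
have mphi := integrable_mfun Iphi.
pose f (t : R) (y : T) := phi y * psi (rv y - (x + t *: e)).
have df t y : is_derive t (1 : R) (f ^~ y) (- (phi y * psi' (rv y - (x + t *: e)))).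
  have dN : is_derive t (1 : R) (fun t : R => - t) (- 1) by exact: is_deriveNid.
  have sh u : rv y - (x + u *: e) = (rv y - x) + (- u) *: e.
    by rewrite opprD addrA scaleNr.
  have d1 : is_derive t (1 : R) (fun t => psi ((rv y - x) + (- t) *: e))
      (psi' ((rv y - x) + (- t) *: e) * - 1).
    exact: (@is_derive1_comp _ (fun t => psi ((rv y - x) + t *: e)) (fun t => - t)).
  have -> : f ^~ y = (fun u => phi y *: psi ((rv y - x) + (- u) *: e)).
    by apply/funext => u; rewrite /f sh.
  apply: is_derive_eq (is_deriveZ (phi y) d1) _.
  by rewrite sh /GRing.scale/=; ring.
have d1f t y : partial1of2 f t y = - (phi y * psi' (rv y - (x + t *: e))).
  by rewrite partial1of2E; have [] := df t y.
have Iabs : mu.-integrable setT (EFin \o (fun y => D * `|phi y|)).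
  by have := integrableZl measurableT D (integrable_abse Iphi).
have cv := @cvg_differentiation_under_integral R _ T mu f setT measurableT 0 (-1) 1.
have {cv} : h^-1 *: (conv psi (h *: e + x) - conv psi x) @[h --> 0^'] --> - conv psi' x.
  have -> : (fun h : R => h^-1 *: (conv psi (h *: e + x) - conv psi x)) =
      (fun h : R => h^-1 *: (\int[mu]_y f (h + 0) y - \int[mu]_y f 0 y)).
    by apply/funext => h; rewrite /f addr0 scale0r addr0 [h *: e + x]addrC.
  have -> : - conv psi' x = \int[mu]_y partial1of2 f 0 y.
    under eq_Rintegral do rewrite d1f scale0r addr0 -mulN1r.
    by rewrite RintegralZl// ?mulN1r//; exact: integrable_conv.
  apply: (cv _ _ _ (fun y => D * `|phi y|)) => //.
  - by rewrite /= in_itv/= ltrN10 ltr01.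
  - by move=> t _; exact: integrable_conv.
  - by move=> y; rewrite mulr_ge0.
  - by move=> t y _ _; rewrite d1f normrN normrM mulrC ler_wpM2r.
move=> cv; apply: DeriveDef; first by apply/cvg_ex; exists (- conv psi' x).
exact: cvg_lim cv.
Qed.

Variables (eps : R) (eps0 : 0 < eps).

(** An iterated partial derivative of the kernel depends only on how often each index occurs, so
    counting in [l] gives the multi-index. *)
Lemma pder_conv l : pder l (conv (moll eps (fun=> 0%N))) =
  (fun x => (-1) ^+ size l * conv (moll eps (fun j => count_mem j l)) x).
Proof.
elim: l => [|i l IH]; first by apply/funext => x; rewrite expr0 mul1r.
apply/funext => x; rewrite /= IH.
have -> : (fun j => count_mem j (i :: l)) = (fun j => (count_mem j l + (j == i))%N).
  by apply/funext => j /=; rewrite addnC eq_sym.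
have d := @is_derive_conv _ _ (ebasis R i) x (moll_bdd_lip eps (fun j => count_mem j l))
  (moll_bdd_lip eps (fun j => (count_mem j l + (j == i))%N))
  (fun v t => is_derive_moll eps (fun j => count_mem j l) i v t).
have [_ ->] := is_deriveZ ((-1) ^+ size l) d.
by rewrite exprS mulN1r mulNr /GRing.scale/= mulrN.
Qed.

Lemma smooth_conv : smooth (conv (moll eps (fun=> 0%N))).
Proof.
move=> l; rewrite pder_conv; split.
  by apply/bdd_lip_continuous/bdd_lipM/conv_bdd_lip/moll_bdd_lip; exact: bdd_lip_cst.
move=> i x.
have d := @is_derive_conv _ _ (ebasis R i) x (moll_bdd_lip eps (fun j => count_mem j l))
  (moll_bdd_lip eps (fun j => (count_mem j l + (j == i))%N))
  (fun v t => is_derive_moll eps (fun j => count_mem j l) i v t).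
by have [+ _] := is_deriveZ ((-1) ^+ size l) d.
Qed.

Lemma testfun_conv (Om K : set 'rV[R]_n) (S : set T) : compact K -> K `<=` Om ->
  (forall x, ~ S x -> phi x = 0) ->
  (forall x y, S y -> `|rv y - x| < eps -> K x) ->
  testfun Om (conv (moll eps (fun=> 0%N))).
Proof.
move=> cK KOm phi0 SK; split; first exact: smooth_conv.
exists K; split => //; split => // x Kx; rewrite /conv.
under eq_Rintegral => y _.
  rewrite (_ : _ * _ = 0); last first.
    have [Sy|/phi0 ->] := pselect (S y); last by rewrite mul0r.
    rewrite moll_support ?mulr0// leNgt; apply/negP => /(SK _ _ Sy); exact: Kx.
  over.
by rewrite /Rintegral integral0.
Qed.

Lemma conv_ge0 (x : 'rV[R]_n) : (forall y, 0 <= phi y) -> 0 <= conv (moll eps (fun=> 0%N)) x.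
Proof. by move=> phi0; apply: Rintegral_ge0 => y _; rewrite mulr_ge0// moll_ge0. Qed.

End convolution.

(** * The singular kernel *)

Section enorm.
Context (R : realType) (n : nat).
Implicit Types v w : 'rV[R]_n.
Local Notation T := (n.-tuple R).

Lemma enorm_ge0 v : 0 <= enorm v.
Proof. exact: sqrtr_ge0. Qed.

Lemma normr_le_enorm v : `|v| <= enorm v.
Proof.
apply/ler_addgt0Pr => e e0; apply: ltW; apply/normr_rvP => [|i].
  by rewrite ltr_wpDl// enorm_ge0.
rewrite (le_lt_trans (y := enorm v)) ?ltrDl// -sqrtr_sqr.
by rewrite ler_wsqrtr// (bigD1 i)//= lerDl sumr_ge0// => j _; exact: sqr_ge0.
Qed.

Lemma enorm_le_normr v : enorm v <= n%:R * `|v|.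
Proof.
rewrite -[leRHS]ger0_norm ?mulr_ge0// -sqrtr_sqr ler_wsqrtr// exprMn.
have vi i : v ord0 i ^+ 2 <= `|v| ^+ 2.
  by rewrite -(real_normK (num_real (v ord0 i))) lerXn2r ?nnegrE// ler_normr_rv.
apply: le_trans (ler_sum _ (fun i _ => vi i)) _.
rewrite sumr_const card_ord -[leLHS]mulr_natl ler_wpM2r ?exprn_ge0//.
by rewrite -natrX ler_nat; case: (n) => // m; rewrite -[X in (X <= _)%N]expn1 leq_pexp2l.
Qed.

Lemma enormN v : enorm (- v) = enorm v.
Proof. by congr Num.sqrt; apply: eq_bigr => i _; rewrite mxE sqrrN. Qed.

Lemma enorm_distC v w : enorm (v - w) = enorm (w - v).
Proof. by rewrite -enormN opprB. Qed.

Definition nrm (x : T) : R := enorm (rv x).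

Definition dst (x y : T) : R := enorm (rv x - rv y).

Lemma dst_ge0 x y : 0 <= dst x y. Proof. exact: enorm_ge0. Qed.

Lemma dstC x y : dst x y = dst y x. Proof. exact: enorm_distC. Qed.

Lemma dst_tadd x y h : dst (tadd x h) (tadd y h) = dst x y.
Proof. by rewrite /dst !rv_tadd opprD addrACA subrr addr0. Qed.

Lemma measurable_nrm : measurable_fun setT nrm.
Proof.
have -> : nrm = Num.sqrt \o (fun x : T => \sum_(i < n) rv x ord0 i ^+ 2) by [].
apply: measurableT_comp; first by apply: continuous_measurable_fun; exact: sqrt_continuous.
apply: measurable_sum => i; apply: (@measurable_funX _ _ _ _ (fun x : T => rv x ord0 i)).
by under eq_fun do rewrite mxE; exact: measurable_tnth.
Qed.

Lemma measurable_dst : measurable_fun setT (fun z : T * T => dst z.1 z.2).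
Proof.
have -> : (fun z : T * T => dst z.1 z.2) =
  Num.sqrt \o (fun z : T * T => \sum_(i < n) (rv z.1 - rv z.2) ord0 i ^+ 2) by [].
apply: measurableT_comp; first by apply: continuous_measurable_fun; exact: sqrt_continuous.
apply: measurable_sum => i.
apply: (@measurable_funX _ _ _ _ (fun z : T * T => (rv z.1 - rv z.2) ord0 i)).
under eq_fun do rewrite !mxE.
by apply: measurable_funB; apply: (measurableT_comp (measurable_tnth i)).
Qed.

End enorm.

Section kernels.
Context (R : realType) (n : nat).
Local Notation T := (n.-tuple R).
Variable mu : {sigma_finite_measure set T -> \bar R}.
Hypothesis mu_leb : is_lebesgue mu.

(** Half-side [2 * t] instead of [t]: the closed ball of radius [t] then fits into a half-open
    box. *)
Definition cube (x : T) (t : R) : set T :=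
  box [tuple tnth x i - 2 * t | i < n] [tuple tnth x i + 2 * t | i < n].

Lemma mu_cube x t : 0 <= t -> mu (cube x t) = ((4 * t) ^+ n)%:E.
Proof.
move=> t0; rewrite mu_leb; last by move=> i; rewrite !tnth_mktuple; lra.
congr EFin; under eq_bigr => i _.
  rewrite !tnth_mktuple (_ : _ - _ = 4 * t); last by ring.
  over.
by rewrite prodr_const card_ord.
Qed.

Lemma cubeP x y t : 0 < t -> `|rv x - rv y| <= t -> cube x t y.
Proof.
move=> t0 xy i; rewrite !tnth_mktuple.
have := le_trans (ler_normr_rv (rv x - rv y) i) xy.
by rewrite !mxE ler_distl => /andP[? ?]; apply/andP; split; lra.
Qed.

Lemma pow2_bracket (t : R) : 1 <= t -> exists k : nat, 2 ^+ k <= t < 2 ^+ k.+1.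
Proof.
move=> t1; set m := Num.truncn t.
have t0 : 0 <= t by exact: le_trans t1.
have m0 : (0 < m)%N by rewrite truncn_gt0.
exists (trunc_log 2 m); have /andP[l1 l2] := trunc_log_bounds (isT : 1 < 2)%N m0.
apply/andP; split.
  by apply: le_trans (_ : m%:R <= _); rewrite ?truncn_le// -natrX ler_nat.
by apply: lt_le_trans (truncnS_gt t) _; rewrite -natrX ler_nat.
Qed.

(** Summation over dyadic shells: wherever [f] is nonzero it is bounded by one term of the series of
    [c k] times the indicator of [B k], which is integrated term by term. *)
Lemma integral_le_geometric (f : T -> R) (c : nat -> R) (B : nat -> set T) (a z : R) :
  0 <= a -> 0 < z < 1 -> (forall y, 0 <= f y) -> (forall k, 0 <= c k) ->
  (forall k, measurable (B k)) ->
  (forall y, f y != 0 -> exists2 k, B k y & f y <= c k) ->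
  (forall k, (c k)%:E * mu (B k) <= (a * z ^+ k)%:E)%E ->
  (\int[mu]_y (f y)%:E <= (a / (1 - z))%:E)%E.
Proof.
move=> a0 z01 f0 c0 mB fB muB.
apply: (@le_trans _ _ (\int[mu]_y (\sum_(0 <= k <oo) (c k * \1_(B k) y)%:E))%E).
  apply: ge0_le_integralT => y; first by rewrite lee_fin.
  have g0 k : (0 <= (c k * \1_(B k) y)%:E)%E by rewrite lee_fin mulr_ge0.
  have [->|/fB[k Bk fk]] := eqVneq (f y) 0; first by apply: nneseries_ge0 => k _ _; exact: g0.
  apply: le_trans (nneseries_lim_ge k.+1 _); last by move=> j _ _; exact: g0.
  rewrite big_nat_recr//= sumEFin -EFinD lee_fin indicE mem_set// mulr1.
  by rewrite ler_wpDl// sumr_ge0// => j _; rewrite mulr_ge0.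
rewrite integral_nneseries//; last 2 first.
- by move=> k; apply/measurable_EFinP; apply: measurable_funM => //; exact: measurable_indic.
- by move=> k y _; rewrite lee_fin mulr_ge0.
apply: le_trans (nneseries_geometric_le a0 z01).
apply: lee_nneseries => [k _ _|k _].
  by apply: integral_ge0 => y _; rewrite lee_fin mulr_ge0.
apply: le_trans (muB k); under eq_integral do rewrite EFinM.
rewrite ge0_integralZl//; last 2 first.
- by apply/measurable_EFinP; exact: measurable_indic.
- by rewrite lee_fin.
by rewrite integral_indic// setIT.
Qed.

Variables (s : R) (s01 : 0 < s < 1).

Lemma powR_half_lt1 (r : R) : 0 < r -> 0 < (2^-1 : R) `^ r < 1.
Proof.
move=> r0; rewrite powR_gt0 ?invr_gt0//=.
have := @gt0_ltr_powR R r r0 2^-1 1; rewrite powR1; apply; rewrite ?nnegrE ?invr_ge0//.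
by rewrite invf_lt1// ltr1n.
Qed.

Lemma powR_exprn (x r : R) k : 0 <= x -> (x ^+ k) `^ r = (x `^ r) ^+ k.
Proof. by move=> x0; rewrite -(powR_mulrn k x0) -(powR_mulrn k (powR_ge0 x r)) -!powRrM mulrC. Qed.

Definition wgt (y : T) : R := ((1 + nrm y) `^ (n%:R + s))^-1.

Lemma wgt_ge0 y : 0 <= wgt y. Proof. by rewrite invr_ge0 powR_ge0. Qed.

Lemma nrm1_gt0 (y : T) : 0 < 1 + nrm y.
Proof. by rewrite ltr_wpDr// enorm_ge0. Qed.

Lemma integral_wgt_lt_pinfty : (\int[mu]_y (wgt y)%:E < +oo)%E.
Proof.
have s0 : 0 < s by case/andP: s01.
have ns0 : 0 < n%:R + s by rewrite ltr_wpDl.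
apply: le_lt_trans (ltry _).
(* On the shell 2^k <= 1 + |y| < 2^(k+1) the weight is at most 2^(-k(n+s)), and the shell lies in a
   cube of volume (8 * 2^k)^n. The ratio left over is 2^(-s). *)
apply: (@integral_le_geometric wgt (fun k => ((2 ^+ k) `^ (n%:R + s))^-1)
  (fun k => cube [tuple 0 | i < n] (2 ^+ k.+1)) (8 ^+ n) (2^-1 `^ s)) => //.
- exact: powR_half_lt1.
- by move=> y; exact: wgt_ge0.
- by move=> k; exact: measurable_box.
- move=> y _; have [|k /andP[k1 k2]] := @pow2_bracket (1 + nrm y).
    by rewrite lerDl enorm_ge0.
  exists k.
    apply: cubeP; first by rewrite exprn_gt0.
    have -> : rv ([tuple 0 | i < n] : T) = 0.
      by apply/rowP => i; rewrite !mxE tnth_mktuple.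
    rewrite sub0r normrN.
    apply: le_trans (normr_le_enorm _) _; apply: le_trans (ltW k2).
    by rewrite lerDr.
  rewrite lef_pV2 ?posrE ?powR_gt0 ?exprn_gt0 ?nrm1_gt0//.
  by apply: ge0_ler_powR => //; rewrite ?nnegrE ?exprn_ge0 ?ltW// nrm1_gt0.
move=> k; rewrite mu_cube ?exprn_ge0// -EFinM lee_fin.
rewrite powRD; last by apply/implyP => _; rewrite expf_neq0.
rewrite powR_mulrn ?exprn_ge0// invfM -powR_exprn ?invr_ge0// exprVn.
rewrite -[(2 ^+ k)^-1]powR_inv1 ?exprn_ge0// -powRrM mulN1r powRN.
have E : (2 ^+ k) ^+ n != 0 :> R by rewrite !expf_neq0.
rewrite (_ : 4 * 2 ^+ k.+1 = 8 * 2 ^+ k); last by rewrite exprS; ring.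
by rewrite exprMn mulrAC [_^-1 * (8 ^+ n * _)]mulrCA mulVf// mulr1.
Qed.

(** The kernel |x-y|^(1-s-n) that a Lipschitz difference quotient of order s leaves behind; it is
    integrable near the diagonal because s < 1. *)
Definition kap (x y : T) : R := dst x y `^ (1 - s) / dst x y ^+ n.

Lemma kap_ge0 x y : 0 <= kap x y.
Proof. by rewrite divr_ge0 ?powR_ge0// exprn_ge0// dst_ge0. Qed.

Lemma integral_kap_bounded (rho : R) : 0 < rho -> exists2 C, 0 <= C &
  forall x, (\int[mu]_y (kap x y * (`|rv x - rv y| <= rho)%R%:R)%:E <= C%:E)%E.
Proof.
move=> rho0; have s1 : 0 < 1 - s by case/andP: s01; rewrite subr_gt0.
pose a : R := (n%:R * rho) `^ (1 - s) * 8 ^+ n.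
pose z : R := 2^-1 `^ (1 - s).
have z01 : 0 < z < 1 by exact: powR_half_lt1.
have a0 : 0 <= a by rewrite mulr_ge0 ?powR_ge0// exprn_ge0.
exists (a / (1 - z)); first by rewrite divr_ge0// subr_ge0 ltW//; case/andP: z01.
move=> x; pose t k : R := rho * 2^-1 ^+ k.
have t0 k : 0 < t k by rewrite mulr_gt0// exprn_gt0// invr_gt0.
(* Shells t_k/2 <= |x-y| <= t_k with t_k = rho 2^(-k), in the maximum norm. The factor [n] compares
   it with the Euclidean norm; the ratio is 2^(-(1-s)). *)
apply: (@integral_le_geometric _ (fun k => (n%:R * t k) `^ (1 - s) / (t k / 2) ^+ n)
  (fun k => cube x (t k))) => //.
- by move=> y /=; rewrite mulr_ge0 ?kap_ge0.
- by move=> k /=; rewrite divr_ge0 ?powR_ge0// exprn_ge0// ltW// divr_gt0.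
- by move=> k; exact: measurable_box.
- move=> y; have [xyr|] := leP `|rv x - rv y| rho; last by rewrite mulr0 eqxx.
  rewrite mulr1 => kn0; set r := `|rv x - rv y|.
  (* On the diagonal the kernel has the value 0, a positive power of 0, so the shells need only
     cover [r > 0]. *)
  have r0 : 0 < r.
    rewrite lt0r normr_ge0 andbT; apply: contra kn0 => /eqP rr.
    have d0 : dst x y = 0.
      apply/eqP; rewrite eq_le dst_ge0 andbT; apply: le_trans (enorm_le_normr _) _.
      by rewrite -/r rr mulr0.
    by rewrite /kap d0 powR0 ?mul0r// gt_eqF.
  have [|k /andP[k1 k2]] := @pow2_bracket (rho / r); first by rewrite ler_pdivlMr// mul1r.
  have rk1 : r <= t k.
    by move: k1; rewrite ler_pdivlMr// /t exprVn ler_pdivlMr ?exprn_gt0// mulrC.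
  have rk2 : t k / 2 <= r.
    move: k2; rewrite ltr_pdivrMr// => /ltW; rewrite exprSr /t exprVn => k2.
    rewrite ler_pdivrMr// ler_pdivrMr ?exprn_gt0//.
    by rewrite (_ : _ * _ * _ = 2 ^+ k * 2 * r)//; ring.
  exists k; first exact: cubeP.
  have dr : r <= dst x y by exact: normr_le_enorm.
  apply: ler_pM; rewrite ?powR_ge0// ?invr_ge0 ?exprn_ge0 ?dst_ge0//.
    apply: ge0_ler_powR; rewrite ?nnegrE ?dst_ge0 ?(ltW s1)//.
      by rewrite mulr_ge0// ltW.
    by apply: le_trans (enorm_le_normr _) _; rewrite ler_wpM2l.
  have t20 : 0 < t k / 2 by rewrite divr_gt0.
  rewrite lef_pV2 ?posrE ?exprn_gt0// ?(lt_le_trans r0)//.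
  by rewrite lerXn2r ?nnegrE ?dst_ge0 ?(ltW t20)// (le_trans rk2).
move=> k; rewrite mu_cube ?(ltW (t0 k))// -EFinM lee_fin.
have -> : 4 * t k = 8 * (t k / 2) by field.
rewrite [(8 * _) ^+ n]exprMn -mulrA [_^-1 * (8 ^+ n * _)]mulrCA mulVf ?expf_neq0 ?gt_eqF ?divr_gt0//.
rewrite mulr1 /a /z mulrAC ler_wpM2r ?exprn_ge0// /t mulrA.
by rewrite powRM ?mulr_ge0 ?exprn_ge0 ?invr_ge0 ?(ltW rho0)// powR_exprn// invr_ge0.
Qed.

End kernels.

(** * Growth of g *)

(** Apart from continuity and [0 < g 1], this is what the estimates use of [g]. The exponent is an
    integer so that the cutoff appears with natural powers. *)
Definition doubling (R : realType) (g : R -> R) (m : nat) : Prop :=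
  [/\ g 0 = 0, forall t, 0 <= t -> 0 <= g t,
      forall a b, 0 <= a -> a <= b -> g a <= g b &
      forall c t, 1 <= c -> 0 <= t -> g (c * t) <= c ^+ m * g t].

Section growth.
Context (R : realType) (g : R -> R) (m : nat).
Hypothesis hg : doubling g m.

Let g0 : g 0 = 0. Proof. by case: hg. Qed.
Let g_ge0 t : 0 <= t -> 0 <= g t. Proof. by case: hg => _ + _ _; exact. Qed.
Let g_mono a b : 0 <= a -> a <= b -> g a <= g b. Proof. by case: hg => _ _ + _; exact. Qed.
Let g_scale c t : 1 <= c -> 0 <= t -> g (c * t) <= c ^+ m * g t.
Proof. by case: hg => _ _ _; exact. Qed.

(** The even function t g(t), comparable to [G] through p G(t) <= t g(t) <= q G(t). It replaces [G]
    in the estimates because it is what the weak formulation produces when tested with [u]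
    itself. *)
Definition Phi (t : R) : R := `|t| * g `|t|.

Lemma Phi_ge0 t : 0 <= Phi t. Proof. by rewrite mulr_ge0 ?g_ge0. Qed.

Lemma Phi_norm t : Phi `|t| = Phi t. Proof. by rewrite /Phi normr_id. Qed.

Lemma PhiN t : Phi (- t) = Phi t. Proof. by rewrite /Phi normrN. Qed.

Lemma Phi0 : Phi 0 = 0. Proof. by rewrite /Phi normr0 mul0r. Qed.

Lemma PhiE t : 0 <= t -> Phi t = t * g t.
Proof. by move=> t0; rewrite /Phi ger0_norm. Qed.

Lemma le_Phi a b : `|a| <= `|b| -> Phi a <= Phi b.
Proof. by move=> ab; rewrite ler_pM ?g_ge0 ?g_mono. Qed.

Lemma g_add_le a b : 0 <= a -> 0 <= b -> g (a + b) <= 2 ^+ m * (g a + g b).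
Proof.
move=> a0 b0; apply: (@le_trans _ _ (g (2 * Num.max a b))).
  by apply: g_mono; [exact: addr_ge0|case: (leP a b) => ab; lra].
have mx0 : 0 <= Num.max a b by rewrite le_max a0.
apply: le_trans (g_scale (ler1n _ 2) mx0) _.
rewrite ler_wpM2l ?exprn_ge0//.
by case: (leP a b) => _; rewrite ?lerDl ?lerDr g_ge0.
Qed.

Lemma Phi_scale c t : 1 <= c -> Phi (c * t) <= c ^+ m.+1 * Phi t.
Proof.
move=> c1; have c0 : 0 <= c by apply: le_trans c1.
rewrite /Phi normrM (ger0_norm c0).
rewrite (_ : c ^+ m.+1 * _ = c * `|t| * (c ^+ m * g `|t|)); last by rewrite exprS; ring.
by rewrite ler_wpM2l ?mulr_ge0// g_scale.
Qed.

Lemma Phi_contract c t : 0 <= c <= 1 -> Phi (c * t) <= c * Phi t.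
Proof.
move=> /andP[c0 c1]; rewrite /Phi normrM (ger0_norm c0) -mulrA ler_wpM2l// ler_wpM2l//.
by rewrite g_mono ?mulr_ge0// ler_piMl.
Qed.

Lemma Phi_add_le a b : Phi (a + b) <= 2 ^+ m.+1 * (Phi a + Phi b).
Proof.
have : Phi (a + b) <= Phi (2 * Num.max `|a| `|b|).
  apply: le_Phi; apply: le_trans (ler_normD _ _) _; rewrite [leRHS]ger0_norm.
    by case: (leP `|a| `|b|) => ab; lra.
  by rewrite mulr_ge0// le_max normr_ge0.
move=> /le_trans; apply; apply: le_trans (Phi_scale _ (ler1n _ 2)) _.
rewrite ler_wpM2l ?exprn_ge0//.
by case: (leP `|a| `|b|) => _; rewrite Phi_norm ?lerDl ?lerDr Phi_ge0.
Qed.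

(** Either b <= d a, and the first term suffices, or a < b/d, and the scaling of [g] bounds g(a) by
    d^(-m) g(b). *)
Lemma young_small d a b : 0 < d <= 1 -> 0 <= a -> 0 <= b ->
  g a * b <= d * Phi a + (d^-1) ^+ m * Phi b.
Proof.
move=> /andP[d0 d1] a0 b0; rewrite !PhiE//.
have dm : 0 <= d^-1 ^+ m by rewrite exprn_ge0// invr_ge0 ltW.
have [ba|/ltW ab] := leP b (d * a).
  rewrite ler_wpDr ?mulr_ge0 ?g_ge0//.
  by rewrite mulrA mulrC ler_wpM2r ?g_ge0.
rewrite ler_wpDl ?mulr_ge0 ?g_ge0 ?(ltW d0)//.
rewrite mulrCA mulrC ler_wpM2l//.
apply: (@le_trans _ _ (g (d^-1 * b))); last by rewrite g_scale// invf_ge1.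
by apply: g_mono => //; rewrite ler_pdivlMl.
Qed.

Lemma young_one a b : 0 <= a -> 0 <= b -> g a * b <= Phi a + Phi b.
Proof.
move=> a0 b0; have := @young_small 1 a b _ a0 b0.
by rewrite invr1 expr1n !mul1r; apply; rewrite ltr01 lexx.
Qed.

Lemma gsign_abs t : `|gsign g t| = g `|t|.
Proof.
rewrite /gsign normrM ger0_norm ?g_ge0//; have [->|t0] := eqVneq t 0.
  by rewrite normr0 g0 mul0r.
by rewrite normr_sg t0 mulr1.
Qed.

Lemma gsignN t : gsign g (- t) = - gsign g t.
Proof. by rewrite /gsign normrN sgrN mulrN. Qed.

(* The absorption step of the Caccioppoli estimate: with [eta] the larger cutoff value and
   [b = (m+1) w |D eta|], either [b <= eta a / 2], or [eta a < 2 b] and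
   [g a * eta ^ m <= g (eta a) <= g (2 b)]. *)
Lemma absorb a b eta : 0 <= a -> 0 <= b -> 0 < eta <= 1 ->
  g a * eta ^+ m * b <= 2^-1 * (Phi a * eta ^+ m.+1) + 2 ^+ m * Phi b.
Proof.
move=> a0 b0 /andP[e0 e1]; rewrite !PhiE//.
have gem : 0 <= g a * eta ^+ m by rewrite mulr_ge0 ?g_ge0// exprn_ge0// ltW.
have [ba|/ltW ab] := leP b (2^-1 * (eta * a)).
  rewrite ler_wpDr ?mulr_ge0 ?exprn_ge0 ?g_ge0//.
  rewrite (_ : _ * (_ * _ * _) = g a * eta ^+ m * (2^-1 * (eta * a))).
    by rewrite ler_wpM2l.
  by rewrite exprS; ring.
rewrite ler_wpDl ?mulr_ge0 ?exprn_ge0 ?g_ge0 ?(ltW e0) ?invr_ge0//.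
rewrite mulrCA [leRHS]mulrC -mulrA mulrA ler_wpM2r//.
have ea0 : 0 <= eta * a by rewrite mulr_ge0// ltW.
have h1 : g a <= eta^-1 ^+ m * g (eta * a).
  have := @g_scale eta^-1 (eta * a); rewrite mulKf ?gt_eqF//; apply => //.
  by rewrite invf_ge1.
have h2 : g a * eta ^+ m <= g (eta * a).
  by rewrite -ler_pdivlMr ?exprn_gt0// mulrC -exprVn.
apply: le_trans h2 _; apply: (@le_trans _ _ (g (2 * b))).
  by apply: g_mono => //; lra.
by apply: g_scale => //; exact: ler1n.
Qed.

Lemma exprB_le (x y : R) k : 0 <= x -> x <= y -> y <= 1 ->
  y ^+ k.+1 - x ^+ k.+1 <= k.+1%:R * y ^+ k * (y - x).
Proof.
move=> x0 xy y1; rewrite subrXX mulrC ler_wpM2r ?subr_ge0//.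
have y0 : 0 <= y by exact: le_trans xy.
apply: (@le_trans _ _ (\sum_(i < k.+1) y ^+ k)).
  apply: ler_sum => i _.
  rewrite (_ : y ^+ k = y ^+ (k - i) * y ^+ i); last first.
    by rewrite -exprD subnK// -ltnS.
  by rewrite /= ler_wpM2l ?exprn_ge0// lerXn2r ?nnegrE.
by rewrite sumr_const card_ord mulr_natl.
Qed.

(** The factor 2^m comes from [absorb]; the factor (m+1)^(m+1) from taking m+1, the derivative of
    the cutoff power, out of [Phi]. *)
Definition Ccac : R := 2 ^+ m * (m.+1%:R) ^+ m.+1.

Lemma Ccac_ge0 : 0 <= Ccac. Proof. by rewrite mulr_ge0// exprn_ge0. Qed.

(** Here [w] stands for M - u, [e] for the cutoff and [r] for |x-y|^(-s). By symmetry wy <= wx. If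
    ey <= ex, the right side is at least Phi(a) ex^(m+1) and there is no error. Otherwise the
    difference of the cutoff powers produces the error term with [wx], which [absorb] splits between
    half of the energy and the cutoff terms. *)
Lemma caccioppoli_pointwise wx wy ex ey r : 0 <= wx -> 0 <= wy ->
  0 <= ex <= 1 -> 0 <= ey <= 1 -> 0 <= r ->
  2^-1 * (Phi ((wx - wy) * r) * (ex * ey) ^+ m.+1)
   - Ccac * (Phi (wx * ((ex - ey) * r)) + Phi (wy * ((ex - ey) * r))) <=
  gsign g ((wx - wy) * r) * ((wx * ex ^+ m.+1 - wy * ey ^+ m.+1) * r).
Proof.
wlog wyx : wx wy ex ey / wy <= wx.
  move=> H wx0 wy0 hx hy r0; have [/H|/ltW/H] := leP wy wx; first exact.
  move=> /(_ ey ex wy0 wx0 hy hx r0).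
  rewrite -(opprB ex) -(opprB wx) !mulNr !mulrN !PhiN gsignN.
  rewrite -(opprB (wx * _)) !mulNr mulrN opprK [ey * ex]mulrC.
  by rewrite [Phi (wy * _) + _]addrC.
move=> wx0 wy0 /andP[ex0 ex1] /andP[ey0 ey1] r0.
set a := (wx - wy) * r.
have a0 : 0 <= a by rewrite mulr_ge0// subr_ge0.
have ga : gsign g a = g a.
  rewrite /gsign ger0_norm//; have [->|an0] := eqVneq a 0; first by rewrite g0 mul0r.
  by rewrite gtr0_sg ?mulr1// lt0r an0.
rewrite ga; have ga0 := g_ge0 a0.
have xyx : (ex * ey) ^+ m.+1 <= ex ^+ m.+1.
  by rewrite lerXn2r ?nnegrE ?mulr_ge0// ler_piMr.
have xyy : (ex * ey) ^+ m.+1 <= ey ^+ m.+1.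
  by rewrite lerXn2r ?nnegrE ?mulr_ge0// ler_piMl.
have C0 := Ccac_ge0.
have [eyx|exy] := leP ey ex.
  have e1 : ey ^+ m.+1 <= ex ^+ m.+1 by rewrite lerXn2r ?nnegrE.
  apply: (@le_trans _ _ (Phi a * ex ^+ m.+1)).
    rewrite lerBlDr ler_wpDr//; first by rewrite mulr_ge0// addr_ge0// Phi_ge0.
    apply: (@le_trans _ _ (2^-1 * (Phi a * ex ^+ m.+1))).
      by rewrite ler_wpM2l ?invr_ge0// ler_wpM2l// Phi_ge0.
    by have := mulr_ge0 (Phi_ge0 a) (exprn_ge0 m.+1 ex0); lra.
  rewrite PhiE// [a * g a]mulrC -mulrA ler_wpM2l//.
  rewrite /a mulrAC ler_wpM2r// mulrBl lerD2l lerN2 ler_wpM2l//.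
set k := m.+1%:R : R.
pose b := k * (wx * ((ey - ex) * r)).
have b0 : 0 <= b by rewrite !mulr_ge0// subr_ge0 ltW.
have ey00 : 0 < ey by exact: le_lt_trans exy.
have PhiC : Phi (wx * ((ex - ey) * r)) = Phi (wx * ((ey - ex) * r)).
  by rewrite -(opprB ey) mulNr mulrN PhiN.
have Phib : 2 ^+ m * Phi b <= Ccac * Phi (wx * ((ex - ey) * r)).
  rewrite PhiC /Ccac -mulrA ler_wpM2l ?exprn_ge0//.
  by apply: Phi_scale; rewrite /k ler1n.
have := @absorb a b ey a0 b0; rewrite ey00 ey1 => /(_ isT) ab.
have ge : Phi a * ey ^+ m.+1 - g a * ey ^+ m * b <=
    g a * ((wx * ex ^+ m.+1 - wy * ey ^+ m.+1) * r).
  rewrite PhiE// (_ : _ - _ = g a * ((wx - wy) * ey ^+ m.+1 - wx * (k * ey ^+ m * (ey - ex))) * r).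
    rewrite -mulrA ler_wpM2l// ler_wpM2r//.
    have := exprB_le m ex0 (ltW exy) ey1; rewrite -/k => H.
    have := ler_wpM2l wx0 H; lra.
  by rewrite /b /a; ring.
apply: le_trans ge.
have h2 : 0 <= Ccac * Phi (wy * ((ex - ey) * r)) by rewrite mulr_ge0// Phi_ge0.
have h3 : Phi a * (ex * ey) ^+ m.+1 <= Phi a * ey ^+ m.+1 by rewrite ler_wpM2l// Phi_ge0.
lra.
Qed.

End growth.

(** * Energy density, weak integrand and tail bounds *)

Section integrands.
Context (R : realType) (n : nat).
Local Notation T := (n.-tuple R).
Variables (s : R) (s01 : 0 < s < 1) (g : R -> R) (m : nat).
Hypothesis hg : doubling g m.
Hypothesis gcont : continuous (fun t : R => g `|t|).
Variables (k : T * T -> R) (Lam : R).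
Hypothesis mk : measurable_fun setT k.
Hypothesis k_ge0 : forall z, 0 <= k z.
Hypothesis k_le : forall z, k z <= Lam.

Let s0 : 0 < s. Proof. by case/andP: s01. Qed.
Let s1 : s < 1. Proof. by case/andP: s01. Qed.

Definition DT (u : T -> R) (z : T * T) : R := (u z.1 - u z.2) / dst z.1 z.2 `^ s.

Definition en (u : T -> R) (z : T * T) : R := Phi g (DT u z) / dst z.1 z.2 ^+ n.

Definition integrand (u phi : T -> R) (z : T * T) : R :=
  gsign g (DT u z) * DT phi z * k z / dst z.1 z.2 ^+ n.

Lemma continuous_Phi : continuous (Phi g).
Proof.
by move=> t; apply: cvgM; [exact: cvg_norm|exact: gcont].
Qed.

Lemma continuous_gsign : continuous (gsign g).
Proof.
have [g0 _ _ _] := hg.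
move=> t; rewrite /continuous_at; have [t0|t0|->] := ltgtP t 0.
- have -> : gsign g t = g `|t| * -1 by rewrite /gsign ltr0_sg.
  apply: (@cvg_trans _ ((fun x : R => g `|x| * -1) x @[x --> t])).
    apply: near_eq_cvg; near=> x; rewrite /gsign ltr0_sg//; near: x; exact: lt_nbhsl.
  have H : (fun x : R => g `|x| * -1) x @[x --> t] --> (g `|t| * -1 : R) by apply: cvgM; [exact: gcont|exact: cvg_cst].
  exact: H.
- have -> : gsign g t = g `|t| * 1 by rewrite /gsign gtr0_sg.
  apply: (@cvg_trans _ ((fun x : R => g `|x| * 1) x @[x --> t])).
    apply: near_eq_cvg; near=> x; rewrite /gsign gtr0_sg//; near: x; exact: lt_nbhsr.
  have H : (fun x : R => g `|x| * 1) x @[x --> t] --> (g `|t| * 1 : R) by apply: cvgM; [exact: gcont|exact: cvg_cst].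
  exact: H.
- rewrite {2}/gsign sgr0 mulr0; apply: norm_cvg0.
  under eq_fun do rewrite (gsign_abs hg).
  have c0 : (fun x : R => g `|x|) x @[x --> (0 : R)] --> g `|0 : R| by exact: gcont.
  by rewrite normr0 g0 in c0.
Unshelve. all: by end_near. Qed.

Lemma measurable_DT u : measurable_fun setT u -> measurable_fun setT (DT u).
Proof.
move=> mu'; apply: measurable_funM.
  by apply: measurable_funB; apply: (measurableT_comp mu').
have -> : (fun z : T * T => (dst z.1 z.2 `^ s)^-1) = (fun z => dst z.1 z.2 `^ (- s)).
  by apply/funext => z; rewrite powRN.
by apply: (measurableT_comp (measurable_powR _)); exact: measurable_dst.
Qed.

Lemma measurable_inv_dst : measurable_fun setT (fun z : T * T => (dst z.1 z.2 ^+ n)^-1).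
Proof.
have -> : (fun z : T * T => (dst z.1 z.2 ^+ n)^-1) = (fun z => dst z.1 z.2 `^ (- n%:R)).
  by apply/funext => z; rewrite powRN powR_mulrn// dst_ge0.
by apply: (measurableT_comp (measurable_powR _)); exact: measurable_dst.
Qed.

Lemma measurable_Phi : measurable_fun setT (Phi g).
Proof. by apply: continuous_measurable_fun; exact: continuous_Phi. Qed.

Lemma measurable_en u : measurable_fun setT u -> measurable_fun setT (en u).
Proof.
move=> mu'; apply: measurable_funM; last exact: measurable_inv_dst.
by apply: (measurableT_comp measurable_Phi); exact: measurable_DT.
Qed.

Lemma measurable_integrand u phi : measurable_fun setT u -> measurable_fun setT phi ->
  measurable_fun setT (integrand u phi).
Proof.
move=> mu' mphi; apply: measurable_funM; last exact: measurable_inv_dst.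
apply: measurable_funM => //; apply: measurable_funM; last exact: measurable_DT.
apply: (@measurableT_comp _ _ _ _ _ _ (gsign g)); last exact: measurable_DT.
by apply: continuous_measurable_fun; exact: continuous_gsign.
Qed.

Lemma en_ge0 u z : 0 <= en u z.
Proof. by rewrite divr_ge0 ?(Phi_ge0 hg)// exprn_ge0// dst_ge0. Qed.

Lemma DT_swap u x y : DT u (y, x) = - DT u (x, y).
Proof. by rewrite /DT/= dstC -mulNr opprB. Qed.

Lemma en_swap u x y : en u (y, x) = en u (x, y).
Proof. by rewrite /en DT_swap PhiN /= dstC. Qed.

Lemma DT_tadd (u : T -> R) h z :
  DT (fun x => u (tadd x h)) z = DT u (tadd z.1 h, tadd z.2 h).
Proof. by rewrite /DT /= dst_tadd. Qed.

Lemma en_tadd (u : T -> R) h z :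
  en (fun x => u (tadd x h)) z = en u (tadd z.1 h, tadd z.2 h).
Proof. by rewrite /en DT_tadd /= dst_tadd. Qed.

(** The coefficient of [phi z.1 - phi z.2] does not involve [phi]; this linearity gives both the
    averaging over translates and pointwise convergence along them. *)
Lemma integrandE u phi z : integrand u phi z =
  gsign g (DT u z) / dst z.1 z.2 `^ s * k z / dst z.1 z.2 ^+ n * (phi z.1 - phi z.2).
Proof. by rewrite /integrand {2}/DT; ring. Qed.

Lemma integrand_le u phi z :
  `|integrand u phi z| <= Lam * (g `|DT u z| * `|DT phi z| / dst z.1 z.2 ^+ n).
Proof.
have d0 : 0 <= (dst z.1 z.2 ^+ n)^-1 by rewrite invr_ge0 exprn_ge0// dst_ge0.
rewrite /integrand 3!normrM (gsign_abs hg) (ger0_norm d0) (ger0_norm (k_ge0 z)).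
rewrite [Lam * _]mulrC [leRHS]mulrAC ler_wpM2r// ler_wpM2l// mulr_ge0//.
by have [_ + _ _] := hg; apply.
Qed.

(* Off the diagonal blocks only the kernel's decay is available; the part of [u] far away is
   controlled by its tail weight. *)
Definition tailw (b : R) (y : T) : R := g (`|b| / (1 + nrm y) `^ s) * wgt s y.

Lemma tailw_ge0 b y : 0 <= tailw b y.
Proof.
have [_ gge0 _ _] := hg.
by rewrite mulr_ge0 ?wgt_ge0// gge0// divr_ge0// powR_ge0.
Qed.

Lemma le_tailw a b y : `|a| <= `|b| -> tailw a y <= tailw b y.
Proof.
move=> ab; have [_ _ gmono _] := hg; rewrite ler_wpM2r ?wgt_ge0// gmono//.
  by rewrite divr_ge0// powR_ge0.
by rewrite ler_wpM2r// invr_ge0 powR_ge0.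
Qed.

(** 2^m C0^m comes from splitting and scaling inside [g]; C0^(n+1) from comparing |x-y|^(-s-n) with
    the tail weight, where C0^s is bounded by C0. *)
Definition Ctail (C0 : R) : R := 2 ^+ m * C0 ^+ m * C0 ^+ n.+1.

(** When |x-y| dominates 1 + |y|, the singular kernel is at most a multiple of the tail weight at y.
    The value [a] at x simply loses its denominator, while [b] keeps the one required by the tail
    space. *)
Lemma tail_pointwise C0 x y (a b : R) : 1 <= C0 -> 1 + nrm y <= C0 * dst x y ->
  g (`|a - b| / dst x y `^ s) / dst x y `^ s / dst x y ^+ n <=
  Ctail C0 * (g `|a| * wgt s y + tailw b y).
Proof.
have [_ gge0 gmono gscale] := hg.
move=> C1 yd; have C0' : 0 < C0 by exact: lt_le_trans C1.
have n1 := nrm1_gt0 y; set ny := 1 + nrm y in yd n1 *.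
have d0 : 0 < dst x y by rewrite -(pmulr_rgt0 _ C0'); exact: lt_le_trans yd.
set d := dst x y in yd d0 *.
have ds0 : 0 < d `^ s by rewrite powR_gt0.
have ns0 : 0 < ny `^ s by rewrite powR_gt0.
have dsC : ny `^ s <= C0 * d `^ s.
  apply: (@le_trans _ _ ((C0 * d) `^ s)).
    by apply: ge0_ler_powR; rewrite ?nnegrE ?mulr_ge0 ?(ltW s0) ?(ltW n1) ?(ltW C0') ?(ltW d0).
  rewrite powRM ?(ltW C0') ?(ltW d0)// ler_wpM2r ?(ltW ds0)//.
  by rewrite -[leRHS]powRr1 ?(ltW C0')// ler_powR// ltW.
have inv : (d `^ s)^-1 <= C0 / ny `^ s.
  by rewrite -[leLHS]mul1r ler_pdivrMr// mulrAC ler_pdivlMr// mul1r.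
have nys1 : 1 <= ny `^ s.
  by rewrite -(powRr0 ny) ler_powR ?(ltW s0)// lerDl enorm_ge0.
have gle : g (`|a - b| / d `^ s) <= 2 ^+ m * C0 ^+ m * (g `|a| + g (`|b| / ny `^ s)).
  have b0 : 0 <= `|b| / ny `^ s by rewrite divr_ge0// ltW.
  apply: (@le_trans _ _ (g (C0 * `|a| + C0 * (`|b| / ny `^ s)))).
    apply: gmono; first by rewrite divr_ge0// ltW.
    apply: (@le_trans _ _ ((`|a| + `|b|) * (C0 / ny `^ s))).
      by rewrite ler_pM// ?invr_ge0 ?(ltW ds0)// ler_normB.
    rewrite mulrDl (_ : `|b| * _ = C0 * (`|b| / ny `^ s)); last by ring.
    rewrite lerD2r mulrC ler_wpM2r// ler_pdivrMr// ler_peMr// ltW//.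
  have Ca : 0 <= C0 * `|a| by rewrite mulr_ge0// ltW.
  have Cb : 0 <= C0 * (`|b| / ny `^ s) by rewrite mulr_ge0// ltW.
  apply: le_trans (g_add_le hg Ca Cb) _.
  rewrite -mulrA ler_wpM2l ?exprn_ge0// mulrDr lerD//; exact: gscale.
have wle : (d `^ s)^-1 / d ^+ n <= C0 ^+ n.+1 * wgt s y.
  rewrite /wgt powRD; last by apply/implyP => _; rewrite gt_eqF.
  rewrite powR_mulrn ?(ltW n1)// invfM mulrA exprS.
  rewrite (_ : C0 * C0 ^+ n * _ * _ = C0 / ny `^ s * (C0 ^+ n / ny ^+ n)); last by ring.
  apply: ler_pM => //; rewrite ?invr_ge0 ?exprn_ge0 ?(ltW ds0) ?(ltW d0)//.
  rewrite ler_pdivlMr ?exprn_gt0// mulrC ler_pdivrMr ?exprn_gt0// -exprMn.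
  by rewrite lerXn2r ?nnegrE ?mulr_ge0 ?(ltW n1) ?(ltW C0') ?(ltW d0).
rewrite -mulrA (_ : Ctail C0 * _ = 2 ^+ m * C0 ^+ m * (g `|a| + g (`|b| / ny `^ s)) *
  (C0 ^+ n.+1 * wgt s y)); last by rewrite /Ctail /tailw -/ny; ring.
apply: ler_pM => //.
- by rewrite gge0// divr_ge0// ltW.
- by rewrite mulr_ge0 ?invr_ge0 ?exprn_ge0 ?(ltW ds0) ?(ltW d0).
Qed.

End integrands.

(** * Product measures and tensor products *)

Section product_sigma_finite.
Context d1 d2 (T1 : measurableType d1) (T2 : measurableType d2) (R : realType).
Variables (m1 : {sigma_finite_measure set T1 -> \bar R}) (m2 : {sigma_finite_measure set T2 -> \bar R}).
Local Open Scope ereal_scope.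

Lemma sigma_finite_prod : sigma_finite setT (m1 \x m2).
Proof.
have /sigma_finiteP[F [TF ndF Foo]] := sigma_finiteT m1.
have /sigma_finiteP[G [TG ndG Goo]] := sigma_finiteT m2.
exists (fun i => F i `*` G i).
  apply/seteqP; split => // -[x y] _.
  have [i _ Fx] : (\bigcup_i F i) x by rewrite -TF.
  have [j _ Gy] : (\bigcup_j G j) y by rewrite -TG.
  exists (maxn i j) => //; split => /=.
    by move: x Fx; exact/subsetPset/ndF/leq_maxl.
  by move: y Gy; exact/subsetPset/ndG/leq_maxr.
move=> i; have [mF Fi] := Foo i; have [mG Gi] := Goo i.
split; first exact: measurableX.
by rewrite product_measure1E// lte_mul_pinfty// ge0_fin_numE.
Qed.

(* The library's instance for products is not inferred for iterated products. *)
Definition prodm : {sigma_finite_measure set (T1 * T2)%type -> \bar R} :=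
  HB.pack_for {sigma_finite_measure set (T1 * T2)%type -> \bar R} (m1 \x m2)%E
    (Measure_isSigmaFinite.Build _ _ _ (m1 \x m2)%E sigma_finite_prod).

End product_sigma_finite.

Section tensor.
Context (R : realType) (n : nat).
Local Notation T := (n.-tuple R).
Variable mu : {sigma_finite_measure set T -> \bar R}.
Local Open Scope ereal_scope.

Lemma ge0_integral_swap (f : T * T -> \bar R) : measurable_fun setT f -> (forall z, 0 <= f z) ->
  \int[mu \x mu]_z f (z.2, z.1) = \int[mu \x mu]_z f z.
Proof.
move=> mf f0.
have msw : measurable_fun setT (fun z : T * T => f (z.2, z.1)).
  by apply: (measurableT_comp mf); exact: measurable_swap.
rewrite fubini_tonelli1// [RHS]fubini_tonelli1//.
by rewrite (fubini_tonelli f mf f0).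
Qed.

Definition tens (a b : T -> R) (z : T * T) : R := (a z.1 * b z.2)%R.

Lemma measurable_tens (a b : T -> R) : measurable_fun setT a -> measurable_fun setT b ->
  measurable_fun setT (tens a b).
Proof.
by move=> ma mb; apply: measurable_funM; [exact: (measurableT_comp ma)|exact: (measurableT_comp mb)].
Qed.

Lemma ge0_integral_tens (a b : T -> R) : measurable_fun setT a -> measurable_fun setT b ->
  (forall x, 0 <= a x)%R -> (forall x, 0 <= b x)%R ->
  \int[mu \x mu]_z (tens a b z)%:E = (\int[mu]_x (a x)%:E) * (\int[mu]_x (b x)%:E).
Proof.
move=> ma mb a0 b0.
rewrite fubini_tonelli1/=; last 2 first.
- by apply/measurable_EFinP; exact: measurable_tens.
- by move=> z; rewrite lee_fin mulr_ge0.
rewrite /fubini_F /tens/=.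
under eq_integral => x _.
  under eq_integral do rewrite EFinM.
  rewrite ge0_integralZl//; [|exact/measurable_EFinP|by move=> y _; rewrite lee_fin|by rewrite lee_fin].
  over.
rewrite ge0_integralZr//; [exact/measurable_EFinP|by move=> x _; rewrite lee_fin|].
by apply: integral_ge0 => y _; rewrite lee_fin.
Qed.

Lemma integrable_tens (a b : T -> R) : (forall x, 0 <= a x)%R -> (forall x, 0 <= b x)%R ->
  mu.-integrable setT (EFin \o a) -> mu.-integrable setT (EFin \o b) ->
  (mu \x mu).-integrable setT (EFin \o tens a b).
Proof.
move=> a0 b0 Ia Ib; have ma := integrable_mfun Ia; have mb := integrable_mfun Ib.
apply/integrableP; split; first by apply/measurable_EFinP; exact: measurable_tens.
under eq_integral => z _ do rewrite gee0_abs/= ?lee_fin ?mulr_ge0//.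
rewrite ge0_integral_tens//.
have fin (c : T -> R) : mu.-integrable setT (EFin \o c) -> \int[mu]_x (c x)%:E \is a fin_num.
  exact: integrable_fin_num.
by rewrite -(fineK (fin a Ia)) -(fineK (fin b Ib)) -EFinM ltry.
Qed.

Lemma integrable_swap (f : T * T -> R) : (forall z, 0 <= f z)%R ->
  (mu \x mu).-integrable setT (EFin \o f) ->
  (mu \x mu).-integrable setT (EFin \o (fun z => f (z.2, z.1))).
Proof.
move=> f0 /integrableP[/measurable_EFinP mf fin]; apply/integrableP; split.
  apply/measurable_EFinP; apply: (measurableT_comp mf); exact: measurable_swap.
move: fin; rewrite -ge0_integral_swap//.
by apply/measurable_EFinP; exact: measurableT_comp.
Qed.

Lemma ae_fst (P : T -> Prop) : {ae mu, forall x, P x} ->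
  {ae mu \x mu, forall z, P z.1}.
Proof.
move=> [N [mN N0 sub]]; exists (N `*` setT); split; first exact: measurableX.
  have N0' : mu N = 0 := N0.
  transitivity (mu N * mu setT); first exact: product_measure1E.
  by rewrite N0' mul0e.
by move=> z nP; split => //; apply: sub.
Qed.

Lemma ae_snd (P : T -> Prop) : {ae mu, forall x, P x} ->
  {ae mu \x mu, forall z, P z.2}.
Proof.
move=> [N [mN N0 sub]]; exists (setT `*` N); split; first exact: measurableX.
  have N0' : mu N = 0 := N0.
  transitivity (mu setT * mu N); first exact: product_measure1E.
  by rewrite N0' mule0.
by move=> z nP; split => //; apply: sub.
Qed.

End tensor.

(** * Admissible test functions *)

Section domination.
Context (R : realType) (n : nat).
Local Notation T := (n.-tuple R).
Variable mu : {sigma_finite_measure set T -> \bar R}.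
Hypothesis mu_leb : is_lebesgue mu.
Variables (s : R) (s01 : 0 < s < 1) (g : R -> R) (m : nat).
Hypothesis hg : doubling g m.
Hypothesis gcont : continuous (fun t : R => g `|t|).
Variables (k : T * T -> R) (Lam : R).
Hypothesis mk : measurable_fun setT k.
Hypothesis k_ge0 : forall z, 0 <= k z.
Hypothesis k_le : forall z, k z <= Lam.
Variables (S1 D : set T) (C0 : R).
Hypothesis mS1 : measurable S1.
Hypothesis mD : measurable D.
Hypothesis S1D : S1 `<=` D.
Hypothesis C1 : 1 <= C0.
Hypothesis sep : forall x y, S1 x -> ~ D y -> 1 + nrm y <= C0 * dst x y.
Variable H : T -> R.
Hypothesis mH : measurable_fun setT H.

Let J y := tailw s g (H y) y.
Let W := wgt s : T -> R.

Let J0 y : 0 <= J y. Proof. exact: tailw_ge0 hg _ _. Qed.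
Let W0 y : 0 <= W y. Proof. exact: wgt_ge0. Qed.
Let P0 t : 0 <= Phi g t. Proof. exact: Phi_ge0 hg _. Qed.
Let gge0 t : 0 <= t -> 0 <= g t. Proof. by case: hg => _ + _ _; exact. Qed.
Let C00 : 0 <= Ctail n m C0.
Proof. by have := le_trans ler01 C1 => ?; rewrite /Ctail !mulr_ge0// exprn_ge0. Qed.
Let Lam0 : 0 <= Lam. Proof. exact: le_trans (k_ge0 (point, point)) (k_le _). Qed.

Definition near_part (u phi : T -> R) (z : T * T) : R :=
  \1_(D `*` D) z * (g `|DT s u z| * `|DT s phi z| / dst z.1 z.2 ^+ n).

Definition far_part (u phi : T -> R) (x y : T) : R :=
  `|phi x| * (g `|u x| * W y + J y).

Lemma far_part_ge0 u phi x y : 0 <= far_part u phi x y.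
Proof. by rewrite mulr_ge0// addr_ge0// mulr_ge0// gge0. Qed.

Lemma pairing_far (u phi : T -> R) x y : S1 x -> ~ D y -> `|u y| <= `|H y| -> phi y = 0 ->
  g `|DT s u (x, y)| * `|DT s phi (x, y)| / dst x y ^+ n <= Ctail n m C0 * far_part u phi x y.
Proof.
move=> Sx Dy uH py.
have d0 : 0 <= dst x y `^ s by exact: powR_ge0.
rewrite /DT/= py subr0 !normrM normfV (ger0_norm d0).
rewrite (_ : _ * (`|phi x| * _) * _ =
  `|phi x| * (g (`|u x - u y| / dst x y `^ s) / dst x y `^ s / dst x y ^+ n)); last by ring.
rewrite /far_part [leRHS]mulrCA ler_wpM2l//.
apply: le_trans (tail_pointwise s01 hg _ _ C1 (sep Sx Dy)) _.
by rewrite ler_wpM2l// lerD2l; exact: (le_tailw _ hg).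
Qed.

Lemma integrand_bound (u phi : T -> R) z :
  (forall y, `|u y| <= `|H y|) -> (forall x, ~ S1 x -> phi x = 0) ->
  `|integrand s g k u phi z| <= Lam * (near_part u phi z +
    Ctail n m C0 * (far_part u phi z.1 z.2 + far_part u phi z.2 z.1)).
Proof.
move=> uH pS; apply: le_trans (integrand_le s hg k_ge0 k_le _ _ _) _.
rewrite ler_wpM2l//; case: z => x y /=.
have Q0 := far_part_ge0 u phi x y; have Q1 := far_part_ge0 u phi y x.
rewrite /near_part indicE/=; have [/set_mem[/= Dx Dy]|/negP xy] := boolP ((x, y) \in _).
  by rewrite mul1r lerDl; exact: mulr_ge0 C00 (addr_ge0 Q0 Q1).
rewrite mul0r add0r.
have [Sx|Sx] := pselect (S1 x).
  have Dy : ~ D y by move=> Dy; apply: xy; apply/mem_set; split => //; exact: S1D.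
  apply: le_trans (pairing_far (u := u) (phi := phi) Sx Dy (uH y) _) _.
    by apply: pS => /S1D.
  by apply: (ler_wpM2l C00); rewrite lerDl; exact: Q1.
have [Sy|Sy] := pselect (S1 y).
  have Dx : ~ D x by move=> Dx; apply: xy; apply/mem_set; split => //; exact: S1D.
  rewrite (DT_swap _ u y x) (DT_swap _ phi y x) !normrN dstC.
  apply: le_trans (pairing_far (u := u) (phi := phi) Sy Dx (uH x) _) _; first exact: pS.
  by apply: (ler_wpM2l C00); rewrite lerDr; exact: Q0.
rewrite [DT s phi _]/DT/= (pS _ Sx) (pS _ Sy) subrr mul0r normr0 mulr0 mul0r.
exact: mulr_ge0 C00 (addr_ge0 Q0 Q1).
Qed.

(** The share of [u] after Young's inequality has separated it from [phi]; it is the same for all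
    test functions vanishing outside [S1]. *)
Definition Apart (u : T -> R) (z : T * T) : R := \1_(D `*` D) z * en s g u z
  + (tens (fun x => \1_S1 x * Phi g (u x)) W z
     + tens (fun x => \1_S1 x * Phi g (u x)) W (z.2, z.1)).

(** The share of [phi]. Its energy is taken over the whole space, and [W] and [J] enter only through
    tensor products, which integrate to products of one-variable integrals; so the total integral
    does not change when [phi] is translated, although [W] and [J] stay in place. *)
Definition Bpart (phi : T -> R) (z : T * T) : R := en s g phi z
  + (tens (Phi g \o phi) W z + tens (Phi g \o phi) W (z.2, z.1))
  + (tens (fun x => `|phi x|) J z + tens (fun x => `|phi x|) J (z.2, z.1)).

Lemma integrand_AB (u phi : T -> R) z :
  (forall y, `|u y| <= `|H y|) -> (forall x, ~ S1 x -> phi x = 0) ->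
  `|integrand s g k u phi z| <= Lam * (1 + Ctail n m C0) * (Apart u z + Bpart phi z).
Proof.
move=> uH pS; apply: le_trans (integrand_bound z uH pS) _.
rewrite -mulrA ler_wpM2l//.
have e0 v : 0 <= en s g v z by exact: en_ge0 hg _ _.
have near_le : near_part u phi z <= \1_(D `*` D) z * en s g u z + en s g phi z.
  rewrite /near_part.
  have I1 : 0 <= (\1_(D `*` D) z : R) <= 1.
    by rewrite indicE; case: (_ \in _); rewrite ?lexx ?ler01.
  move: I1 => /andP[i0 i1].
  apply: (@le_trans _ _ (\1_(D `*` D) z * (en s g u z + en s g phi z))).
    rewrite ler_wpM2l// -mulrDl ler_wpM2r//.
      by rewrite invr_ge0 exprn_ge0// dst_ge0.
    by have := young_one hg (normr_ge0 (DT s u z)) (normr_ge0 (DT s phi z)); rewrite !Phi_norm.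
  by rewrite mulrDr lerD2l ler_piMl.
have far_le x y : far_part u phi x y <= \1_S1 x * Phi g (u x) * W y
     + Phi g (phi x) * W y + `|phi x| * J y.
  rewrite /far_part mulrDr lerD2r -mulrDl mulrA ler_wpM2r//.
  rewrite indicE; have [Sx|/negP Sx0] := boolP (x \in S1); last first.
    have p0 : phi x = 0 by apply: pS => Sx; apply: Sx0; exact: mem_set.
    by rewrite p0 normr0 !mul0r add0r; exact: P0.
  by rewrite mul1r mulrC; have := young_one hg (normr_ge0 (u x)) (normr_ge0 (phi x));
    rewrite !Phi_norm.
have f1 := far_le z.1 z.2; have f2 := far_le z.2 z.1.
set X := \1_(D `*` D) z * en s g u z in near_le *.
rewrite /Apart /Bpart -/X /tens/=.
have X0 : 0 <= X by apply: mulr_ge0; [rewrite indicE|exact: e0].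
have i0 x : 0 <= (\1_S1 x : R) by rewrite indicE.
have a1 : 0 <= \1_S1 z.1 * Phi g (u z.1) * W z.2 by apply/mulr_ge0/W0/mulr_ge0/P0/i0.
have a2 : 0 <= \1_S1 z.2 * Phi g (u z.2) * W z.1 by apply/mulr_ge0/W0/mulr_ge0/P0/i0.
have b1 : 0 <= Phi g (phi z.1) * W z.2 by apply/mulr_ge0/W0/P0.
have b2 : 0 <= Phi g (phi z.2) * W z.1 by apply/mulr_ge0/W0/P0.
have c1 : 0 <= `|phi z.1| * J z.2 by apply/mulr_ge0/J0.
have c2 : 0 <= `|phi z.2| * J z.1 by apply/mulr_ge0/J0.
move: (e0 phi) X0 a1 a2 b1 b2 c1 c2 near_le f1 f2 (C00).
move: (en s g phi z) (\1_S1 z.1 * Phi g (u z.1) * W z.2) (\1_S1 z.2 * Phi g (u z.2) * W z.1)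
  (Phi g (phi z.1) * W z.2) (Phi g (phi z.2) * W z.1) (`|phi z.1| * J z.2) (`|phi z.2| * J z.1)
  X (near_part u phi z) (far_part u phi z.1 z.2) (far_part u phi z.2 z.1) (Ctail n m C0).
move=> x1 x2 x3 x4 x5 x6 x7 x8 x9 x10 x11 x12 *; rewrite mulrDl mul1r.
by apply: lerD; [lra|apply: ler_wpM2l => //; lra].
Qed.

Lemma measurable_J : measurable_fun setT J.
Proof.
have mnv (e : R) : measurable_fun setT (fun y : T => ((1 + nrm y) `^ e)^-1).
  have -> : (fun y : T => ((1 + nrm y) `^ e)^-1) = (fun y => (1 + nrm y) `^ (- e)).
    by apply/funext => y; rewrite powRN.
  apply: (measurableT_comp (measurable_powR _)); apply: measurable_funD => //.
  exact: measurable_nrm.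
apply: measurable_funM; last exact: mnv.
have -> : (fun y => g (`|H y| / (1 + nrm y) `^ s)) =
    (fun t : R => g `|t|) \o (fun y => `|H y| / (1 + nrm y) `^ s).
  by apply/funext => y; rewrite /= normrM normr_id normfV (ger0_norm (powR_ge0 _ _)).
apply: measurableT_comp; first by apply: continuous_measurable_fun.
by apply: measurable_funM => //; exact: measurableT_comp.
Qed.

Lemma measurable_W : measurable_fun setT W.
Proof.
rewrite /W /wgt.
have -> : (fun y : T => ((1 + nrm y) `^ (n%:R + s))^-1) = (fun y => (1 + nrm y) `^ (- (n%:R + s))).
  by apply/funext => y; rewrite powRN.
apply: (measurableT_comp (measurable_powR _)); apply: measurable_funD => //.
exact: measurable_nrm.
Qed.

End domination.

(** * Translation invariance of the dominating integral *)

Section translation_average.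
Context (R : realType) (n : nat).
Local Notation T := (n.-tuple R).
Variable mu : {sigma_finite_measure set T -> \bar R}.
Hypothesis mu_leb : is_lebesgue mu.
Variables (s : R) (s01 : 0 < s < 1) (g : R -> R) (m : nat).
Hypothesis hg : doubling g m.
Hypothesis gcont : continuous (fun t : R => g `|t|).
Variables (k : T * T -> R) (Lam : R).
Hypothesis mk : measurable_fun setT k.
Hypothesis k_ge0 : forall z, 0 <= k z.
Hypothesis k_le : forall z, k z <= Lam.
Variables (S1 D : set T) (C0 : R).
Hypothesis mS1 : measurable S1.
Hypothesis mD : measurable D.
Hypothesis S1D : S1 `<=` D.
Hypothesis C1 : 1 <= C0.
Hypothesis sep : forall x y, S1 x -> ~ D y -> 1 + nrm y <= C0 * dst x y.
Variable H : T -> R.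
Hypothesis mH : measurable_fun setT H.

Let J y := tailw s g (H y) y.
Let W := wgt s : T -> R.
Hypothesis IJ : mu.-integrable setT (EFin \o J).

Let J0 y : 0 <= J y. Proof. exact: tailw_ge0 hg _ _. Qed.
Let W0 y : 0 <= W y. Proof. exact: wgt_ge0. Qed.
Let P0 t : 0 <= Phi g t. Proof. exact: Phi_ge0 hg _. Qed.
Let mJ : measurable_fun setT J. Proof. exact: measurable_J. Qed.
Let mW : measurable_fun setT W. Proof. exact: measurable_W. Qed.

Lemma integrable_wgt : mu.-integrable setT (EFin \o W).
Proof.
apply/integrableP; split; first exact/measurable_EFinP.
under eq_integral => y _ do rewrite gee0_abs/= ?lee_fin//.
exact: integral_wgt_lt_pinfty.
Qed.

Section translates.
Local Open Scope ereal_scope.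

Lemma integral_BpartE (phi : T -> R) : measurable_fun setT phi ->
  \int[mu \x mu]_z (Bpart s g H phi z)%:E =
  \int[mu \x mu]_z (en s g phi z)%:E
  + (\int[mu]_x (Phi g (phi x))%:E * \int[mu]_x (W x)%:E
     + \int[mu]_x (Phi g (phi x))%:E * \int[mu]_x (W x)%:E)
  + (\int[mu]_x (`|phi x|)%:E * \int[mu]_x (J x)%:E
     + \int[mu]_x (`|phi x|)%:E * \int[mu]_x (J x)%:E).
Proof.
move=> mphi.
have mP : measurable_fun setT (Phi g \o phi).
  by apply: measurableT_comp => //; exact: measurable_Phi.
have mA : measurable_fun setT (fun x => `|phi x|%R) by exact: measurableT_comp.
have msw (f : T * T -> R) : measurable_fun setT f -> measurable_fun setT (fun z => f (z.2, z.1)).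
  by move=> mf; apply: (measurableT_comp mf); exact: measurable_swap.
have mt1 := measurable_tens mP mW; have mt2 := measurable_tens mA mJ.
have men := measurable_en s gcont mphi.
have t10 z : (0 <= tens (Phi g \o phi) W z)%R by exact: (mulr_ge0 (P0 (phi z.1)) (W0 z.2)).
have t20 z : (0 <= tens (fun x => `|phi x|) J z)%R by exact: (mulr_ge0 (normr_ge0 _) (J0 z.2)).
have e0 z : (0 <= en s g phi z)%R by exact: en_ge0 hg _ _.
have E2 (f : T * T -> R) : measurable_fun setT f -> (forall z, 0 <= f z)%R ->
    \int[mu \x mu]_z (f z + f (z.2, z.1))%:E =
    \int[mu \x mu]_z (f z)%:E + \int[mu \x mu]_z (f z)%:E.
  move=> mf f0; under eq_integral do rewrite EFinD.
  rewrite ge0_integralD//; try by move=> z _; rewrite lee_fin.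
  - rewrite (@ge0_integral_swap _ _ mu (fun z => (f z)%:E))//.
    by apply/measurable_EFinP.
  - by apply/measurable_EFinP.
  - by apply/measurable_EFinP; exact: msw.
rewrite /Bpart; under eq_integral do rewrite EFinD.
rewrite ge0_integralD//; last 4 first.
- by move=> z _; rewrite lee_fin; apply/addr_ge0/addr_ge0/t10/t10/e0.
- by apply/measurable_EFinP; exact: (measurable_funD men (measurable_funD mt1 (msw _ mt1))).
- by move=> z _; rewrite lee_fin; apply/addr_ge0/t20/t20.
- by apply/measurable_EFinP; exact: (measurable_funD mt2 (msw _ mt2)).
rewrite (E2 _ mt2 t20) ge0_integral_tens//.
congr (_ + _); under eq_integral do rewrite EFinD.
rewrite ge0_integralD//; last 4 first.
- by move=> z _; rewrite lee_fin.
- by apply/measurable_EFinP.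
- by move=> z _; rewrite lee_fin; apply/addr_ge0/t10/t10.
- by apply/measurable_EFinP; exact: (measurable_funD mt1 (msw _ mt1)).
by rewrite (E2 _ mt1 t10) ge0_integral_tens// => x; exact: P0.
Qed.

Definition tau (h : T) (phi : T -> R) (x : T) : R := phi (tadd x h).

Lemma measurable_tau h phi : measurable_fun setT phi -> measurable_fun setT (tau h phi).
Proof. by move=> mphi; apply: (measurableT_comp mphi); exact: measurable_taddr. Qed.

Lemma integral_Bpart_tau h (phi : T -> R) : measurable_fun setT phi ->
  \int[mu \x mu]_z (Bpart s g H (tau h phi) z)%:E = \int[mu \x mu]_z (Bpart s g H phi z)%:E.
Proof.
move=> mphi; rewrite !integral_BpartE//; last exact: measurable_tau.
have mP : measurable_fun setT (Phi g \o phi).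
  by apply: measurableT_comp => //; exact: measurable_Phi.
congr (_ + _); [congr (_ + _)|].
- under eq_integral do rewrite en_tadd.
  rewrite (@ge0_integral_translate2 _ _ mu mu_leb h (fun z => (en s g phi z)%:E))//.
    by apply/measurable_EFinP; exact: measurable_en.
  by move=> z; rewrite lee_fin; exact: en_ge0 hg _ _.
- rewrite (@ge0_integral_translate _ _ mu mu_leb h (fun x => (Phi g (phi x))%:E))//.
    exact/measurable_EFinP.
  by move=> z; rewrite lee_fin.
- rewrite (@ge0_integral_translate _ _ mu mu_leb h (fun x => (`|phi x|)%:E))//.
  by apply/measurable_EFinP; exact: measurableT_comp.
Qed.

End translates.
End translation_average.

(** * Nonsmooth test functions by selection of translates *)

Section mollified_test.
Context (R : realType) (n : nat).
Local Notation T := (n.-tuple R).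
Variable mu : {sigma_finite_measure set T -> \bar R}.
Hypothesis mu_leb : is_lebesgue mu.
Variables (s : R) (s01 : 0 < s < 1) (g : R -> R) (m : nat).
Hypothesis hg : doubling g m.
Hypothesis gcont : continuous (fun t : R => g `|t|).
Variables (k : T * T -> R) (Lam : R).
Hypothesis mk : measurable_fun setT k.
Hypothesis k_ge0 : forall z, 0 <= k z.
Hypothesis k_le : forall z, k z <= Lam.
Variables (S1 D : set T) (C0 : R).
Hypothesis mS1 : measurable S1.
Hypothesis mD : measurable D.
Hypothesis S1D : S1 `<=` D.
Hypothesis C1 : 1 <= C0.
Hypothesis sep : forall x y, S1 x -> ~ D y -> 1 + nrm y <= C0 * dst x y.
Variable H : T -> R.
Hypothesis mH : measurable_fun setT H.

Let J y := tailw s g (H y) y.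
Let W := wgt s : T -> R.
Hypothesis IJ : mu.-integrable setT (EFin \o J).

Let J0 y : 0 <= J y. Proof. exact: tailw_ge0 hg _ _. Qed.
Let W0 y : 0 <= W y. Proof. exact: wgt_ge0. Qed.
Let P0 t : 0 <= Phi g t. Proof. exact: Phi_ge0 hg _. Qed.
Let mJ : measurable_fun setT J. Proof. exact: measurable_J. Qed.
Let mW : measurable_fun setT W. Proof. exact: measurable_W. Qed.

Let IW : mu.-integrable setT (EFin \o W). Proof. exact: integrable_wgt. Qed.
Let mB (phi : T -> R) : measurable_fun setT phi -> measurable_fun setT (Bpart s g H phi).
Proof.
move=> mphi.
have msw (f : T * T -> R) : measurable_fun setT f -> measurable_fun setT (fun z => f (z.2, z.1)).
  by move=> mf; apply: (measurableT_comp mf); exact: measurable_swap.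
have mt1 : measurable_fun setT (tens (Phi g \o phi) W).
  apply: measurable_tens => //; apply: measurableT_comp => //; exact: measurable_Phi.
have mt2 : measurable_fun setT (tens (fun x => `|phi x|) J).
  by apply: measurable_tens => //; exact: measurableT_comp.
apply: measurable_funD; last exact: (measurable_funD mt2 (msw _ mt2)).
apply: measurable_funD; first exact: measurable_en.
exact: (measurable_funD mt1 (msw _ mt1)).
Qed.

Lemma Bpart_ge0 (phi : T -> R) z : 0 <= Bpart s g H phi z.
Proof.
rewrite /Bpart /tens /=; apply/addr_ge0/addr_ge0; last 2 first.
- by apply/mulr_ge0/J0.
- by apply/mulr_ge0/J0.
apply/addr_ge0/addr_ge0; first exact: en_ge0 hg _ _.
- by apply/mulr_ge0/W0/P0.
- by apply/mulr_ge0/W0/P0.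
Qed.

Variable u : T -> R.
Hypothesis mu' : measurable_fun setT u.
Hypothesis uH : forall y, `|u y| <= `|H y|.
Hypothesis IA : (mu \x mu)%E.-integrable setT (EFin \o Apart s g S1 D u).

Lemma integrable_integrand (phi : T -> R) : measurable_fun setT phi -> (forall x, ~ S1 x -> phi x = 0) ->
  (mu \x mu)%E.-integrable setT (EFin \o Bpart s g H phi) ->
  (mu \x mu)%E.-integrable setT (EFin \o integrand s g k u phi).
Proof.
move=> mphi phi0 IB.
apply: (@le_integrable _ _ _ (mu \x mu)%E setT measurableT _
  (fun z => (Lam * (1 + Ctail n m C0))%:E * ((EFin \o Apart s g S1 D u) z
     + (EFin \o Bpart s g H phi) z))%E).
- by apply/measurable_EFinP; exact: (measurable_integrand _ hg).
- move=> z _; rewrite /= lee_fin.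
  apply: le_trans (integrand_AB s01 hg k_ge0 k_le S1D C1 sep z uH phi0) _.
  exact: ler_norm.
- by apply: integrableZl => //; exact: integrableD.
Qed.

Lemma integrable_Bpart_tau h (phi : T -> R) : measurable_fun setT phi ->
  (mu \x mu)%E.-integrable setT (EFin \o Bpart s g H phi) ->
  (mu \x mu)%E.-integrable setT (EFin \o Bpart s g H (tau h phi)).
Proof.
move=> mphi /integrableP[_ fin]; apply/integrableP; split.
  by apply/measurable_EFinP; apply: mB; exact: measurable_tau.
move: fin; under eq_integral => z _ do rewrite gee0_abs/= ?lee_fin ?Bpart_ge0//.
under [X in _ -> (X < _)%E]eq_integral => z _ do rewrite gee0_abs/= ?lee_fin ?Bpart_ge0//.
by rewrite (integral_Bpart_tau mu_leb s hg gcont mH h mphi).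
Qed.

Lemma tau_support (S0 : set T) (phi : T -> R) (e0 : R) (h : T) :
  (forall x, ~ S0 x -> phi x = 0) ->
  (forall x h, S0 (tadd x h) -> `|rv h| < e0 -> S1 x) -> `|rv h| < e0 ->
  forall x, ~ S1 x -> tau h phi x = 0.
Proof.
move=> phi0 S01 he x Sx; apply: phi0 => Sxh; apply: Sx; exact: S01 Sxh he.
Qed.

Lemma taddC (x h : T) : tadd x h = tadd h x.
Proof. by apply: eq_from_tnth => i; rewrite !tnth_mktuple addrC. Qed.

Lemma tadd_sub (x y : T) : tadd x (tof (rv y - rv x)) = y.
Proof. by apply: eq_from_tnth => i; rewrite !tnth_mktuple !mxE; ring. Qed.

Section average.
Variables (phi : T -> R) (e : R).
Hypothesis e_gt0 : 0 < e.
Hypothesis phi_ge0 : forall x, 0 <= phi x.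
Hypothesis Iphi : mu.-integrable setT (EFin \o phi).

Let rho (h : T) : R := moll e (fun=> 0%N) (rv h).
Let psi := conv mu phi (moll e (fun=> 0%N)).

Let rho_ge0 h : 0 <= rho h. Proof. exact: moll_ge0. Qed.

Let mrho : measurable_fun setT rho.
Proof.
by apply: measurable_continuous_rv; apply: bdd_lip_continuous; exact: moll_bdd_lip.
Qed.

Lemma average_tau x : mu.-integrable setT (fun h => (rho h * phi (tadd x h))%:E) /\
  (\int[mu]_h (rho h * phi (tadd x h))%:E)%E = (psi (rv x))%:E.
Proof.
pose f y := (phi y * moll e (fun=> 0%N) (rv y - rv x))%:E.
have If : mu.-integrable setT f by apply: integrable_conv => //; exact: moll_bdd_lip.
have [mf _] := integrableP _ _ _ If.
have f0 y : (0 <= f y)%E by rewrite lee_fin mulr_ge0// moll_ge0.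
have E h : (rho h * phi (tadd x h))%:E = f (tadd h x).
  by rewrite /f taddC rv_tadd addrK mulrC.
have Ei : (\int[mu]_h (rho h * phi (tadd x h))%:E = \int[mu]_y f y)%E.
  by under eq_integral do rewrite E; rewrite ge0_integral_translate.
split.
  apply/integrableP; split.
    apply/measurable_EFinP; apply: measurable_funM => //.
    apply: (measurableT_comp (integrable_mfun Iphi)); exact: measurable_taddl.
  under eq_integral => h _ do rewrite gee0_abs/= ?lee_fin ?mulr_ge0//.
  rewrite Ei; have [_] := integrableP _ _ _ If.
  by under eq_integral => y _ do rewrite gee0_abs//.
by rewrite Ei /psi /conv /Rintegral fineK//; exact: integrable_fin_num.
Qed.

Lemma integral_rho_lt_pinfty : (\int[mu]_h (rho h)%:E < +oo)%E.
Proof.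
have [C C_ge0 [Cb _]] := moll_bdd_lip e (fun _ : 'I_n => 0%N).
have mc : measurable (cube [tuple 0 | i < n] e : set T) by exact: measurable_box.
apply: (@le_lt_trans _ _ (\int[mu]_h (C%:E * (\1_(cube [tuple 0 | i < n] e) h)%:E))%E).
  apply: ge0_le_integralT => h; first by rewrite lee_fin.
  rewrite -EFinM lee_fin; have [he|he] := ltP `|rv h| e.
    rewrite indicE mem_set ?mulr1; first exact: le_trans (ler_norm _) (Cb _).
    apply: cubeP => //; have -> : rv ([tuple 0 | i < n] : T) = 0 :> 'rV[R]_n.
      by apply/rowP => i; rewrite !mxE tnth_mktuple.
    by rewrite sub0r normrN ltW.
  by rewrite /rho moll_support// mulr_ge0.
have box0 i : tnth [tuple tnth [tuple 0 | i < n] i - 2 * e | i < n] i <=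
    tnth [tuple tnth [tuple 0 | i < n] i + 2 * e | i < n] i :> R.
  by rewrite !tnth_mktuple lerD2l -subr_ge0 opprK -mulr2n mulrn_wge0// mulr_ge0// ltW.
have I1 := integrable_indic_fin mc (mu_box_lt_pinfty mu_leb box0).
have I2 := integrableZl measurableT C I1.
by rewrite ltey_eq (integrable_fin_num measurableT I2).
Qed.

Lemma integrand_average z :
  (\int[mu]_h (rho h * integrand s g k u (tau h phi) z)%:E)%E =
  (integrand s g k u (psi \o @rv R n) z)%:E.
Proof.
pose c := gsign g (DT s u z) / dst z.1 z.2 `^ s * k z / dst z.1 z.2 ^+ n.
have [I1 E1] := average_tau z.1; have [I2 E2] := average_tau z.2.
transitivity (\int[mu]_h (c%:E * ((rho h * phi (tadd z.1 h))%:E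
     - (rho h * phi (tadd z.2 h))%:E)))%E.
  apply: eq_integral => h _; rewrite -EFinB -EFinM; congr EFin.
  by rewrite integrandE /tau -mulrBr mulrCA.
rewrite integralZl//; last exact: integrableB.
by rewrite integralB// E1 E2 -EFinB -EFinM integrandE.
Qed.

Variables (Om K : set 'rV[R]_n) (S0 : set T) (e0 : R).
Hypothesis phi0 : forall x, ~ S0 x -> phi x = 0.
Hypothesis ee0 : e <= e0.
Hypothesis S01 : forall x h, S0 (tadd x h) -> `|rv h| < e0 -> S1 x.
Hypothesis cK : compact K.
Hypothesis KOm : K `<=` Om.
Hypothesis S1K : forall x, S1 x -> K (rv x).
Hypothesis IB : (mu \x mu)%E.-integrable setT (EFin \o Bpart s g H phi).
Hypothesis u_super : forall f : 'rV[R]_n -> R, testfun Om f -> (forall x, 0 <= f x) ->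
  (0 <= \int[mu \x mu]_z (integrand s g k u (f \o @rv R n) z)%:E)%E.

Let mphi : measurable_fun setT phi. Proof. exact: integrable_mfun Iphi. Qed.

Let f (w : (T * T) * T) : R := rho w.2 * integrand s g k u (tau w.2 phi) w.1.

Let mf : measurable_fun setT f.
Proof.
have m12 : measurable_fun setT (fun w : (T * T) * T => w.1) by exact: measurable_fst.
have mt (p : (T * T) * T -> T) : measurable_fun setT p ->
    measurable_fun setT (fun w : (T * T) * T => phi (tadd (p w) w.2)).
  move=> mp; apply: (measurableT_comp mphi).
  apply: (@measurableT_comp _ _ _ _ _ _ (fun z : T * T => tadd z.1 z.2) _ (fun w => (p w, w.2))).
    exact: measurable_tadd.
  by apply: measurable_fun_pair.
have mg : measurable_fun setT (fun z => integrand s g k u (cst 1) z).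
  by apply: (measurable_integrand _ hg).
pose c z := gsign g (DT s u z) / dst z.1 z.2 `^ s * k z / dst z.1 z.2 ^+ n.
have mc : measurable_fun setT c.
  rewrite /c; apply: measurable_funM; last exact: measurable_inv_dst.
  apply: measurable_funM => //; apply: measurable_funM.
    apply: (@measurableT_comp _ _ _ _ _ _ (gsign g)); last exact: measurable_DT.
    by apply: continuous_measurable_fun; exact: (continuous_gsign hg).
  have -> : (fun z : T * T => (dst z.1 z.2 `^ s)^-1) = (fun z => dst z.1 z.2 `^ (- s)).
    by apply/funext => z; rewrite powRN.
  by apply: (measurableT_comp (measurable_powR _)); exact: measurable_dst.
have -> : f = (fun w => rho w.2 * (c w.1 * (phi (tadd w.1.1 w.2) - phi (tadd w.1.2 w.2)))).
  by apply/funext => w; rewrite /f integrandE.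
apply: measurable_funM; first exact: (measurableT_comp mrho measurable_snd).
apply: measurable_funM; first exact: (measurableT_comp mc m12).
apply: measurable_funB; apply: mt.
- exact: (measurableT_comp measurable_fst m12).
- exact: (measurableT_comp measurable_snd m12).
Qed.

(** The hypothesis of Fubini's theorem: for each h the dominating function of the translate has the
    same integral, so the triple integral is at most a constant times the integral of [rho]. *)
Let If : (prodm mu mu \x mu)%E.-integrable setT (EFin \o f).
Proof.
have mEf : measurable_fun setT (EFin \o f) by apply/measurable_EFinP.
apply/(integrable21ltyP (prodm mu mu) mu mEf).
change (\int[mu]_h \int[mu \x mu]_z `|(EFin \o f) (z, h)| < +oo)%E.
pose Cst := Lam * (1 + Ctail n m C0).
pose AB : \bar R := (\int[mu \x mu]_z (Apart s g S1 D u z)%:E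
  + \int[mu \x mu]_z (Bpart s g H phi z)%:E)%E.
have ABfin : AB \is a fin_num.
  by rewrite fin_numD !integrable_fin_num.
have Cst0 : 0 <= Cst.
  have L0 : 0 <= Lam by exact: le_trans (k_ge0 (point, point)) (k_le _).
  have c0 : 0 <= C0 by exact: le_trans C1.
  by rewrite /Cst /Ctail !mulr_ge0 ?addr_ge0 ?mulr_ge0 ?exprn_ge0.
have A0 z : 0 <= Apart s g S1 D u z.
  rewrite /Apart /tens/=; apply/addr_ge0/addr_ge0.
  - by apply: mulr_ge0; [rewrite indicE|exact: en_ge0 hg _ _].
  - by apply/mulr_ge0/W0/mulr_ge0/P0; rewrite indicE.
  - by apply/mulr_ge0/W0/mulr_ge0/P0; rewrite indicE.
have mA : measurable_fun setT (Apart s g S1 D u).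
  by have /integrableP[/measurable_EFinP] := IA.
apply: (@le_lt_trans _ _ (\int[mu]_h ((Cst * fine AB)%:E * (rho h)%:E))%E); last first.
  rewrite ge0_integralZl//; last 3 first.
  - exact/measurable_EFinP.
  - by move=> h _; rewrite lee_fin; exact: rho_ge0.
  - rewrite lee_fin mulr_ge0// fine_ge0// adde_ge0//; apply: integral_ge0 => z _; rewrite lee_fin//.
    exact: Bpart_ge0.
  apply: lte_mul_pinfty => //.
    rewrite lee_fin mulr_ge0// fine_ge0// adde_ge0//; apply: integral_ge0 => z _; rewrite lee_fin//.
    exact: Bpart_ge0.
  exact: integral_rho_lt_pinfty.
apply: ge0_le_integralT => h; first by apply: integral_ge0.
have [he|he] := ltP `|rv h| e; last first.
  rewrite [X in (X <= _)%E](_ : _ = 0%E); last first.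
    rewrite -[RHS](integral0 (mu \x mu)%E setT); apply: eq_integral => z _.
    by rewrite /f /rho/= moll_support// mul0r normr0.
  by rewrite /rho moll_support// mule0.
have tS := @tau_support S0 phi e0 h phi0 S01 (lt_le_trans he ee0).
apply: (@le_trans _ _ (\int[mu \x mu]_z ((rho h * Cst)%:E *
    ((Apart s g S1 D u z)%:E + (Bpart s g H (tau h phi) z)%:E)))%E).
  apply: ge0_le_integralT => z; first exact: abse_ge0.
  rewrite -EFinD -EFinM /f /= lee_fin normrM (ger0_norm (rho_ge0 h)) -mulrA ler_wpM2l//.
  exact: (integrand_AB s01 hg k_ge0 k_le S1D C1 sep z uH tS).
have mBt : measurable_fun setT (Bpart s g H (tau h phi)) by apply: mB; exact: measurable_tau.
rewrite ge0_integralZl//; last 3 first.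
- by apply: emeasurable_funD; exact/measurable_EFinP.
- by move=> z _; rewrite adde_ge0 ?lee_fin//; exact: Bpart_ge0.
- by rewrite lee_fin mulr_ge0//; exact: rho_ge0.
rewrite ge0_integralD//; last 4 first.
- by move=> z _; rewrite lee_fin.
- exact/measurable_EFinP.
- by move=> z _; rewrite lee_fin; exact: Bpart_ge0.
- exact/measurable_EFinP.
rewrite (integral_Bpart_tau mu_leb s hg gcont mH h mphi) -/AB.
have EAB : AB = (fine AB)%:E by rewrite fineK.
by rewrite [X in (_ * X <= _)%E]EAB -!EFinM lee_fin [leRHS]mulrC -mulrA lexx.
Qed.

(** Otherwise every translate by less than [e] would give a negative integral, and so would their
    average against the positive kernel. By Fubini this average is the integral for the
    mollification, a smooth test function, which is nonnegative. *)
Lemma exists_good_translate : exists2 h, `|rv h| < e &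
  (0 <= \int[mu \x mu]_z (integrand s g k u (tau h phi) z)%:E)%E.
Proof.
apply: contrapT => nex.
have neg h : `|rv h| < e -> (\int[mu \x mu]_z (integrand s g k u (tau h phi) z)%:E < 0)%E.
  by move=> he; rewrite ltNge; apply/negP => pos; apply: nex; exists h.
pose G h := (\int[mu \x mu]_z (f (z, h))%:E)%E.
have GE h : `|rv h| < e -> G h =
    ((rho h)%:E * \int[mu \x mu]_z (integrand s g k u (tau h phi) z)%:E)%E.
  move=> he; have tS := @tau_support S0 phi e0 h phi0 S01 (lt_le_trans he ee0).
  rewrite -integralZl//.
    by apply: integrable_integrand => //; [exact: measurable_tau|exact: integrable_Bpart_tau].
have G0 h : e <= `|rv h| -> G h = 0%E.
  move=> he; rewrite -[RHS](integral0 (mu \x mu)%E setT); apply: eq_integral => z _.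
  by rewrite /f /rho/= moll_support// mul0r.
have Gneg h : `|rv h| < e -> (G h < 0)%E.
  by move=> he; rewrite GE// pmule_rlt0 ?neg// lte_fin; exact: moll_gt0.
have Gle h : (G h <= 0)%E.
  by have [/Gneg/ltW//|/G0 ->] := ltP `|rv h| e.
have Gpos : (0 <= \int[mu]_h G h)%E.
  rewrite -(Fubini If).
  have -> : (\int[mu \x mu]_z \int[mu]_h (EFin \o f) (z, h) =
     \int[mu \x mu]_z (integrand s g k u (psi \o @rv R n) z)%:E)%E.
    by apply: eq_integral => z _; exact: integrand_average.
  apply: u_super; last by move=> x; apply: conv_ge0.
  apply: (@testfun_conv _ _ _ _ Iphi _ e_gt0 Om K S0) => // x y Sy yx.
  rewrite -[x]tofK; apply: S1K; apply: (S01 (h := tof (rv y - x))); last first.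
    by rewrite tofK; exact: lt_le_trans yx ee0.
  by rewrite -[in tof (rv y - x)](tofK x) tadd_sub.
have Gabs h : G h = (- `|G h|)%E by rewrite lee0_abs// oppeK.
have mG : measurable_fun setT G.
  by have := measurable_fubini_G If.
have intG : (\int[mu]_h `|G h| = 0)%E.
  apply/eqP; rewrite eq_le integral_ge0// andbT.
  by move: Gpos; under eq_integral do rewrite Gabs; rewrite integral_ge0N// oppe_ge0.
have /(ae_eq_integral_abs mu measurableT mG) G0ae := intG.
(* [G] is nonpositive with nonnegative integral, so it vanishes almost everywhere; but it is
   negative on this cube around the origin, whose volume is e^n. *)
pose lo : T := [tuple - (e / 2) | i < n]; pose hi : T := [tuple e / 2 | i < n].
have lohi i : tnth lo i <= tnth hi i.
  by rewrite !tnth_mktuple; have := e_gt0; lra.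
have neglB : mu.-negligible (box lo hi).
  apply: negligibleS G0ae => h hB /= /(_ Logic.I) Gh0.
  have he : `|rv h| < e.
    apply/normr_rvP => // i; have := hB i; rewrite !tnth_mktuple mxE => /andP[h1 h2].
    by rewrite ltr_norml; have := e_gt0; lra.
  by have := Gneg h he; rewrite Gh0 ltxx.
have : mu (box lo hi) = 0%E by apply: measure_negligible => //; exact: measurable_box.
rewrite mu_leb// => -[] /eqP; rewrite (eq_bigr (fun=> e)) => [|i _].
  by rewrite prodr_const (negbTE (expf_neq0 _ _))// gt_eqF.
by rewrite !tnth_mktuple; field.
Qed.

End average.

(* Testing with the mollification of [phi] yields admissible translates of [phi] by arbitrarily
   small vectors; along a sequence of them the integrands converge, and the dominating
   functions, being translates of a fixed function plus a fixed one, keep their integral. *)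
Lemma supersol_test (phi : T -> R) (Om K : set 'rV[R]_n) (S0 : set T) (e0 : R) :
  0 < e0 -> (forall x, 0 <= phi x) -> mu.-integrable setT (EFin \o phi) ->
  (forall x, ~ S0 x -> phi x = 0) ->
  (forall x h, S0 (tadd x h) -> `|rv h| < e0 -> S1 x) -> compact K -> K `<=` Om ->
  (forall x, S1 x -> K (rv x)) ->
  (mu \x mu)%E.-integrable setT (EFin \o Bpart s g H phi) ->
  (forall f : 'rV[R]_n -> R, testfun Om f -> (forall x, 0 <= f x) ->
    (0 <= \int[mu \x mu]_z (integrand s g k u (f \o @rv R n) z)%:E)%E) ->
  (mu \x mu)%E.-integrable setT (EFin \o integrand s g k u phi) /\
  (0 <= \int[mu \x mu]_z (integrand s g k u phi z)%:E)%E.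
Proof.
move=> e00 phi_ge0 Iphi phi0 S01 cK KOm S1K IB u_super.
have mphi := integrable_mfun Iphi.
(* Keeping the translation below [e0] ensures that the translate still vanishes outside [S1], so the
   same dominating functions apply. *)
pose P h := `|rv h| < e0 /\
  (0 <= \int[mu \x mu]_z (integrand s g k u (tau h phi) z)%:E)%E.
have exP e : 0 < e -> exists2 h, P h & `|rv h| < e.
  move=> e_gt0; have m0 : 0 < Num.min e e0 by rewrite lt_min e_gt0.
  have me : Num.min e e0 <= e0 by rewrite ge_min lexx orbT.
  have [h hm hpos] := exists_good_translate m0 phi_ge0 Iphi phi0 me S01 cK KOm S1K IB u_super.
  by move: hm; rewrite lt_min => /andP[he he0]; exists h.
have [h_ [hP cv]] := cvg_translate_ae mu_leb phi_ge0 Iphi exP.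
pose Cst := Lam * (1 + Ctail n m C0).
pose a_ j z := Cst * (Apart s g S1 D u z + Bpart s g H (tau (h_ j) phi) z).
pose a z := Cst * (Apart s g S1 D u z + Bpart s g H phi z).
have Ia psi : (mu \x mu)%E.-integrable setT (EFin \o Bpart s g H psi) ->
    (mu \x mu)%E.-integrable setT
      (EFin \o (fun z => Cst * (Apart s g S1 D u z + Bpart s g H psi z))).
  move=> IBp; have := integrableZl measurableT Cst (integrableD measurableT IA IBp).
  by apply: eq_integrable.
have cvz : {ae (mu \x mu)%E, forall z,
    (fun j => tau (h_ j) phi z.1) @ \oo --> phi z.1 /\
    (fun j => tau (h_ j) phi z.2) @ \oo --> phi z.2}.
  by apply: filterS2 (ae_fst cv) (ae_snd cv) => z c1 c2.
have cPhi (b_ : nat -> R) b : b_ @ \oo --> b -> (fun j => Phi g (b_ j)) @ \oo --> Phi g b.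
  by move=> cb; apply: (cvg_comp _ _ cb); exact: continuous_Phi.
have cDT z : (fun j => tau (h_ j) phi z.1) @ \oo --> phi z.1 ->
    (fun j => tau (h_ j) phi z.2) @ \oo --> phi z.2 ->
    (fun j => DT s (tau (h_ j) phi) z) @ \oo --> DT s phi z.
  by move=> c1 c2; apply: cvgM; [exact: cvgB|exact: cvg_cst].
have cint z : (fun j => tau (h_ j) phi z.1) @ \oo --> phi z.1 ->
    (fun j => tau (h_ j) phi z.2) @ \oo --> phi z.2 ->
    (fun j => integrand s g k u (tau (h_ j) phi) z) @ \oo --> integrand s g k u phi z.
  move=> c1 c2; under eq_fun do rewrite integrandE; rewrite integrandE.
  by apply: cvgM; [exact: cvg_cst|exact: cvgB].
have cB z : (fun j => tau (h_ j) phi z.1) @ \oo --> phi z.1 ->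
    (fun j => tau (h_ j) phi z.2) @ \oo --> phi z.2 ->
    (fun j => Bpart s g H (tau (h_ j) phi) z) @ \oo --> Bpart s g H phi z.
  move=> c1 c2; rewrite /Bpart /tens /en /=.
  apply: cvgD; first apply: cvgD.
  - by apply: cvgM; [apply: cPhi; exact: cDT|exact: cvg_cst].
  - by apply: cvgD; apply: cvgM; [exact: cPhi|exact: cvg_cst|exact: cPhi|exact: cvg_cst].
  - by apply: cvgD; apply: cvgM; [exact: cvg_norm|exact: cvg_cst|exact: cvg_norm|exact: cvg_cst].
have tS j := @tau_support S0 phi e0 (h_ j) phi0 S01 (proj1 (hP j)).
have mfj j : measurable_fun setT (integrand s g k u (tau (h_ j) phi)).
  by apply: (measurable_integrand _ hg) => //; exact: measurable_tau.
have mfl : measurable_fun setT (integrand s g k u phi) by exact: (measurable_integrand _ hg).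
have Iaj j : (mu \x mu)%E.-integrable setT (EFin \o a_ j).
  by apply: Ia; exact: integrable_Bpart_tau.
have bnd j z : `|integrand s g k u (tau (h_ j) phi) z| <= a_ j z.
  exact: (integrand_AB s01 hg k_ge0 k_le S1D C1 sep z uH (tS j)).
have cfz : {ae (mu \x mu)%E, forall z,
    (fun j => integrand s g k u (tau (h_ j) phi) z) @ \oo --> integrand s g k u phi z}.
  by apply: filterS cvz => z [c1 c2]; exact: cint.
have caz : {ae (mu \x mu)%E, forall z, (fun j => a_ j z) @ \oo --> a z}.
  apply: filterS cvz => z [c1 c2]; apply: cvgM; first exact: cvg_cst.
  by apply: cvgD; [exact: cvg_cst|exact: cB].
have intE psi : (mu \x mu)%E.-integrable setT (EFin \o Bpart s g H psi) ->
    (\int[mu \x mu]_z (Cst * (Apart s g S1 D u z + Bpart s g H psi z))%:E =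
     Cst%:E * (\int[mu \x mu]_z (Apart s g S1 D u z)%:E
       + \int[mu \x mu]_z (Bpart s g H psi z)%:E))%E.
  move=> IBp; rewrite -integralD//; rewrite -integralZl//; exact: integrableD.
have ale j : (\int[mu \x mu]_z (a_ j z)%:E <= \int[mu \x mu]_z (a z)%:E + 0%:E)%E.
  rewrite adde0 /a_ /a (intE _ (integrable_Bpart_tau (h_ j) mphi IB)) (intE _ IB).
  by rewrite (integral_Bpart_tau mu_leb s hg gcont mH (h_ j) mphi).
have fpos j : (0 <= \int[mu \x mu]_z (integrand s g k u (tau (h_ j) phi) z)%:E)%E.
  by have [] := hP j.
have [IF] := fatou_dominated mfj mfl Iaj (Ia _ IB) bnd cfz caz ale fpos.
by rewrite oppr0.
Qed.

End mollified_test.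

(** * The Caccioppoli estimate *)

Section caccioppoli.
Context (R : realType) (n : nat).
Local Notation T := (n.-tuple R).
Variable mu : {sigma_finite_measure set T -> \bar R}.
Hypothesis mu_leb : is_lebesgue mu.
Variables (s : R) (s01 : 0 < s < 1) (g : R -> R) (m : nat).
Hypothesis hg : doubling g m.
Hypothesis gcont : continuous (fun t : R => g `|t|).
Variables (k : T * T -> R) (Lam : R).
Hypothesis mk : measurable_fun setT k.
Hypothesis k_ge0 : forall z, 0 <= k z.
Hypothesis k_le : forall z, k z <= Lam.
Variables (S1 D : set T) (C0 : R).
Hypothesis mS1 : measurable S1.
Hypothesis mD : measurable D.
Hypothesis S1D : S1 `<=` D.
Hypothesis C1 : 1 <= C0.
Hypothesis sep : forall x y, S1 x -> ~ D y -> 1 + nrm y <= C0 * dst x y.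
Variable H : T -> R.
Hypothesis mH : measurable_fun setT H.

Let J y := tailw s g (H y) y.
Let W := wgt s : T -> R.
Hypothesis IJ : mu.-integrable setT (EFin \o J).

Let J0 y : 0 <= J y. Proof. exact: tailw_ge0 hg _ _. Qed.
Let W0 y : 0 <= W y. Proof. exact: wgt_ge0. Qed.
Let P0 t : 0 <= Phi g t. Proof. exact: Phi_ge0 hg _. Qed.
Let mJ : measurable_fun setT J. Proof. exact: measurable_J. Qed.
Let mW : measurable_fun setT W. Proof. exact: measurable_W. Qed.

Let IW : mu.-integrable setT (EFin \o W). Proof. exact: integrable_wgt. Qed.
Let Pm (f : T -> R) : measurable_fun setT f -> measurable_fun setT (Phi g \o f).
Proof. by move=> mf; apply: measurableT_comp => //; exact: measurable_Phi. Qed.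

Variable rho : R.
Hypothesis rho0 : 0 < rho.
Hypothesis Drho : forall x y, D x -> D y -> `|rv x - rv y| <= rho.

(** The truncation at [rho], a bound for the diameter of [D], makes the integral in y bounded
    uniformly in x. *)
Definition kaprho (z : T * T) : R := kap s z.1 z.2 * (`|rv z.1 - rv z.2| <= rho)%R%:R.

Lemma kaprho_ge0 z : 0 <= kaprho z. Proof. by rewrite mulr_ge0// kap_ge0. Qed.

Lemma measurable_kaprho : measurable_fun setT kaprho.
Proof.
apply: measurable_funM.
  apply: measurable_funM; last exact: measurable_inv_dst.
  by apply: (measurableT_comp (measurable_powR _)); exact: measurable_dst.
pose c (v : 'rV[R]_n) : R := (`|v| <= rho)%R%:R.
have -> : (fun z : T * T => (`|rv z.1 - rv z.2| <= rho)%R%:R : R) =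
    (fun w : T => c (rv w)) \o (fun z => tof (rv z.1 - rv z.2)).
  by apply/funext => z; rewrite /= tofK.
have mc : measurable_fun setT (fun w : T => c (rv w)).
  have mn : measurable_fun setT (fun w : T => `|rv w|).
    by apply: (@measurable_continuous_rv R n (fun v => `|v|)); exact: norm_continuous.
  have -> : (fun w : T => c (rv w)) = \1_[set w : T | `|rv w| <= rho].
    apply/funext => w; rewrite indicE /c.
    suff -> : (w \in [set w : T | `|rv w| <= rho]) = (`|rv w| <= rho) by [].
    by apply/idP/idP => [/set_mem//|h]; apply/mem_set.
  apply: measurable_indic.
  rewrite (_ : [set w : T | _] = (fun w : T => `|rv w|) @^-1` `]-oo, rho]); last first.
    by apply/seteqP; split => w; rewrite /= in_itv.
  by rewrite -[X in measurable X]setTI; exact: mn.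
apply: (measurableT_comp mc).
apply/measurable_fun_tnthP => i.
rewrite (_ : _ \o _ = fun z : T * T => tnth z.1 i - tnth z.2 i); last first.
  by apply/funext => z; rewrite /= tnth_mktuple !mxE.
by apply: measurable_funB; apply: (measurableT_comp (measurable_tnth i)).
Qed.

Lemma integrable_kaprho (a : T -> R) : (forall x, 0 <= a x) -> mu.-integrable setT (EFin \o a) ->
  (mu \x mu)%E.-integrable setT (EFin \o (fun z => a z.1 * kaprho z)).
Proof.
move=> a0 Ia; have ma := integrable_mfun Ia.
have [C C_ge0 HC] := integral_kap_bounded mu_leb s01 rho0.
have mf : measurable_fun setT (fun z : T * T => a z.1 * kaprho z).
  apply: measurable_funM; last exact: measurable_kaprho.
  exact: (measurableT_comp ma measurable_fst).
have f0 z : 0 <= a z.1 * kaprho z by rewrite mulr_ge0// kaprho_ge0.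
apply/integrableP; split; first exact/measurable_EFinP.
under eq_integral => z _ do rewrite gee0_abs/= ?lee_fin//.
have mEf : measurable_fun setT (fun z : T * T => (a z.1 * kaprho z)%:E).
  exact/measurable_EFinP.
rewrite (fubini_tonelli1 _ mEf)//.
apply: (@le_lt_trans _ _ (\int[mu]_x (C%:E * (a x)%:E))%E); last first.
  have := integrable_fin_num measurableT (integrableZl measurableT C Ia).
  by rewrite ltey_eq => ->.
apply: ge0_le_integralT => x; first by apply: integral_ge0 => y _; rewrite lee_fin.
rewrite /fubini_F /=; under eq_integral do rewrite EFinM.
have mk1 : measurable_fun setT (fun y => kaprho (x, y)).
  apply: (measurableT_comp measurable_kaprho); exact: measurable_pair1.
rewrite ge0_integralZl//; last 3 first.
- exact/measurable_EFinP.
- by move=> y _; rewrite lee_fin kaprho_ge0.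
- by rewrite lee_fin.
rewrite muleC; apply: lee_wpmul2r; first by rewrite lee_fin.
exact: HC.
Qed.

Variables (S0 : set T) (eta : T -> R) (L : R).
Hypothesis S0S1 : S0 `<=` S1.
Hypothesis meta : measurable_fun setT eta.
Hypothesis eta01 : forall x, 0 <= eta x <= 1.
Hypothesis eta0 : forall x, ~ S0 x -> eta x = 0.
Hypothesis L1 : 1 <= L.
Hypothesis eta_lip : forall x y, `|eta x - eta y| <= L * `|rv x - rv y|.

Definition CL : R := (L * (1 + n%:R * rho)) ^+ m.+1.

Let r01 : 1 <= 1 + n%:R * rho.
Proof. by rewrite lerDl mulr_ge0// ltW. Qed.

Lemma CL_ge0 : 0 <= CL.
Proof. by rewrite exprn_ge0// mulr_ge0// ?(le_trans ler01). Qed.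

(** One factor th = |x-y|^(1-s) has to leave [Phi] for the kernel to become integrable. The quotient
    is at most L th and th <= L2 = 1 + n rho; the factor th/L2 <= 1 comes out linearly by
    [Phi_contract], the constant L L2 by [Phi_scale], which explains [CL]. *)
Lemma Phi_cutoff_le (w : R) x y : D x -> D y ->
  Phi g (w * ((eta x - eta y) / dst x y `^ s)) / dst x y ^+ n <= CL * (Phi g w * kaprho (x, y)).
Proof.
move=> Dx Dy; have xyr := Drho Dx Dy.
have [s0 s1] : 0 < s /\ 0 < 1 - s by case/andP: s01 => ? ?; rewrite subr_gt0.
set d := dst x y; have d_ge0 : 0 <= d by exact: dst_ge0.
set L2 := 1 + n%:R * rho; have L20 : 0 < L2 by exact: lt_le_trans r01.
have L0 : 0 < L by exact: lt_le_trans L1.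
have dle : d <= n%:R * rho.
  by apply: le_trans (enorm_le_normr _) _; rewrite ler_wpM2l.
set th := d `^ (1 - s); have th0 : 0 <= th by exact: powR_ge0.
have thL2 : th <= L2.
  apply: (@le_trans _ _ (L2 `^ (1 - s))).
    apply: ge0_ler_powR; rewrite ?nnegrE ?(ltW s1) ?(ltW L20)//.
    by apply: le_trans dle _; rewrite lerDr.
  by rewrite -[leRHS]powRr1 ?(ltW L20)// ler_powR// gerBl ltW.
have quot : `|eta x - eta y| / d `^ s <= L * th.
  have [d0|dn0] := eqVneq d 0.
    by rewrite d0 powR0 ?gt_eqF// invr0 mulr0 mulr_ge0// ltW.
  have dp : 0 < d by rewrite lt0r dn0.
  rewrite ler_pdivrMr ?powR_gt0// -mulrA -powRD; last by rewrite dn0 implybT.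
  rewrite subrK powRr1//; apply: le_trans (eta_lip _ _) _.
  by rewrite ler_wpM2l ?(ltW L0)//; exact: normr_le_enorm.
have th1 : 0 <= th / L2 <= 1.
  by rewrite divr_ge0 ?(ltW L20)//= ler_pdivrMr// mul1r.
have LL2 : 1 <= L * L2 by rewrite mulr_ege1.
have main : Phi g (w * ((eta x - eta y) / d `^ s)) <= th * (CL * Phi g w).
  apply: (@le_trans _ _ (Phi g ((th / L2) * (L * L2 * w)))).
    apply: (le_Phi hg); rewrite !normrM normfV (ger0_norm (powR_ge0 _ _)).
    rewrite (ger0_norm th0) (gtr0_norm L0) normfV (gtr0_norm L20).
    rewrite (_ : th / L2 * (L * L2 * `|w|) = `|w| * (L * th)); last first.
      by field; rewrite gt_eqF.
    by rewrite ler_wpM2l.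
  apply: le_trans (Phi_contract hg _ th1) _.
  apply: ler_pM => //; first by case/andP: th1.
    by rewrite ler_pdivrMr// ler_peMr.
  exact: (Phi_scale hg w LL2).
rewrite /kaprho xyr mulr1 /kap -/d -/th.
rewrite (_ : CL * _ = th * (CL * Phi g w) / d ^+ n); last by ring.
by rewrite ler_wpM2r// invr_ge0 exprn_ge0.
Qed.

Variables (b : T -> R) (M : R).
Hypothesis M_ge0 : 0 <= M.
Hypothesis mb : measurable_fun setT b.
Hypothesis b_ge0 : forall x, 0 <= b x.
Hypothesis g1 : 0 < g 1.
Hypothesis ID : mu.-integrable setT (EFin \o (\1_D : T -> R)).
Hypothesis IPb : mu.-integrable setT (EFin \o (fun x => \1_D x * Phi g (b x))).

(** A majorant of M - u on [D] in which [u] is replaced by the envelope [b], to be common to the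
    whole sequence. *)
Definition om (x : T) : R := \1_D x * (M + b x).

Lemma om_ge0 x : 0 <= om x.
Proof. by apply: mulr_ge0; [rewrite indicE|exact: addr_ge0]. Qed.

Let mom : measurable_fun setT om.
Proof.
by apply: measurable_funM; [exact: measurable_indic|exact: measurable_funD].
Qed.

Lemma integrable_Phi_om : mu.-integrable setT (EFin \o (Phi g \o om)).
Proof.
apply: (le_integrableT (g := fun x => 2 ^+ m.+1 * (Phi g M * \1_D x + \1_D x * Phi g (b x)))).
- exact: Pm.
- move=> x; rewrite /= ger0_norm// /om indicE; case: (_ \in _).
    by rewrite !mul1r mulr1; exact: Phi_add_le.
  by rewrite !mul0r mulr0 addr0 mulr0 Phi0.
- by apply: integrableZT; apply: integrableDT => //; exact: integrableZT.
Qed.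

(** Where [om] is at most 1 the indicator of [D] dominates it; beyond 1, monotonicity of [g] gives
    om <= Phi(om) / g(1). *)
Lemma integrable_om : mu.-integrable setT (EFin \o om).
Proof.
apply: (le_integrableT (g := fun x => \1_D x + (g 1)^-1 * Phi g (om x))) => //.
  move=> x; rewrite ger0_norm ?om_ge0//; have [omx|/ltW omx] := leP (om x) 1.
    apply: ler_wpDr; first by rewrite mulr_ge0// invr_ge0 ltW.
    rewrite indicE; case: (boolP (x \in D)) => // xD.
    by rewrite /om indicE (negbTE xD) mul0r.
  apply: ler_wpDl; first by rewrite indicE.
  rewrite (PhiE _ (om_ge0 x)) ler_pdivlMl// mulrC ler_wpM2l ?om_ge0//.
  by have [_ _ gm _] := hg; exact: gm.
by apply: integrableDT => //; apply: integrableZT; exact: integrable_Phi_om.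
Qed.

Let gb x : R := g `|b x|.

Let mgb : measurable_fun setT gb.
Proof.
have mgn : measurable_fun setT (fun t : R => g `|t|) by apply: continuous_measurable_fun.
exact: (measurableT_comp mgn mb).
Qed.

Let gb_ge0 x : 0 <= gb x. Proof. by have [_ gge0 _ _] := hg; exact: gge0. Qed.

Lemma integrable_om_gb : mu.-integrable setT (EFin \o (fun x => om x * gb x)).
Proof.
apply: (le_integrableT (g := fun x => \1_D x * Phi g (b x) + Phi g (om x))).
- exact: measurable_funM.
- move=> x; rewrite ger0_norm; last by rewrite mulr_ge0 ?om_ge0.
  rewrite {1}/om; have := young_one hg (normr_ge0 (b x)) (om_ge0 x).
  rewrite Phi_norm /om indicE; case: (_ \in _).
    by rewrite !mul1r mulrC.
  by rewrite !mul0r Phi0 addr0.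
- by apply: integrableDT => //; exact: integrable_Phi_om.
Qed.

Definition far_bound : T * T -> R :=
  fun z => tens (fun x => om x * gb x) W z + tens om J z.

(** Contains [M], the envelopes [b] and [H] and constants, but not [u]: this makes the resulting
    energy bound uniform along the sequence. *)
Definition cacc_bound (z : T * T) : R :=
  Lam * Ccac R m * CL * (Phi g (om z.1) * kaprho z + Phi g (om z.2) * kaprho (z.2, z.1))
  + Lam * Ctail n m C0 * (far_bound z + far_bound (z.2, z.1)).

Let I1 : (mu \x mu)%E.-integrable setT (EFin \o (fun z => Phi g (om z.1) * kaprho z)).
Proof. by apply: (@integrable_kaprho (Phi g \o om)) => [x|]; [exact: P0|exact: integrable_Phi_om]. Qed.

Let I1' : (mu \x mu)%E.-integrable setT
  (EFin \o (fun z => Phi g (om z.2) * kaprho (z.2, z.1))).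
Proof.
by apply: (integrable_swap _ I1) => z; apply: mulr_ge0; [exact: P0|exact: kaprho_ge0].
Qed.

Lemma far_bound_ge0 z : 0 <= far_bound z.
Proof.
by apply: addr_ge0; apply: mulr_ge0 => //; rewrite ?om_ge0// mulr_ge0// om_ge0.
Qed.

Let Ifb : (mu \x mu)%E.-integrable setT (EFin \o far_bound).
Proof.
have o0 x : 0 <= om x * gb x by rewrite mulr_ge0// om_ge0.
exact: (integrableDT (integrable_tens o0 W0 integrable_om_gb IW)
  (integrable_tens om_ge0 J0 integrable_om IJ)).
Qed.

Lemma integrable_cacc_bound : (mu \x mu)%E.-integrable setT (EFin \o cacc_bound).
Proof.
have Ifb' := integrable_swap far_bound_ge0 Ifb.
exact: (integrableDT (integrableZT _ (integrableDT I1 I1'))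
  (integrableZT _ (integrableDT Ifb Ifb'))).
Qed.

Variable u : T -> R.
Hypothesis mu' : measurable_fun setT u.
Hypothesis uH : forall y, `|u y| <= `|H y|.
Hypothesis uM : forall x, D x -> u x <= M.
Hypothesis ub : forall x, D x -> `|u x| <= b x.
Hypothesis Ien : (mu \x mu)%E.-integrable setT
  (EFin \o (fun z => \1_(D `*` D) z * en s g u z)).

Definition cutphi (x : T) : R := (M - u x) * eta x ^+ m.+1.

Lemma cutphi_S0 x : ~ S0 x -> cutphi x = 0.
Proof. by move=> /eta0; rewrite /cutphi => ->; rewrite expr0n mulr0. Qed.

Lemma wom x : D x -> 0 <= M - u x <= om x.
Proof.
move=> Dx; rewrite subr_ge0 uM//= /om indicE mem_set// mul1r lerD2l.
by apply: le_trans (ub Dx); rewrite -normrN ler_norm.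
Qed.

Lemma eta_exp_le1 x : 0 <= eta x ^+ m.+1 <= 1.
Proof. by have /andP[e0 e1] := eta01 x; rewrite exprn_ge0//= exprn_ile1. Qed.

Lemma cutphi_ge0 x : 0 <= cutphi x.
Proof.
have [/S0S1/S1D/wom/andP[w0 _]|/cutphi_S0 -> //] := pselect (S0 x).
by rewrite mulr_ge0//; have /andP[] := eta_exp_le1 x.
Qed.

Lemma cutphi_le x : `|cutphi x| <= om x.
Proof.
rewrite ger0_norm ?cutphi_ge0//.
have [/S0S1/S1D/wom/andP[w0 w1]|/cutphi_S0 -> //] := pselect (S0 x); last exact: om_ge0.
by apply: le_trans w1; rewrite ler_piMr//; have /andP[] := eta_exp_le1 x.
Qed.

Lemma measurable_cutphi : measurable_fun setT cutphi.
Proof.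
apply: measurable_funM; first exact: measurable_funB.
exact: measurable_funX.
Qed.

Lemma eta_expB_le x y : `|eta x ^+ m.+1 - eta y ^+ m.+1| <= m.+1%:R * `|eta x - eta y|.
Proof.
wlog xy : x y / eta x <= eta y.
  by move=> h; have [/h//|/ltW/h] := leP (eta x) (eta y); rewrite distrC (distrC (eta y)).
have /andP[x0 _] := eta01 x; have /andP[y0 y1] := eta01 y.
have xyX : eta x ^+ m.+1 <= eta y ^+ m.+1 by rewrite lerXn2r ?nnegrE.
rewrite distrC (distrC (eta x)) !ger0_norm ?subr_ge0//.
apply: le_trans (exprB_le m x0 xy y1) _.
by rewrite ler_wpM2r ?subr_ge0// ler_piMr// exprn_ile1.
Qed.

Lemma kaprho_swap x y : kaprho (y, x) = kaprho (x, y).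
Proof. by rewrite /kaprho /kap /= dstC distrC. Qed.

(** Discrete product rule: the difference of [cutphi] is minus the difference of [u] times
    eta(x)^(m+1), plus M - u(y) times a Lipschitz difference. *)
Lemma en_cutphi_near x y : D x -> D y -> en s g cutphi (x, y) <=
  2 ^+ m.+1 * (en s g u (x, y) + m.+1%:R ^+ m.+1 * CL * (Phi g (om y) * kaprho (y, x))).
Proof.
move=> Dx Dy; have /andP[wx0 wx1] := wom Dx; have /andP[wy0 wy1] := wom Dy.
have d0 : 0 <= (dst x y ^+ n)^-1 by rewrite invr_ge0 exprn_ge0// dst_ge0.
have r0 : 0 <= (dst x y `^ s)^-1 by rewrite invr_ge0 powR_ge0.
set r := (dst x y `^ s)^-1 in r0 *.
set wy := M - u y in wy0 wy1 *.
have h1 : `|DT s cutphi (x, y)| <= `|DT s u (x, y)| + `|m.+1%:R * wy * ((eta x - eta y) * r)|.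
  rewrite /DT /= -/r.
  have -> : (cutphi x - cutphi y) * r = - ((u x - u y) * r) * eta x ^+ m.+1
      + wy * (eta x ^+ m.+1 - eta y ^+ m.+1) * r.
    by rewrite /cutphi /wy; move: (eta x ^+ m.+1) (eta y ^+ m.+1) => A B; ring.
  apply: le_trans (ler_normD _ _) _; apply: lerD.
    rewrite normrM normrN ler_piMr//.
    by rewrite ger0_norm; have /andP[] := eta_exp_le1 x.
  rewrite !normrM (ger0_norm r0) mulrA ler_wpM2r// [`|m.+1%:R|]ger0_norm//.
  by rewrite [_ * `|wy|]mulrC -mulrA ler_wpM2l// eta_expB_le.
have h2 : Phi g (DT s cutphi (x, y)) <= 2 ^+ m.+1 *
    (Phi g (DT s u (x, y)) + Phi g (m.+1%:R * wy * ((eta x - eta y) * r))).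
  apply: (@le_trans _ _ (Phi g (`|DT s u (x, y)| + `|m.+1%:R * wy * ((eta x - eta y) * r)|))).
    by apply: (le_Phi hg); apply: le_trans h1 (ler_norm _).
  by apply: le_trans (Phi_add_le hg _ _) _; rewrite !Phi_norm.
rewrite /en; apply: (@le_trans _ _ (2 ^+ m.+1 * (Phi g (DT s u (x, y)) / dst x y ^+ n +
   Phi g (m.+1%:R * wy * ((eta x - eta y) * r)) / dst x y ^+ n))).
  by rewrite -mulrDl mulrA ler_wpM2r.
rewrite ler_wpM2l ?exprn_ge0// lerD2l.
apply: le_trans (Phi_cutoff_le _ Dx Dy) _.
rewrite (kaprho_swap x y).
apply: (@le_trans _ _ (CL * ((m.+1%:R ^+ m.+1 * Phi g (om y)) * kaprho (x, y)))); last first.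
  move: CL (m.+1%:R ^+ m.+1) (Phi g (om y)) (kaprho (x, y)) => A B C E.
  by rewrite (_ : A * (B * C * E) = B * A * (C * E)) //; ring.
apply: ler_wpM2l; first exact: CL_ge0.
apply: ler_wpM2r; first exact: kaprho_ge0.
apply: le_trans (Phi_scale hg _ _) _; first by rewrite ler1n.
apply: ler_wpM2l; first by rewrite exprn_ge0.
by apply: (le_Phi hg); rewrite !ger0_norm// ?om_ge0.
Qed.

Lemma en_cutphi_far x y : S1 x -> ~ D y ->
  en s g cutphi (x, y) <= Ctail n m C0 * (Phi g (om x) * W y).
Proof.
move=> Sx Dy; have py : cutphi y = 0 by apply: cutphi_S0 => /S0S1/S1D.
have d0 : 0 <= dst x y `^ s by exact: powR_ge0.
have C00 : 0 <= Ctail n m C0.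
  by have := le_trans ler01 C1 => ?; rewrite /Ctail !mulr_ge0// exprn_ge0.
rewrite /en /DT/= /Phi py subr0 normrM normfV (ger0_norm d0).
rewrite (_ : _ * _ * _ * _ = `|cutphi x| *
   (g (`|cutphi x| / dst x y `^ s) / dst x y `^ s / dst x y ^+ n)); last by ring.
have := tail_pointwise s01 hg (cutphi x) 0 C1 (sep Sx Dy); rewrite subr0 => tp.
have tw0 : tailw s g 0 y = 0.
  by rewrite /tailw normr0 mul0r; have [-> _ _ _] := hg; rewrite mul0r.
rewrite tw0 addr0 in tp.
apply: le_trans (ler_wpM2l (normr_ge0 _) tp) _.
rewrite (_ : _ * (_ * (_ * _)) = Ctail n m C0 * (Phi g (cutphi x) * W y)); last first.
  by rewrite /Phi /W; move: (wgt s y) (Ctail n m C0) => A B; ring.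
apply: ler_wpM2l => //; apply: ler_wpM2r => //.
by apply: (le_Phi hg); apply: le_trans (cutphi_le x) (ler_norm _).
Qed.

(** Serves only to show that [cutphi] has finite energy and is admissible. It involves the energy of
    [u], which is finite for each single supersolution but not yet controlled uniformly. *)
Definition en_bound (z : T * T) : R :=
  2 ^+ m.+1 * (\1_(D `*` D) z * en s g u z
     + m.+1%:R ^+ m.+1 * CL * (Phi g (om z.2) * kaprho (z.2, z.1)))
  + Ctail n m C0 * (tens (Phi g \o om) W z + tens (Phi g \o om) W (z.2, z.1)).

Lemma en_cutphi_le z : en s g cutphi z <= en_bound z.
Proof.
have C00 : 0 <= Ctail n m C0.
  by have := le_trans ler01 C1 => ?; rewrite /Ctail !mulr_ge0// exprn_ge0.
case: z => x y; rewrite /en_bound /tens /=.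
have t1 : 0 <= Phi g (om x) * W y by rewrite mulr_ge0.
have t2 : 0 <= Phi g (om y) * W x by rewrite mulr_ge0.
have t3 : 0 <= m.+1%:R ^+ m.+1 * CL * (Phi g (om y) * kaprho (y, x)).
  apply: mulr_ge0; first by apply: mulr_ge0; rewrite ?CL_ge0// exprn_ge0.
  by apply: mulr_ge0 => //; exact: kaprho_ge0.
have t4 : 0 <= \1_(D `*` D) (x, y) * en s g u (x, y).
  by apply: mulr_ge0; [rewrite indicE|exact: en_ge0 hg _ _].
have h2 : 0 <= (2 : R) ^+ m.+1 by rewrite exprn_ge0.
have [[Dx Dy]|nD] := pselect ((D `*` D) (x, y)).
  apply: le_trans (en_cutphi_near Dx Dy) _.
  rewrite indicE mem_set ?mul1r ?lerDl; last by split.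
  exact: mulr_ge0 C00 (addr_ge0 t1 t2).
apply: ler_wpDl; first exact: mulr_ge0 h2 (addr_ge0 t4 t3).
have [Sx|Sx] := pselect (S1 x).
  have Dy : ~ D y by move=> Dy; apply: nD; split => //; exact: S1D.
  by apply: le_trans (en_cutphi_far Sx Dy) _; apply: (ler_wpM2l C00); rewrite lerDl; exact: t2.
have [Sy|Sy] := pselect (S1 y).
  have Dx : ~ D x by move=> Dx; apply: nD; split => //; exact: S1D.
  rewrite -en_swap; apply: le_trans (en_cutphi_far Sy Dx) _.
  by apply: (ler_wpM2l C00); rewrite lerDr; exact: t1.
have px : cutphi x = 0 by apply: cutphi_S0 => /S0S1.
have py : cutphi y = 0 by apply: cutphi_S0 => /S0S1.
rewrite /en /DT /= px py subrr mul0r Phi0 mul0r.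
exact: mulr_ge0 C00 (addr_ge0 t1 t2).
Qed.

Lemma integrable_en_cutphi : (mu \x mu)%E.-integrable setT (EFin \o en s g cutphi).
Proof.
apply: (le_integrableT (g := en_bound)).
- by apply: measurable_en => //; exact: measurable_cutphi.
- by move=> z; rewrite ger0_norm ?en_cutphi_le//; exact: en_ge0 hg _ _.
have IPW : (mu \x mu)%E.-integrable setT (EFin \o tens (Phi g \o om) W).
  by apply: integrable_tens => // [x|]; [exact: P0|exact: integrable_Phi_om].
have IPW' := integrable_swap (fun z => mulr_ge0 (P0 (om z.1)) (W0 z.2)) IPW.
exact: (integrableDT (integrableZT _ (integrableDT Ien (integrableZT _ I1')))
  (integrableZT _ (integrableDT IPW IPW'))).
Qed.

Lemma integrable_Bpart_cutphi : (mu \x mu)%E.-integrable setT (EFin \o Bpart s g H cutphi).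
Proof.
have mc := measurable_cutphi.
have IPc : mu.-integrable setT (EFin \o (Phi g \o cutphi)).
  apply: le_integrableT integrable_Phi_om; first exact: Pm.
  move=> x; rewrite /= ger0_norm//; apply: (le_Phi hg).
  exact: le_trans (cutphi_le x) (ler_norm _).
have Ic : mu.-integrable setT (EFin \o (fun x => `|cutphi x|)).
  apply: le_integrableT integrable_om; first exact: measurableT_comp.
  by move=> x; rewrite normr_id cutphi_le.
have IPW : (mu \x mu)%E.-integrable setT (EFin \o tens (Phi g \o cutphi) W).
  by apply: integrable_tens => // x; exact: P0.
have IcJ : (mu \x mu)%E.-integrable setT (EFin \o tens (fun x => `|cutphi x|) J).
  exact: integrable_tens (fun x => normr_ge0 (cutphi x)) J0 Ic IJ.
have IPW' := integrable_swap (fun z => mulr_ge0 (P0 (cutphi z.1)) (W0 z.2)) IPW.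
have IcJ' := integrable_swap (fun z => mulr_ge0 (normr_ge0 (cutphi z.1)) (J0 z.2)) IcJ.
exact: (integrableDT (integrableDT integrable_en_cutphi (integrableDT IPW IPW'))
  (integrableDT IcJ IcJ')).
Qed.

Lemma integrable_Apart : (mu \x mu)%E.-integrable setT (EFin \o Apart s g S1 D u).
Proof.
have IS : mu.-integrable setT (EFin \o (fun x => \1_S1 x * Phi g (u x))).
  apply: le_integrableT IPb; first by apply: measurable_funM; [exact: measurable_indic|exact: Pm].
  move=> x; rewrite normrM !indicE; have [/set_mem Sx|_] := boolP (x \in S1).
    rewrite normr1 mul1r mem_set ?mul1r; last exact: S1D.
    rewrite ger0_norm//; apply: (le_Phi hg).
    exact: le_trans (ub (S1D Sx)) (ler_norm _).
  by rewrite normr0 mul0r mulr_ge0.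
have S0' x : 0 <= \1_S1 x * Phi g (u x) by apply: mulr_ge0; [rewrite indicE|exact: P0].
have It := integrable_tens S0' W0 IS IW.
have It' := integrable_swap (fun z => mulr_ge0 (S0' z.1) (W0 z.2)) It.
exact: (integrableDT Ien (integrableDT It It')).
Qed.

Variables (lam : R) (D2 : set T).
Hypothesis lam0 : 0 < lam.
Hypothesis k_ge : forall z, lam <= k z.
Hypothesis mD2 : measurable D2.
Hypothesis D2D : D2 `<=` D.
Hypothesis eta1 : forall x, D2 x -> eta x = 1.

(** The test function contains -u, so the energy appears with a negative sign. The lower bound of
    [k] is used for the energy, the upper one for the error; on D2 x D2 the cutoffs equal 1. *)
Lemma integrand_cutphi_near x y : D x -> D y ->
  integrand s g k u cutphi (x, y) <=
  - (lam / 2 * (\1_(D2 `*` D2) (x, y) * en s g u (x, y)))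
  + Lam * Ccac R m * CL * (Phi g (om x) * kaprho (x, y) + Phi g (om y) * kaprho (y, x)).
Proof.
move=> Dx Dy; have /andP[wx0 wx1] := wom Dx; have /andP[wy0 wy1] := wom Dy.
have d0 : 0 <= (dst x y ^+ n)^-1 by rewrite invr_ge0 exprn_ge0// dst_ge0.
have r0 : 0 <= (dst x y `^ s)^-1 by rewrite invr_ge0 powR_ge0.
set r := (dst x y `^ s)^-1 in r0 *; set d := (dst x y ^+ n)^-1 in d0 *.
set wx := M - u x in wx0 wx1 *; set wy := M - u y in wy0 wy1 *.
have := caccioppoli_pointwise hg wx0 wy0 (eta01 x) (eta01 y) r0.
set a := (wx - wy) * r; set p1 := Phi g (wx * _); set p2 := Phi g (wy * _).
set X := gsign g a * _ => cp.
have aE : DT s u (x, y) = - a by rewrite /DT /= -/r /a /wx /wy; ring.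
have XE : integrand s g k u cutphi (x, y) = - (X * (k (x, y) * d)).
  rewrite /integrand aE (gsignN) /X /DT /= -/r -/d /cutphi -/wx -/wy.
  by move: (eta x ^+ m.+1) (eta y ^+ m.+1) => A B; ring.
have enE : en s g u (x, y) = Phi g a * d by rewrite /en aE PhiN.
have kd0 : 0 <= k (x, y) * d by rewrite mulr_ge0.
have C_ge0 := Ccac_ge0 R m; have CL0 := CL_ge0.
have q1 : p1 * d <= CL * (Phi g (om x) * kaprho (x, y)).
  apply: le_trans (Phi_cutoff_le _ Dx Dy) _; rewrite ler_wpM2l// ler_wpM2r ?kaprho_ge0//.
  by apply: (le_Phi hg); rewrite !ger0_norm// om_ge0.
have q2 : p2 * d <= CL * (Phi g (om y) * kaprho (y, x)).
  rewrite kaprho_swap.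
  apply: le_trans (Phi_cutoff_le _ Dx Dy) _; rewrite ler_wpM2l// ler_wpM2r ?kaprho_ge0//.
  by apply: (le_Phi hg); rewrite !ger0_norm// om_ge0.
set i := \1_(D2 `*` D2) (x, y) : R.
have ie : i <= (eta x * eta y) ^+ m.+1.
  rewrite /i indicE; have [/set_mem[/= D2x D2y]|_] := boolP (_ \in _).
    by rewrite !eta1// mulr1 expr1n.
  have /andP[ex _] := eta01 x; have /andP[ey _] := eta01 y.
  by rewrite exprn_ge0// mulr_ge0.
have i0 : 0 <= i by rewrite /i indicE.
have Pa := P0 a.
have s1 : lam / 2 * (i * (Phi g a * d)) <=
    2^-1 * (Phi g a * (eta x * eta y) ^+ m.+1) * (k (x, y) * d).
  rewrite (_ : lam / 2 * _ = 2^-1 * (Phi g a * i) * (lam * d)); last by ring.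
  have h0 : (0 : R) <= 2^-1 by rewrite invr_ge0.
  apply: ler_pM.
  - by apply: mulr_ge0 => //; exact: mulr_ge0.
  - by apply: mulr_ge0 => //; exact: ltW.
  - by apply: ler_wpM2l => //; exact: ler_wpM2l.
  - exact: ler_wpM2r.
have s2 : Ccac R m * (p1 + p2) * (k (x, y) * d) <=
    Lam * Ccac R m * CL * (Phi g (om x) * kaprho (x, y) + Phi g (om y) * kaprho (y, x)).
  rewrite (_ : _ * _ * (_ * _) = k (x, y) * (Ccac R m * (p1 * d + p2 * d))); last by ring.
  have -> : Lam * Ccac R m * CL * (Phi g (om x) * kaprho (x, y) + Phi g (om y) * kaprho (y, x))
      = Lam * (Ccac R m * (CL * (Phi g (om x) * kaprho (x, y)) + CL * (Phi g (om y) * kaprho (y, x)))).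
    by move: (Ccac R m) CL => A B; ring.
  apply: ler_pM => //; last by apply: ler_wpM2l => //; exact: lerD.
  apply: mulr_ge0 => //; apply: addr_ge0; apply: mulr_ge0 => //; exact: P0.
rewrite XE enE; have := ler_wpM2r kd0 cp; rewrite mulrBl; lra.
Qed.

(** Off D x D the sign plays no part: the absolute value is bounded by the far terms, in which [u]
    is replaced by [b] and [H]. *)
Lemma integrand_cutphi_le z : integrand s g k u cutphi z <=
  - (lam / 2 * (\1_(D2 `*` D2) z * en s g u z)) + cacc_bound z.
Proof.
have Lam0 : 0 <= Lam by exact: le_trans (k_ge0 (point, point)) (k_le _).
have C00 : 0 <= Ctail n m C0.
  by have := le_trans ler01 C1 => ?; rewrite /Ctail !mulr_ge0// exprn_ge0.
case: z => x y; rewrite /cacc_bound /=.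
have f1 := far_bound_ge0 (x, y); have f2 := far_bound_ge0 (y, x).
have p1 := mulr_ge0 (P0 (om x)) (kaprho_ge0 (x, y)).
have p2 := mulr_ge0 (P0 (om y)) (kaprho_ge0 (y, x)).
have [[Dx Dy]|nD] := pselect ((D `*` D) (x, y)).
  apply: le_trans (integrand_cutphi_near Dx Dy) _; rewrite lerD2l lerDl.
  exact: mulr_ge0 (mulr_ge0 Lam0 C00) (addr_ge0 f1 f2).
have nD2 : ~ (D2 `*` D2) (x, y) by move=> [/= D2x D2y]; apply: nD; split; exact: D2D.
rewrite [\1_(D2 `*` D2) _]indicE (memNset nD2) mul0r mulr0 oppr0 add0r.
apply: le_trans (ler_norm _) _.
apply: le_trans (integrand_bound s01 hg k_ge0 k_le S1D C1 sep (x, y) uH _) _.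
  by move=> z Sz; apply: cutphi_S0 => /S0S1.
rewrite /near_part [\1_(D `*` D) _]indicE (memNset nD) mul0r add0r.
apply: ler_wpDl.
  apply: mulr_ge0; last exact: addr_ge0 p1 p2.
  by apply: mulr_ge0; [apply: mulr_ge0 => //; exact: Ccac_ge0|exact: CL_ge0].
rewrite -mulrA; apply: ler_wpM2l => //; apply: ler_wpM2l => //=.
have fl v w : far_part s g H u cutphi v w <= far_bound (v, w).
  rewrite /far_part /far_bound /tens /=.
  have [Sv|Sv] := pselect (S0 v); last first.
    by rewrite (cutphi_S0 Sv) normr0 mul0r; exact: far_bound_ge0 (v, w).
  have Dv := S1D (S0S1 Sv).
  rewrite mulrDr mulrA; apply: lerD; last by apply: ler_wpM2r; [exact: J0|exact: cutphi_le].
  apply: ler_wpM2r; first exact: W0.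
  have [_ gge0 gm _] := hg.
  by apply: ler_pM; rewrite ?cutphi_le ?gge0// gm// (le_trans (ub Dv)) ?ler_norm.
exact: lerD (fl x y) (fl y x).
Qed.

(** The integral against [cutphi] is nonnegative and carries the energy with a minus sign; the
    energy is finite by [Ien], so it can be moved to the other side. *)
Lemma caccioppoli_integral (Om K : set 'rV[R]_n) (e0 : R) : 0 < e0 ->
  (forall x h, S0 (tadd x h) -> `|rv h| < e0 -> S1 x) -> compact K -> K `<=` Om ->
  (forall x, S1 x -> K (rv x)) ->
  (forall f : 'rV[R]_n -> R, testfun Om f -> (forall x, 0 <= f x) ->
    (0 <= \int[mu \x mu]_z (integrand s g k u (f \o @rv R n) z)%:E)%E) ->
  ((lam / 2)%:E * \int[mu \x mu]_z (\1_(D2 `*` D2) z * en s g u z)%:E <=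
   \int[mu \x mu]_z (cacc_bound z)%:E)%E.
Proof.
move=> e00 S01 cK KOm S1K u_super.
have Ic : mu.-integrable setT (EFin \o cutphi).
  by apply: le_integrableT cutphi_le integrable_om; exact: measurable_cutphi.
have [II pos] := supersol_test mu_leb s01 hg gcont mk k_ge0 k_le S1D C1 sep mH mu' uH
  integrable_Apart e00 cutphi_ge0 Ic cutphi_S0 S01 cK KOm S1K integrable_Bpart_cutphi u_super.
have ID2 : (mu \x mu)%E.-integrable setT
    (EFin \o (fun z => \1_(D2 `*` D2) z * en s g u z)).
  apply: le_integrableT Ien.
    apply: measurable_funM; last exact: measurable_en.
    by apply: measurable_indic; exact: measurableX.
  move=> z; have e_ge0 : 0 <= en s g u z by exact: en_ge0 hg _ _.
  rewrite normrM (ger0_norm e_ge0) ler_wpM2r// ger0_norm; last by rewrite indicE.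
  rewrite !indicE; have [/set_mem[D2x D2y]|_] := boolP (z \in D2 `*` D2).
    by rewrite mem_set//; split; exact: D2D.
  by case: (_ \in _).
have IZ := integrableZT (lam / 2) ID2; have IC := integrable_cacc_bound.
have le : (\int[mu \x mu]_z (integrand s g k u cutphi z)%:E <=
    \int[mu \x mu]_z (cacc_bound z - lam / 2 * (\1_(D2 `*` D2) z * en s g u z))%:E)%E.
  apply: le_integral => //.
    by apply: eq_integrable (integrableB measurableT IC IZ).
  by move=> z _; rewrite lee_fin addrC integrand_cutphi_le.
have := le_trans pos le; under eq_integral do rewrite EFinB.
rewrite integralB// sube_ge0; last by rewrite integrable_fin_num.
by under eq_integral do rewrite EFinM; rewrite integralZl.
Qed.

End caccioppoli.

(** * Passage to the limit *)

Section limit.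
Context (R : realType) (n : nat).
Local Notation T := (n.-tuple R).
Variable mu : {sigma_finite_measure set T -> \bar R}.
Hypothesis mu_leb : is_lebesgue mu.
Variables (s : R) (s01 : 0 < s < 1) (g : R -> R) (m : nat).
Hypothesis hg : doubling g m.
Hypothesis gcont : continuous (fun t : R => g `|t|).
Variables (k : T * T -> R) (Lam : R).
Hypothesis mk : measurable_fun setT k.
Hypothesis k_ge0 : forall z, 0 <= k z.
Hypothesis k_le : forall z, k z <= Lam.
Variables (S1 D : set T) (C0 : R).
Hypothesis mS1 : measurable S1.
Hypothesis mD : measurable D.
Hypothesis S1D : S1 `<=` D.
Hypothesis C1 : 1 <= C0.
Hypothesis sep : forall x y, S1 x -> ~ D y -> 1 + nrm y <= C0 * dst x y.
Variable H : T -> R.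
Hypothesis mH : measurable_fun setT H.

Let J y := tailw s g (H y) y.
Let W := wgt s : T -> R.
Hypothesis IJ : mu.-integrable setT (EFin \o J).

Let J0 y : 0 <= J y. Proof. exact: tailw_ge0 hg _ _. Qed.
Let W0 y : 0 <= W y. Proof. exact: wgt_ge0. Qed.
Let P0 t : 0 <= Phi g t. Proof. exact: Phi_ge0 hg _. Qed.
Let g0 (t : R) : 0 <= g `|t|. Proof. by have [_ h _ _] := hg; exact: h. Qed.

Variable rho : R.
Hypothesis rho0 : 0 < rho.
Hypothesis Drho : forall x y, D x -> D y -> `|rv x - rv y| <= rho.

Variable b : T -> R.
Hypothesis mb : measurable_fun setT b.
Hypothesis b_ge0 : forall x, 0 <= b x.
Hypothesis ID : mu.-integrable setT (EFin \o (\1_D : T -> R)).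
Hypothesis IPb : mu.-integrable setT (EFin \o (fun x => \1_D x * Phi g (b x))).

Variables (u_ : nat -> T -> R) (u : T -> R) (E : R).
Hypothesis mu_ : forall j, measurable_fun setT (u_ j).
Hypothesis mu' : measurable_fun setT u.
Hypothesis uH : forall j y, `|u_ j y| <= `|H y|.
Hypothesis ub : forall j x, D x -> `|u_ j x| <= b x.
Hypothesis cvu : forall x, (fun j => u_ j x) @ \oo --> u x.
Hypothesis uE : forall j,
  (\int[mu \x mu]_z (\1_(D `*` D) z * en s g (u_ j) z)%:E <= E%:E)%E.

Let mDD : measurable (D `*` D). Proof. exact: measurableX. Qed.

Let en_cut v z : 0 <= \1_(D `*` D) z * en s g v z.
Proof. by apply: mulr_ge0; [rewrite indicE|exact: en_ge0 hg _ _]. Qed.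

Let men v : measurable_fun setT v ->
  measurable_fun setT (fun z => \1_(D `*` D) z * en s g v z).
Proof.
by move=> mv; apply: measurable_funM; [exact: measurable_indic|exact: measurable_en].
Qed.

Lemma cvg_DT z : (fun j => DT s (u_ j) z) @ \oo --> DT s u z.
Proof. by apply: cvgMl; apply: cvgB; exact: cvu. Qed.

Lemma cvg_en z : (fun j => en s g (u_ j) z) @ \oo --> en s g u z.
Proof.
have c : Phi g (DT s (u_ j) z) @[j --> \oo] --> Phi g (DT s u z).
  have h := continuous_cvg _ (@continuous_Phi _ _ gcont _) (@cvg_DT z).
  exact: h.
by apply: cvgMl; exact: c.
Qed.

Lemma cvg_integrand phi z :
  (fun j => integrand s g k (u_ j) phi z) @ \oo --> integrand s g k u phi z.
Proof.
have c : gsign g (DT s (u_ j) z) @[j --> \oo] --> gsign g (DT s u z).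
  have h := continuous_cvg _ (@continuous_gsign _ _ _ hg gcont _) (@cvg_DT z).
  exact: h.
by do 3 apply: cvgMl; exact: c.
Qed.

Lemma energy_limit : (\int[mu \x mu]_z (\1_(D `*` D) z * en s g u z)%:E <= E%:E)%E.
Proof.
have mf j : measurable_fun setT (fun z => (\1_(D `*` D) z * en s g (u_ j) z)%:E).
  by apply/measurable_EFinP; exact: men.
have f0 j z : setT z -> (0 <= (\1_(D `*` D) z * en s g (u_ j) z)%:E)%E.
  by rewrite lee_fin.
have := fatou (mu \x mu)%E measurableT mf f0.
rewrite (_ : (fun x => limn_einf _) = fun z => (\1_(D `*` D) z * en s g u z)%:E); last first.
  apply/funext => z; have c : (fun j => (\1_(D `*` D) z * en s g (u_ j) z)%:E) @ \oo -->
      (\1_(D `*` D) z * en s g u z)%:E.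
    by apply: cvg_EFin; [exact: nearW|apply: cvgMr; exact: cvg_en].
  have [-> _] := cvg_limn_einf_sup c; by [].
move=> h; apply: le_trans h _; exact: limn_einf_ub.
Qed.

Variables (phi : T -> R) (Cp L : R).
Hypothesis mphi : measurable_fun setT phi.
Hypothesis phiC : forall x, `|phi x| <= Cp.
Hypothesis phi0 : forall x, ~ S1 x -> phi x = 0.
Hypothesis L1 : 1 <= L.
Hypothesis phi_lip : forall x y, `|phi x - phi y| <= L * `|rv x - rv y|.

Lemma integrable_en_lipschitz : (mu \x mu)%E.-integrable setT
  (EFin \o (fun z => \1_(D `*` D) z * en s g phi z)).
Proof.
have I1 : (mu \x mu)%E.-integrable setT (EFin \o (fun z => \1_D z.1 * kaprho s rho z)).
  by apply: (@integrable_kaprho _ _ mu mu_leb s s01 rho rho0 \1_D) => // x; rewrite indicE.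
apply: le_integrableT (integrableZT (CL n m rho L * Phi g 1) I1); first exact: men.
case=> x y; rewrite ger0_norm// indicE; have [/set_mem[Dx Dy]|_] := boolP (_ \in _); last first.
  rewrite mul0r; apply: mulr_ge0; first by apply: mulr_ge0 => //; exact: CL_ge0.
  by apply: mulr_ge0; [rewrite indicE|exact: kaprho_ge0].
rewrite mul1r /= indicE mem_set// mul1r /en /DT /=.
have := Phi_cutoff_le s01 hg rho0 Drho L1 phi_lip 1 Dx Dy.
by rewrite mul1r => /le_trans; apply; rewrite mulrA.
Qed.

(** A far bound common to all members of the sequence: [b] controls them on [S1], and [H] inside [J]
    elsewhere. *)
Let qfar (z : T * T) : R := tens (fun x => `|phi x| * g `|b x|) W z + tens (fun x => `|phi x|) J z.

Let mb' : measurable_fun setT (fun x => g `|b x|).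
Proof. exact: (measurableT_comp (continuous_measurable_fun gcont) mb). Qed.

Let Ifar : (mu \x mu)%E.-integrable setT (EFin \o qfar).
Proof.
have Cp0 : 0 <= Cp by exact: le_trans (phiC point).
have phiD x : `|phi x| <= Cp * \1_D x.
  have [/S1D Dx|nS] := pselect (S1 x); first by rewrite indicE mem_set// mulr1.
  by rewrite phi0// normr0 mulr_ge0// indicE.
have mnphi : measurable_fun setT (fun x => `|phi x|) by exact: measurableT_comp.
have Iphi : mu.-integrable setT (EFin \o (fun x => `|phi x|)).
  apply: le_integrableT (integrableZT Cp ID) => // x.
  by rewrite normr_id.
have Iphib : mu.-integrable setT (EFin \o (fun x => `|phi x| * g `|b x|)).
  apply: le_integrableT (integrableZT Cp (integrableDT (integrableZT (g 1) ID) IPb)).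
    exact: measurable_funM.
  move=> x; rewrite ger0_norm; last exact: mulr_ge0.
  apply: le_trans (ler_wpM2r (g0 _) (phiD x)) _; rewrite -mulrA; apply: ler_wpM2l => //.
  rewrite (mulrC (g 1)) -mulrDr; apply: ler_wpM2l; first by rewrite indicE.
  have [_ _ gm _] := hg; rewrite (ger0_norm (b_ge0 x)); have [b1|b1] := leP (b x) 1.
    by apply: ler_wpDr => //; exact: gm.
  apply: ler_wpDl; first by rewrite -(normr1 R); exact: g0.
  rewrite (PhiE _ (b_ge0 x)) ler_peMl//; last exact: ltW.
  by rewrite -(ger0_norm (b_ge0 x)); exact: g0.
have IW := integrable_wgt mu_leb s01.
apply: integrableDT; apply: integrable_tens => // x.
exact: mulr_ge0.
Qed.

Let q0 z : 0 <= qfar z.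
Proof. by apply: addr_ge0; apply: mulr_ge0 => //; exact: mulr_ge0. Qed.

Lemma integrand_far_le j x y : far_part s g H (u_ j) phi x y <= qfar (x, y).
Proof.
rewrite /far_part /qfar /tens/=.
have [Sx|/phi0 ->] := pselect (S1 x); last by rewrite normr0 !mul0r addr0.
rewrite mulrDr mulrA lerD2r; apply: ler_wpM2r; first exact: W0.
have [_ _ gm _] := hg; apply: ler_wpM2l => //; apply: gm => //.
by rewrite (ger0_norm (b_ge0 x)); apply: ub; exact: S1D.
Qed.

Let Lam0 : 0 <= Lam. Proof. exact: le_trans (k_ge0 (point, point)) (k_le _). Qed.
Let C00 : 0 <= Ctail n m C0.
Proof. by have := le_trans ler01 C1 => ?; rewrite /Ctail !mulr_ge0// exprn_ge0. Qed.

Definition dom_bound (d : R) (v : T -> R) (z : T * T) : R :=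
  Lam * d * (\1_(D `*` D) z * en s g v z)
  + (Lam * d^-1 ^+ m * (\1_(D `*` D) z * en s g phi z)
     + Lam * Ctail n m C0 * (qfar z + qfar (z.2, z.1))).

Lemma integrand_dom_bound d j z : 0 < d <= 1 ->
  `|integrand s g k (u_ j) phi z| <= dom_bound d (u_ j) z.
Proof.
move=> d01; apply: le_trans (integrand_bound s01 hg k_ge0 k_le S1D C1 sep z (uH j) phi0) _.
have f1 := integrand_far_le j z.1 z.2; have f2 := integrand_far_le j z.2 z.1.
have nr : near_part s g D (u_ j) phi z <= d * (\1_(D `*` D) z * en s g (u_ j) z) +
    d^-1 ^+ m * (\1_(D `*` D) z * en s g phi z).
  rewrite /near_part /en.
  have -> : d * (\1_(D `*` D) z * (Phi g (DT s (u_ j) z) / dst z.1 z.2 ^+ n)) +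
      d^-1 ^+ m * (\1_(D `*` D) z * (Phi g (DT s phi z) / dst z.1 z.2 ^+ n)) =
      \1_(D `*` D) z * ((d * Phi g (DT s (u_ j) z) + d^-1 ^+ m * Phi g (DT s phi z))
        / dst z.1 z.2 ^+ n).
    by move: (d^-1 ^+ m) ((dst z.1 z.2 ^+ n)^-1) => A B; ring.
  apply: ler_wpM2l; first by rewrite indicE.
  apply: ler_wpM2r; first by rewrite invr_ge0 exprn_ge0// dst_ge0.
  have := young_small hg d01 (normr_ge0 (DT s (u_ j) z)) (normr_ge0 (DT s phi z)).
  by rewrite !Phi_norm.
rewrite (surjective_pairing z) /= in f1 f2 *; rewrite -surjective_pairing in nr f1 f2 *.
apply: le_trans (ler_wpM2l Lam0 (lerD nr (ler_wpM2l C00 (lerD f1 f2)))) _.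
rewrite /dom_bound le_eqVlt; apply/orP; left; apply/eqP.
by move: (\1_(D `*` D) z * en s g (u_ j) z) (d^-1 ^+ m) (\1_(D `*` D) z * en s g phi z)
  (Ctail n m C0) (qfar _) (qfar _) => A1 A2 A3 A4 A5 A6; ring.
Qed.

Hypothesis usup : forall j, (0 <= \int[mu \x mu]_z (integrand s g k (u_ j) phi z)%:E)%E.

Let Ien v : measurable_fun setT v ->
  (\int[mu \x mu]_z (\1_(D `*` D) z * en s g v z)%:E <= E%:E)%E ->
  (mu \x mu)%E.-integrable setT (EFin \o (fun z => \1_(D `*` D) z * en s g v z)).
Proof.
move=> mv vE; apply/integrableP; split; first by apply/measurable_EFinP; exact: men.
under eq_integral => z _ do rewrite gee0_abs/= ?lee_fin//.
by apply: le_lt_trans vE _; rewrite ltry.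
Qed.

(* Young's inequality puts an arbitrarily small multiple [d] of the energy of [u_ j] into the
   dominating functions, whose integrals therefore converge up to an error [d * E]. *)
Lemma limit_test : (0 <= \int[mu \x mu]_z (integrand s g k u phi z)%:E)%E.
Proof.
have E0 : 0 <= E.
  by rewrite -lee_fin; apply: le_trans (uE 0); apply: integral_ge0 => z _; rewrite lee_fin.
have Iu := Ien mu' energy_limit; have Iu_ j := Ien (mu_ j) (uE j).
have Iphi := integrable_en_lipschitz.
pose rest d z := Lam * d^-1 ^+ m * (\1_(D `*` D) z * en s g phi z)
     + Lam * Ctail n m C0 * (qfar z + qfar (z.2, z.1)).
have Irest d : (mu \x mu)%E.-integrable setT (EFin \o rest d).
  exact: integrableDT (integrableZT _ Iphi)
    (integrableZT _ (integrableDT Ifar (integrable_swap q0 Ifar))).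
have Idom d v : (mu \x mu)%E.-integrable setT
    (EFin \o (fun z => \1_(D `*` D) z * en s g v z)) ->
  (mu \x mu)%E.-integrable setT (EFin \o dom_bound d v).
  move=> Iv; exact: integrableDT (integrableZT _ Iv) (Irest d).
have Edom d v : (mu \x mu)%E.-integrable setT
    (EFin \o (fun z => \1_(D `*` D) z * en s g v z)) ->
  (\int[mu \x mu]_z (dom_bound d v z)%:E =
   (Lam * d)%:E * \int[mu \x mu]_z (\1_(D `*` D) z * en s g v z)%:E
   + \int[mu \x mu]_z (rest d z)%:E)%E.
  move=> Iv; have IZ := integrableZT (Lam * d) Iv.
  rewrite -(integralZl measurableT Iv) -(integralD measurableT IZ (Irest d)).
  by apply: eq_integral.
have key d : 0 < d <= 1 ->
    ((- (Lam * d * E))%:E <= \int[mu \x mu]_z (integrand s g k u phi z)%:E)%E.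
  move=> d01; have d0 : 0 <= d by case/andP: d01 => /ltW.
  have Ld : 0 <= Lam * d by exact: mulr_ge0.
  have [] := @fatou_dominated _ _ _ (mu \x mu)%E (fun j => integrand s g k (u_ j) phi)
    (fun j => dom_bound d (u_ j)) (integrand s g k u phi) (dom_bound d u) (Lam * d * E) => //.
  - by move=> j; exact: (measurable_integrand s hg gcont mk (mu_ j) mphi).
  - exact: (measurable_integrand s hg gcont mk mu' mphi).
  - by move=> j; exact: Idom.
  - exact: Idom.
  - by move=> j z; exact: integrand_dom_bound.
  - by apply: aeW => z; exact: cvg_integrand.
  - apply: aeW => z; apply: cvgD; last exact: cvg_cst.
    by apply: cvgMr; apply: cvgMr; exact: cvg_en.
  move=> j; rewrite (Edom _ _ (Iu_ j)) (Edom _ _ Iu).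
  (* The energies need not converge: that of [u_ j] is bounded by [E] and that of [u] from below by
     0, which accounts for the excess [Lam * d * E]. *)
  apply: (@le_trans _ _ ((Lam * d * E)%:E + \int[mu \x mu]_z (rest d z)%:E)%E).
    by apply: leeD => //; rewrite [(Lam * d * E)%:E]EFinM; apply: lee_wpmul2l; rewrite ?lee_fin.
  rewrite -addeA [X in (_ <= _ + X)%E]addeC; apply: leeDr; apply: mule_ge0; first by rewrite lee_fin.
  by apply: integral_ge0 => z _; rewrite lee_fin.
apply/lee_addgt0Pr => e e0.
(* Chosen so that Lam * d * E <= e; the summand 1 keeps the denominator positive, and d <= 1 is
   required by Young's inequality. *)
pose d := Num.min 1 (e / (Lam * E + 1)).
have LE : 0 < Lam * E + 1 by rewrite ltr_wpDl// mulr_ge0.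
have d01 : 0 < d <= 1 by rewrite lt_min ltr01 divr_gt0//= ge_min lexx.
apply: le_trans (leeD2r e%:E (key d d01)); rewrite -EFinD lee_fin addrC subr_ge0.
have : d <= e / (Lam * E + 1) by rewrite ge_min lexx orbT.
rewrite ler_pdivlMr// => h; apply: le_trans h; rewrite mulrDr mulr1 mulrAC mulrC lerDl.
by case/andP: d01 => /ltW.
Qed.

End limit.

(** * Cutoff functions *)

Section neighborhoods.
Context (R : realType) (n : nat).
Implicit Types (K Om : set 'rV[R]_n) (x y : 'rV[R]_n) (r d : R).

Definition nbh K r : set 'rV[R]_n := [set x | exists2 y, K y & `|x - y| < r].

Lemma open_nbh K r : open (nbh K r).
Proof.
rewrite openE => x [y Ky xy]; rewrite /interior.
apply/(@nbhs_ballP _ 'rV[R]_n); exists (r - `|x - y|); first by rewrite /= subr_gt0.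
move=> z; rewrite -ball_normE /= => xz; exists y => //; rewrite -(subrK x z) -addrA.
by apply: le_lt_trans (ler_normD _ _) _; rewrite distrC -ltrBrDr.
Qed.

Lemma sub_nbh K r : 0 < r -> K `<=` nbh K r.
Proof. by move=> r0 x Kx; exists x => //; rewrite subrr normr0. Qed.

Lemma le_nbh K r r' : r <= r' -> nbh K r `<=` nbh K r'.
Proof. by move=> rr' x [y Ky xy]; exists y => //; exact: lt_le_trans rr'. Qed.

Lemma nbh_add K r r' x y : nbh K r x -> `|y - x| < r' -> nbh K (r + r') y.
Proof.
move=> [z Kz xz] yx; exists z => //; rewrite -(subrK x y) -addrA addrC (addrC r).
by rewrite addrC; apply: le_lt_trans (ler_normD _ _) _; exact: ltrD.
Qed.

Lemma closure_nbh K r r' : r < r' -> closure (nbh K r) `<=` nbh K r'.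
Proof.
move=> rr' x xK; have rr0 : 0 < r' - r by rewrite subr_gt0.
have [y [Ky xy]] := xK (ball x (r' - r)) (nbhsx_ballx x _ rr0).
rewrite -(subrKC r r'); apply: nbh_add Ky _.
by move: xy; rewrite -ball_normE.
Qed.

Lemma nbh_bounded K r : compact K -> exists2 B, 0 < B & forall x, nbh K r x -> `|x| <= B.
Proof.
move=> /compact_bounded[M [_ /(_ (`|M| + 1))]].
have M1 : M < `|M| + 1 by rewrite (le_lt_trans (ler_norm M))// ltrDl.
move=> /(_ M1) KM; exists (`|M| + 1 + `|r|); first by rewrite ltr_pwDl ?ltr_wpDl.
move=> x [y Ky xy]; rewrite -(subrK y x) addrC; apply: le_trans (ler_normD _ _) _.
by apply: lerD; [exact: KM|apply: le_trans (ltW xy) (ler_norm _)].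
Qed.

Lemma compact_closure_nbh K r : compact K -> compact (closure (nbh K r)).
Proof.
move=> cK; apply: bounded_closed_compact; last exact: closed_closure.
have [B B0 KB] := nbh_bounded (r + 1) cK.
exists B; split; first exact: num_real.
move=> M BM x /= /(closure_nbh (r' := r + 1)); rewrite ltrDl => /(_ ltr01)/KB xB.
exact: le_trans xB (ltW BM).
Qed.

Lemma collar Om K : open Om -> compact K -> K `<=` Om ->
  exists2 d : R, 0 < d & closure (nbh K (3 * d)) `<=` Om.
Proof.
move=> oOm /compact_near_coveringP cK KOm.
have := cK R (0^'+) (fun e x => ball x e `<=` Om) _ _; case.
  move=> x Kx; have /nbhs_ballP[r /= r0 rOm] := open_nbhs_nbhs (conj oOm (KOm x Kx)).
  have r20 : 0 < r / 2 by rewrite divr_gt0.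
  exists (ball x (r / 2), [set e : R | e <= r / 2]) => /=.
    split; first exact: nbhsx_ballx.
    exact: nbhs_right_le.
  move=> [y e] /= [xy er] z yz; apply: rOm; rewrite (splitr r).
  by apply: ball_triangle xy _; exact: le_ball yz.
(* With d = e/8 the closure of the 3d-neighbourhood lies in the 4d-neighbourhood, that is, within
   e/2 of the compact set. *)
move=> e /= e0 h; pose d : R := e / 8.
have d0 : 0 < d by rewrite divr_gt0.
exists d => // x /(closure_nbh (r' := 4 * d)).
have : 3 * d < 4 * d by lra.
move=> dd /(_ dd) [y Ky xy].
apply: (h (e / 2)) Ky _ _ => //.
- by rewrite /ball_ /= sub0r normrN gtr0_norm ?divr_gt0//; lra.
- by rewrite divr_gt0.
rewrite -ball_normE /= distrC; apply: lt_le_trans xy _; rewrite /d; lra.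
Unshelve. all: by end_near. Qed.

(** Supremum of cones of height 1 and radius [d] with vertices in [K]; adjoining 0 keeps the set
    nonempty when [K] is empty. *)
Definition tent K d x : R := sup (0 |` [set Num.max 0 (1 - `|x - y| / d) | y in K]).

Let tentS K d x := 0 |` [set Num.max 0 (1 - `|x - y| / d) | y in K].

Let tent_ub K d x : 0 < d -> ubound (tentS K d x) 1.
Proof.
move=> d0 z [->//|[y _ <-]]; rewrite ge_max ler01/= gerBl.
by rewrite divr_ge0// ltW.
Qed.

Lemma tent_ge0_le1 K d x : 0 < d -> 0 <= tent K d x <= 1.
Proof.
move=> d0; apply/andP; split; first by apply: ub_le_sup; [exists 1; exact: tent_ub|left].
by apply: ge_sup; [exists 0; left|exact: tent_ub].
Qed.

Lemma tent_eq1 K d x : 0 < d -> K x -> tent K d x = 1.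
Proof.
move=> d0 Kx; apply/eqP; rewrite eq_le; have /andP[_ ->] := tent_ge0_le1 K x d0.
apply: ub_le_sup; first by exists 1; exact: tent_ub.
by right; exists x => //; rewrite subrr normr0 mul0r subr0; apply/max_idPr.
Qed.

Lemma tent_eq0 K d x : 0 < d -> ~ nbh K d x -> tent K d x = 0.
Proof.
move=> d0 nx; apply/eqP; rewrite eq_le; have /andP[-> _] := tent_ge0_le1 K x d0.
rewrite andbT; apply: ge_sup; first by exists 0; left.
move=> z [->//|[y Ky <-]]; rewrite ge_max lexx/= subr_le0 ler_pdivlMr// mul1r leNgt.
by apply/negP => xy; apply: nx; exists y.
Qed.

(** Each cone has slope 1/d, and a supremum inherits the constant. The maximum with 1 supplies the
    condition [1 <= L] of the cutoff estimate. *)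
Lemma tent_lipschitz K d x y : 0 < d ->
  `|tent K d x - tent K d y| <= Num.max 1 d^-1 * `|x - y|.
Proof.
move=> d0; apply: (@le_trans _ _ (d^-1 * `|x - y|)); last first.
  by rewrite ler_wpM2r// le_max lexx orbT.
wlog suff h : x y / tent K d x <= tent K d y + d^-1 * `|x - y|.
  by rewrite ler_norml; have := h y x; have := h x y; rewrite (distrC y); lra.
apply: ge_sup; first by exists 0; left.
have /andP[t0 _] := tent_ge0_le1 K y d0.
have e0 : 0 <= d^-1 * `|x - y| by rewrite mulr_ge0// invr_ge0 ltW.
move=> _ [->|[z Kz <-]]; first exact: addr_ge0.
rewrite ge_max addr_ge0//=.
have h : Num.max 0 (1 - `|y - z| / d) <= tent K d y.
  by apply: ub_le_sup; [exists 1; exact: tent_ub|right; exists z].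
move: h; rewrite ge_max => /andP[_ h].
have tri : `|y - z| / d <= `|x - z| / d + d^-1 * `|x - y|.
  rewrite mulrC (mulrC `|x - z|) -mulrDr ler_wpM2l ?invr_ge0 ?(ltW d0)//.
  have -> : y - z = (x - z) + (y - x) by rewrite [RHS]addrC addrA subrK.
  by rewrite (distrC x y); exact: ler_normD.
lra.
Qed.

(** |y| is at most |x| + |x-y| with x bounded, and the remaining constant 1 + n B is absorbed
    because |x-y| >= d. *)
Lemma nbh_sep K d : 0 < d -> compact K -> exists2 C : R, 1 <= C &
  forall x y : n.-tuple R, nbh K (2 * d) (rv x) -> ~ nbh K (3 * d) (rv y) ->
    1 + nrm y <= C * dst x y.
Proof.
move=> d0 cK; have [B B0 KB] := nbh_bounded (2 * d) cK.
have B1 : 0 <= 1 + n%:R * B by rewrite addr_ge0// mulr_ge0// ltW.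
exists (1 + n%:R + (1 + n%:R * B) / d).
  by rewrite -addrA lerDl addr_ge0// divr_ge0// ltW.
move=> x y Kx Ky; have dxy : d <= dst x y.
  apply: le_trans (normr_le_enorm _); rewrite leNgt; apply/negP => xy; apply: Ky.
  by rewrite (_ : 3 * d = 2 * d + d); [apply: nbh_add Kx _; rewrite distrC|ring].
have ny : nrm y <= n%:R * (B + dst x y).
  apply: le_trans (enorm_le_normr _) _; rewrite ler_wpM2l//.
  rewrite -(subrK (rv x) (rv y)) addrC; apply: le_trans (ler_normD _ _) _.
  by apply: lerD; [exact: KB|rewrite distrC; exact: normr_le_enorm].
have q : 1 + n%:R * B <= (1 + n%:R * B) / d * dst x y.
  by rewrite mulrAC ler_pdivlMr// ler_wpM2l.
have := dst_ge0 x y; move: ny q; rewrite mulrDr !mulrDl mul1r; lra.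
Qed.

Lemma nbh_diam K r : compact K -> exists2 rho : R, 0 < rho &
  forall x y, nbh K r x -> nbh K r y -> `|x - y| <= rho.
Proof.
move=> /(nbh_bounded r)[B B0 KB]; exists (B + B); first exact: addr_gt0.
by move=> x y /KB xB /KB yB; apply: le_trans (ler_normB _ _) _; exact: lerD.
Qed.

Lemma mu_nbh_lt_pinfty (mu : {sigma_finite_measure set (n.-tuple R) -> \bar R}) K r :
  is_lebesgue mu -> compact K -> (mu (@rv R n @^-1` nbh K r) < +oo)%E.
Proof.
move=> mu_leb /(nbh_bounded r)[B B0 KB].
pose lo : n.-tuple R := [tuple - B - 1 | i < n]; pose hi : n.-tuple R := [tuple B | i < n].
have lh i : tnth lo i <= tnth hi i by rewrite !tnth_mktuple; lra.
apply: le_lt_trans (mu_box_lt_pinfty mu_leb lh).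
apply: le_measure; rewrite ?inE.
- by apply: measurable_preimage_open; exact: open_nbh.
- exact: measurable_box.
move=> x /KB xB i; have := le_trans (ler_normr_rv (rv x) i) xB.
by rewrite !tnth_mktuple mxE ler_norml => /andP[? ?]; apply/andP; split; lra.
Qed.

End neighborhoods.

(** * Young functions and test functions *)

Section young_functions.
Context (R : realType) (g : R -> R) (q : R).
Hypothesis g0 : g 0 = 0.
Hypothesis gpos : forall t, 0 < t -> 0 < g t.
Hypothesis gmono : forall a b, 0 <= a -> a <= b -> g a <= g b.
Hypothesis gpow : forall a b : R, 0 < a -> a <= b ->
  g b / b `^ (q - 1) <= g a / a `^ (q - 1).

(** Comparing the quotient at t and at c t gives g(c t) <= c^(q-1) g(t), and c >= 1 allows a larger
    exponent. *)
Lemma doubling_of_power m : q - 1 <= m%:R -> doubling g m.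
Proof.
move=> qm; have gge0 t : 0 <= t -> 0 <= g t by move=> /(gmono (lexx 0)); rewrite g0.
split => // c t c1; rewrite le_eqVlt => /predU1P[<-|t0]; first by rewrite mulr0 g0 mulr0.
have c0 : 0 < c by exact: lt_le_trans c1.
have ct0 : 0 < c * t by exact: mulr_gt0.
have tct : t <= c * t by rewrite ler_peMl// ltW.
have := gpow t0 tct; rewrite powRM ?(ltW c0) ?(ltW t0)//.
rewrite ler_pdivrMr ?mulr_gt0 ?powR_gt0// => /le_trans; apply.
rewrite [X in _ / _ * X]mulrC mulrA divfK ?gt_eqF ?powR_gt0// mulrC ler_wpM2r ?gge0 ?(ltW t0)//.
by rewrite -powR_mulrn ?(ltW c0)// ler_powR.
Qed.

(** Away from 0 continuity is automatic: the ratio of g(|x|) and g(|t|) lies between 1 and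
    (|x|/|t|)^m by monotonicity and scaling. At 0 it is right continuity. *)
Lemma continuous_doubling m : doubling g m -> g x @[x --> (0 : R)^'+] --> g 0 ->
  continuous (fun t : R => g `|t|).
Proof.
move=> [_ gge0 _ gscale] gr t; have [->|t0] := eqVneq t 0.
  rewrite /continuous_at normr0 g0; rewrite g0 in gr.
  apply/cvgrPdist_lt => e e0; move/cvgrPdist_lt : gr => /(_ e e0).
  rewrite near_withinE => /nbhs_ballP[d /= d0 h]; apply/nbhs_ballP; exists d => // x xd.
  have [->|x0] := eqVneq x 0; first by rewrite normr0 g0 subrr normr0.
  apply: (h `|x|); last by rewrite normr_gt0.
  by move: xd; rewrite -!ball_normE /= !sub0r !normrN normr_id.
have a0 : 0 < `|t| by rewrite normr_gt0.
set a := `|t| in a0.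
pose r (x : R) : R := (`|x| / a) ^+ m.
have cr : `|r x - 1| @[x --> t] --> (0 : R).
  have -> : (0 : R) = `|r t - 1| by rewrite /r divff ?expr1n ?subrr ?normr0// gt_eqF.
  have cq : `|x| / a @[x --> t] --> `|t| / a by apply: cvgMl; apply: cvg_norm; exact: cvg_id.
  have h := continuous_cvg _ (@exprn_continuous _ m _) cq.
  by apply: cvg_norm; apply: cvgB; [exact: h|exact: cvg_cst].
pose lo (x : R) : R := (1 - `|r x - 1|) * g a.
pose hi (x : R) : R := (1 + `|r x - 1|) * g a.
have clo : lo x @[x --> t] --> g a.
  have -> : g a = (1 - 0) * g a by rewrite subr0 mul1r.
  by apply: cvgMl; apply: cvgB => //; exact: cvg_cst.
have chi : hi x @[x --> t] --> g a.
  have -> : g a = (1 + 0) * g a by rewrite addr0 mul1r.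
  by apply: cvgMl; apply: cvgD => //; exact: cvg_cst.
have ga0 : 0 <= g a by rewrite gge0// ltW.
apply: (squeeze_cvgr _ clo chi); near=> x.
have x0 : 0 < `|x|.
  rewrite normr_gt0; near: x; exact: (open_nbhs_nbhs (conj (@open_neq _ 0) t0)).
have xa0 : 0 < `|x| / a by exact: divr_gt0.
have rabs : - `|r x - 1| <= r x - 1 <= `|r x - 1| by rewrite -ler_norml lexx.
rewrite /lo /hi; have [xa|ax] := leP `|x| a.
  apply/andP; split; last first.
    by apply: le_trans (gmono (ltW x0) xa) _; rewrite ler_peMl// lerDl.
  have c1 : 1 <= a / `|x| by rewrite ler_pdivlMr// mul1r.
  have := gscale _ _ c1 (ltW x0); rewrite divfK ?gt_eqF// => h.
  apply: (@le_trans _ _ (r x * g a)); first by rewrite ler_wpM2r//; lra.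
  rewrite mulrC -ler_pdivlMr ?exprn_gt0//; apply: le_trans h _.
  by rewrite mulrC -exprVn invf_div.
apply/andP; split.
  apply: le_trans (gmono (ltW a0) (ltW ax)).
  by rewrite ler_piMl// gerBl.
have c1 : 1 <= `|x| / a by rewrite ler_pdivlMr// mul1r ltW.
have := gscale _ _ c1 (ltW a0); rewrite divfK ?gt_eqF// => /le_trans; apply.
by rewrite ler_wpM2r// -/(r x); lra.
Unshelve. all: by end_near. Qed.

End young_functions.

Lemma young_primitive_bounds (R : realType) (G g : R -> R) (p q : R) : 1 < p -> p <= q ->
  (forall t, 0 <= t -> 0 <= g t) ->
  (forall t : R, 0 <= t -> p * G t <= t * g t /\ t * g t <= q * G t) ->
  forall t : R, 0 <= G `|t| <= Phi g t /\ Phi g t <= q * G `|t|.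
Proof.
move=> p1 pq gge0 h t; have [h1 h2] := h _ (normr_ge0 t).
have tg : 0 <= `|t| * g `|t| by rewrite mulr_ge0// gge0.
have q0 : 0 < q by lra.
have G0 : 0 <= G `|t| by rewrite -(pmulr_rge0 _ q0); exact: le_trans h2.
by split=> //; rewrite G0/=; apply: le_trans h1; rewrite ler_peMl// ltW.
Qed.

(** * Test functions are bounded and Lipschitz *)

Section test_functions.
Context (R : realType) (n : nat).
Implicit Types (f : 'rV[R]_n -> R) (v x y : 'rV[R]_n).

Lemma is_derive_line f v e (t : R) : derivable f (v + t *: e) e ->
  is_derive t 1 (fun r : R => f (v + r *: e)) (derive f (v + t *: e) e).
Proof.
have E : (fun h : R => h^-1 *: ((fun r : R => f (v + r *: e)) (h *: 1 + t) - f (v + t *: e))) =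
    (fun h : R => h^-1 *: (f (h *: e + (v + t *: e)) - f (v + t *: e))).
  apply/funext => h /=; congr (_ *: (f _ - _)).
  by rewrite [h *: 1]mulr1 scalerDl addrCA.
move=> df; apply: DeriveDef; last by rewrite /derive /= E.
by rewrite /derivable E.
Qed.

Lemma bounded_pder_lipschitz f (C : R) : 0 <= C ->
  (forall i x, derivable f x (ebasis R i)) ->
  (forall i x, `|derive f x (ebasis R i)| <= C) ->
  forall x y, `|f x - f y| <= n%:R * C * `|x - y|.
Proof.
move=> C0 df fC x y.
(* A path from x to y that changes one coordinate at a time; each step is parallel to an axis, where
   the mean value theorem applies. *)
pose z (k : nat) : 'rV[R]_n := \row_(i < n) (if (i < k)%N then y ord0 i else x ord0 i).
have zn : z n = y by apply/rowP => i; rewrite mxE ltn_ord.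
have z0 : z 0%N = x by apply/rowP => i; rewrite mxE ltn0.
suff h k : (k <= n)%N -> `|f x - f (z k)| <= k%:R * C * `|x - y|.
  by have := h n (leqnn n); rewrite zn.
elim: k => [_|k ih kn]; first by rewrite z0 subrr normr0 !mul0r.
apply: le_trans (ler_distD (f (z k)) _ _) _.
rewrite -natr1 !mulrDl mul1r; apply: lerD; first exact/ih/ltnW.
pose i := Ordinal kn; pose t := y ord0 i - x ord0 i.
have zS : z k.+1 = z k + t *: ebasis R i.
  apply/rowP => j; rewrite !mxE eqxx/= ltnS leq_eqVlt.
  have [ji|ji] := eqVneq j i; first by rewrite ji /= eqxx ltnn mulr1 /t addrC subrK.
  by rewrite -val_eqE/= in ji; rewrite (negbTE ji)/= mulr0 addr0.
have := @bounded_derive_lipschitz R _ _ C (fun r => is_derive_line (df i (z k + r *: ebasis R i)))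
  (fun r => fC i _) 0 t.
rewrite scale0r addr0 -zS sub0r normrN => /le_trans; apply; rewrite ler_wpM2l//.
rewrite /t distrC (_ : x ord0 i - y ord0 i = (x - y) ord0 i); last by rewrite !mxE.
exact: ler_normr_rv.
Qed.

Lemma testfun_bdd_lip Om f : testfun Om f -> bdd_lip f.
Proof.
move=> [smf [K [cK [_ fK]]]].
have bd (h : 'rV[R]_n -> R) : continuous h -> (forall x, ~ K x -> h x = 0) ->
    exists2 C : R, 0 <= C & forall x, `|h x| <= C.
  move=> ch hK; have ci : compact (h @` K).
    by apply: continuous_compact cK; exact: continuous_subspaceT.
  have [M [_ /(_ (`|M| + 1))]] := compact_bounded ci.
  have M1 : M < `|M| + 1 by rewrite (le_lt_trans (ler_norm M))// ltrDl.
  move=> /(_ M1) KM; exists (`|M| + 1) => [|x]; first exact: addr_ge0.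
  have [Kx|/hK ->] := pselect (K x); first by apply: KM; exists x.
  by rewrite normr0 addr_ge0.
(* The complement of [K] is open, so the difference quotients vanish near such a point; the partial
   derivatives are thus supported in [K] and bounded. *)
have d0 i x : ~ K x -> derive f x (ebasis R i) = 0.
  move=> nKx; have oK : open (~` K) by apply: closed_openC; exact: compact_closed.
  have fx0 := fK x nKx.
  rewrite /derive; apply: cvg_lim => //.
  apply: (@cvg_trans _ ((fun=> 0 : R) @ 0^')); last exact: cvg_cst.
  apply: near_eq_cvg.
  have : \forall h \near (0 : R)^', (~` K) (h *: ebasis R i + x).
    have c : (h *: ebasis R i + x) @[h --> (0 : R)^'] --> x.
      rewrite -[X in _ --> X]add0r -(scale0r (ebasis R i)).
      apply: cvg_within_filter; apply: cvgD; last exact: cvg_cst.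
      by apply: cvgZr_tmp; exact: cvg_id.
    exact: (c _ (open_nbhs_nbhs (conj oK nKx))).
  by apply: filterS => h /= /fK ->; rewrite fx0 subrr scaler0.
have [C0 C00 fC0] := bd f (smf [::]).1 fK.
have [C C_ge0 fC] : exists2 C : R, 0 <= C & forall i x, `|derive f x (ebasis R i)| <= C.
  have [F FP] := @boolp.choice _ _
    (fun (i : 'I_n) (D : R) => 0 <= D /\ forall x, `|derive f x (ebasis R i)| <= D)
    (fun i => let: ex_intro2 D D0 DP := bd _ (smf [:: i]).1 (d0 i) in ex_intro _ D (conj D0 DP)).
  exists (\sum_i F i) => [|i x]; first by apply: sumr_ge0 => i _; have [] := FP i.
  apply: le_trans ((FP i).2 x) _; rewrite (bigD1 i)//= lerDl sumr_ge0// => j _.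
  by have [] := FP j.
exists (C0 + n%:R * C); first by rewrite addr_ge0// mulr_ge0.
split => [x|x y]; first by apply: le_trans (fC0 x) _; rewrite lerDl mulr_ge0.
apply: le_trans (bounded_pder_lipschitz C_ge0 (smf [::]).2 fC x y) _.
by rewrite ler_wpM2r// lerDr.
Qed.

End test_functions.

(** * Increasing sequences of supersolutions *)

Section increasing_limit.
Context (R : realType) (n : nat).
Local Notation T := (n.-tuple R).
Variable mu : {sigma_finite_measure set T -> \bar R}.
Hypothesis mu_leb : is_lebesgue mu.
Variables (s : R) (s01 : 0 < s < 1) (g : R -> R) (m : nat).
Hypothesis hg : doubling g m.
Hypothesis gcont : continuous (fun t : R => g `|t|).
Hypothesis g1 : 0 < g 1.
Variables (k : T * T -> R) (lam Lam : R).
Hypothesis mk : measurable_fun setT k.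
Hypothesis lam0 : 0 < lam.
Hypothesis k_ge : forall z, lam <= k z.
Hypothesis k_le : forall z, k z <= Lam.
Variable H : T -> R.
Hypothesis mH : measurable_fun setT H.
Hypothesis IJ : mu.-integrable setT (EFin \o (fun y => tailw s g (H y) y)).
Variable Om : set 'rV[R]_n.
Hypothesis oOm : open Om.
Variables (U_ : nat -> T -> R) (U : T -> R).
Hypothesis mU_ : forall j, measurable_fun setT (U_ j).
Hypothesis mU : measurable_fun setT U.
Hypothesis UH : forall j y, `|U_ j y| <= `|H y|.
Hypothesis Uincr : forall j x, U_ j x <= U_ j.+1 x.
Hypothesis Ucvg : forall x, (fun j => U_ j x) @ \oo --> U x.

Local Notation pre D := (@rv R n @^-1` D).

Hypothesis UPhi : forall j D, open D -> ccont D Om ->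
  (\int[mu]_x (\1_(pre D) x * Phi g (U_ j x))%:E < +oo)%E.
Hypothesis Uen : forall j D, open D -> ccont D Om ->
  (\int[mu \x mu]_z (\1_(pre D `*` pre D) z * en s g (U_ j) z)%:E < +oo)%E.
Hypothesis UM : forall D, open D -> ccont D Om ->
  exists M : R, forall j, {ae mu, forall x, D (rv x) -> U_ j x <= M}.
Hypothesis Usuper : forall j (f : 'rV[R]_n -> R), testfun Om f -> (forall x, 0 <= f x) ->
  (0 <= \int[mu \x mu]_z (integrand s g k (U_ j) (f \o @rv R n) z)%:E)%E.

Let k_ge0 z : 0 <= k z. Proof. exact: le_trans (ltW lam0) (k_ge z). Qed.
Let P0 t : 0 <= Phi g t. Proof. exact: Phi_ge0 hg _. Qed.
Let en0 (v : T -> R) z : 0 <= en s g v z. Proof. exact: en_ge0 hg _ _. Qed.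

Let Pm (f : T -> R) : measurable_fun setT f -> measurable_fun setT (Phi g \o f).
Proof. by move=> mf; apply: measurableT_comp => //; exact: measurable_Phi. Qed.

Let mpre D : open D -> measurable (pre D).
Proof. exact: measurable_preimage_open. Qed.

Lemma ae_pair (V V' : T -> R) : {ae mu, forall x, V x = V' x} ->
  {ae (mu \x mu)%E, forall z, V z.1 = V' z.1 /\ V z.2 = V' z.2}.
Proof. by move=> h; apply: filterS2 (ae_fst h) (ae_snd h) => z. Qed.

Lemma en_ae V V' (D : set (T * T)) : {ae mu, forall x, V x = V' x} ->
  (\int[mu \x mu]_z (\1_D z * en s g V z)%:E = \int[mu \x mu]_z (\1_D z * en s g V' z)%:E)%E.
Proof.
move=> /ae_pair h; apply: ae_eq_integralT; apply: filterS h => z [h1 h2].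
by rewrite /en /DT h1 h2.
Qed.

Lemma integrand_ae V V' phi : {ae mu, forall x, V x = V' x} ->
  (\int[mu \x mu]_z (integrand s g k V phi z)%:E =
   \int[mu \x mu]_z (integrand s g k V' phi z)%:E)%E.
Proof.
move=> /ae_pair h; apply: ae_eq_integralT; apply: filterS h => z [h1 h2].
by rewrite /integrand /DT h1 h2.
Qed.

Lemma Uincr0 j x : U_ 0%N x <= U_ j x.
Proof. by elim: j => // j /le_trans; apply; exact: Uincr. Qed.

(* Setting the functions to 0 on a null set keeps the envelope [H], since [0 <= M]. *)
Lemma exists_clean D : open D -> ccont D Om ->
  exists (M : R) (V_ : nat -> T -> R) (V : T -> R),
  [/\ 0 <= M, forall j, measurable_fun setT (V_ j), measurable_fun setT V,
      forall j y, `|V_ j y| <= `|H y| & forall x, (fun j => V_ j x) @ \oo --> V x] /\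
  [/\ forall j x, D (rv x) -> V_ j x <= M,
      forall j x, D (rv x) -> `|V_ j x| <= `|U_ 0%N x| + M,
      forall j, {ae mu, forall x, V_ j x = U_ j x} & {ae mu, forall x, V x = U x}].
Proof.
move=> oD cD; have [M0 /ae_foralln[N [mN N0 sub]]] := UM oD cD.
have M0le : M0 <= Num.max M0 0 by rewrite le_max lexx.
have M_ge0 : 0 <= Num.max M0 0 by rewrite le_max lexx orbT.
move: (Num.max M0 0) M0le M_ge0 => M M0le M_ge0.
pose c := \1_(~` N) : T -> R.
have c01 x : 0 <= c x <= 1 by rewrite /c indicE; case: (_ \in _); rewrite ?lexx ler01.
have mc : measurable_fun setT c by apply: measurable_indic; exact: measurableC.
have ae (V : T -> R) : {ae mu, forall x, V x * c x = V x}.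
  exists N; split => // x; apply: contra_notP => xN.
  by rewrite /= /c indicE mem_set// mulr1.
have le x j : D (rv x) -> U_ j x * c x <= M.
  move=> Dx; rewrite /c indicE; have [/set_mem xN|_] := boolP (_ \in _); last by rewrite mulr0.
  rewrite mulr1; apply: le_trans M0le; apply: contrapT => h; apply: xN; apply: sub => /= h'.
  by apply: h; exact: h'.
exists M, (fun j x => U_ j x * c x), (fun x => U x * c x); split; split => //.
- by move=> j; exact: measurable_funM.
- exact: measurable_funM.
- move=> j y; rewrite normrM; apply: le_trans (UH j y); rewrite ler_piMr//.
  by have /andP[c0 c1] := c01 y; rewrite ger0_norm.
- by move=> x; apply: cvgMl; exact: Ucvg.
- by move=> j x; exact: le.
- move=> j x Dx; have h1 := le x j Dx; have h0 := Uincr0 j x.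
  have /andP[c0 c1] := c01 x; rewrite ler_norml; apply/andP; split.
    have := ler_norm (- U_ 0%N x); rewrite normrN => h2.
    have : - (U_ j x * c x) <= `|U_ 0%N x|.
      rewrite -mulNr; apply: (@le_trans _ _ (`|U_ 0%N x| * c x)); last by rewrite ler_piMr.
      by rewrite ler_wpM2r//; lra.
    lra.
  by apply: le_trans h1 _; rewrite lerDr.
Qed.

Lemma integrable_indic_nbh K d : compact K ->
  mu.-integrable setT (EFin \o (\1_(pre (nbh K d)) : T -> R)).
Proof.
move=> cK; apply: integrable_indic_fin; first by apply: mpre; exact: open_nbh.
exact: mu_nbh_lt_pinfty.
Qed.

Lemma integrable_bound D (M : R) : open D -> ccont D Om -> 0 <= M ->
  mu.-integrable setT (EFin \o (\1_(pre D) : T -> R)) ->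
  mu.-integrable setT (EFin \o (fun x => \1_(pre D) x * Phi g (`|U_ 0%N x| + M))).
Proof.
move=> oD cD M0 ID.
have I0 : mu.-integrable setT (EFin \o (fun x => \1_(pre D) x * Phi g (U_ 0%N x))).
  apply/integrableP; split.
    apply/measurable_EFinP; apply: measurable_funM; last exact: Pm.
    by apply: measurable_indic; exact: mpre.
  have := UPhi 0 oD cD; congr (_ < _)%E; apply: eq_integral => x _.
  by rewrite /= ger0_norm// mulr_ge0// indicE.
apply: le_integrableT (integrableZT (2 ^+ m.+1) (integrableDT I0 (integrableZT (Phi g M) ID))).
  apply: measurable_funM; first by apply: measurable_indic; exact: mpre.
  apply: Pm; apply: measurable_funD => //; exact: measurableT_comp.
move=> x; rewrite ger0_norm; last by apply: mulr_ge0; rewrite // indicE.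
rewrite (mulrC (Phi g M)) -mulrDr [leRHS]mulrCA; apply: ler_wpM2l; first by rewrite indicE.
by apply: le_trans (Phi_add_le hg _ _) _; rewrite Phi_norm.
Qed.

Lemma ccont_nbh K d : compact K -> closure (nbh K d) `<=` Om -> ccont (nbh K d) Om.
Proof. by move=> cK KOm; split=> //; exact: compact_closure_nbh. Qed.

Lemma integrable_energy V D : open D -> measurable_fun setT V ->
  (\int[mu \x mu]_z (\1_(pre D `*` pre D) z * en s g V z)%:E < +oo)%E ->
  (mu \x mu)%E.-integrable setT (EFin \o (fun z => \1_(pre D `*` pre D) z * en s g V z)).
Proof.
move=> oD mV fin; apply/integrableP; split.
  apply/measurable_EFinP; apply: measurable_funM; last exact: measurable_en.
  by apply: measurable_indic; apply: measurableX; exact: mpre.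
move: fin; congr (_ < _)%E; apply: eq_integral => z _.
by rewrite /= ger0_norm// mulr_ge0// indicE.
Qed.

(** Caccioppoli with the tent over K = closure D as cutoff: it is 1 on [D], vanishes off the
    d-neighbourhood, translations shorter than d stay in the 2d-neighbourhood, and the
    3d-neighbourhood is the region of near pairs. *)
Lemma energy_bounded D : open D -> ccont D Om -> exists E : R, forall j,
  (\int[mu \x mu]_z (\1_(pre D `*` pre D) z * en s g (U_ j) z)%:E <= E%:E)%E.
Proof.
move=> oD [cK KOm]; set K := closure D in cK KOm.
have DK : D `<=` K by exact: subset_closure.
have [d d0 nOm] := collar oOm cK KOm.
have [C C1 sep] := nbh_sep d0 cK.
pose D3 := nbh K (3 * d); have oD3 : open D3 by exact: open_nbh.
have cD3 : ccont D3 Om by exact: ccont_nbh.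
have [M [V_ [V [[M0 mV_ mV VH Vcvg] [VM Vb V_ae V_ae']]]]] := exists_clean oD3 cD3.
have [rho rho0 Drho] := nbh_diam (3 * d) cK.
pose L : R := Num.max 1 d^-1; have L1 : 1 <= L by rewrite le_max lexx.
pose eta (x : T) := tent K d (rv x).
have lipc : continuous (tent K d).
  apply: bdd_lip_continuous; exists L; first exact: le_trans L1.
  split => [x|x y]; last exact: tent_lipschitz.
  by have /andP[t0 t1] := tent_ge0_le1 K x d0; rewrite ger0_norm//; exact: le_trans L1.
have meta : measurable_fun setT eta by exact: measurable_continuous_rv.
have dd : d <= 2 * d by lra.
have dd3 : 2 * d <= 3 * d by lra.
pose b x := `|U_ 0%N x| + M.
have mb : measurable_fun setT b.
  by apply: measurable_funD => //; apply: measurableT_comp.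
have b0 x : 0 <= b x by rewrite addr_ge0.
have ID := integrable_indic_nbh (3 * d) cK.
have Ib := integrable_bound oD3 cD3 M0 ID.
pose B := cacc_bound s g m Lam (pre D3) C H rho L b M.
have IB : (mu \x mu)%E.-integrable setT (EFin \o B).
  exact: (integrable_cacc_bound mu_leb s01 hg gcont Lam C (mpre oD3) IJ rho0 L M0 mb b0 g1 ID Ib).
(* [B] does not involve [j]; the factor 2/lam undoes the lam/2 in front of the energy. *)
exists (2 / lam * fine (\int[mu \x mu]_z (B z)%:E)%E) => j.
have Ien : (mu \x mu)%E.-integrable setT
    (EFin \o (fun z => \1_(pre D3 `*` pre D3) z * en s g (V_ j) z)).
  by apply: integrable_energy => //; rewrite (en_ae _ (V_ae j)); exact: Uen.
have super f : testfun Om f -> (forall x, 0 <= f x) ->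
    (0 <= \int[mu \x mu]_z (integrand s g k (V_ j) (f \o @rv R n) z)%:E)%E.
  by move=> tf f0; rewrite (integrand_ae _ (V_ae j)); exact: Usuper.
have S01 (x h : T) : pre (nbh K d) (tadd x h) -> `|rv h| < d -> pre (nbh K (2 * d)) x.
  rewrite /= rv_tadd => Kxh hd; rewrite (_ : 2 * d = d + d); last by ring.
  by apply: nbh_add Kxh _; rewrite opprD addrA subrr sub0r normrN.
have m2 : measurable (pre (nbh K (2 * d))) by apply: mpre; exact: open_nbh.
have S1D : pre (nbh K (2 * d)) `<=` pre D3 by move=> x; exact: le_nbh.
have S0S1 : pre (nbh K d) `<=` pre (nbh K (2 * d)) by move=> x; exact: le_nbh.
have cc : compact (closure D3) by exact: compact_closure_nbh.
have DD3 : pre D `<=` pre D3 by move=> x Dx; apply: sub_nbh; [lra|exact: DK].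
have eta1 x : pre D x -> eta x = 1 by move=> Dx; apply: tent_eq1 => //; exact: DK.
have S1K x : pre (nbh K (2 * d)) x -> closure D3 (rv x).
  by move=> Sx; apply: subset_closure; exact: le_nbh Sx.
have eta0 x : ~ pre (nbh K d) x -> eta x = 0 by exact: tent_eq0.
have := caccioppoli_integral mu_leb s01 hg gcont mk k_ge0 k_le m2
  (mpre oD3) S1D C1 sep mH IJ rho0 (fun x y => @Drho (rv x) (rv y)) S0S1 meta
  (fun x => tent_ge0_le1 K (rv x) d0) eta0 L1
  (fun x y => tent_lipschitz K (rv x) (rv y) d0) M0 mb b0 g1 ID Ib (mV_ j) (VH j)
  (VM j) (Vb j) Ien lam0 k_ge (mpre oD) DD3 eta1 d0 S01 cc nOm S1K super.
rewrite (en_ae _ (V_ae j)) => h.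
rewrite EFinM fineK; last exact: integrable_fin_num IB.
apply: le_trans (lee_wpmul2l _ h); last by rewrite lee_fin divr_ge0// ltW.
rewrite muleA -EFinM (_ : 2 / lam * (lam / 2) = 1) ?mul1e//.
by field; rewrite gt_eqF.
Qed.

Lemma limit_en D : open D -> ccont D Om ->
  (\int[mu \x mu]_z (\1_(pre D `*` pre D) z * en s g U z)%:E < +oo)%E.
Proof.
move=> oD cD; have [E UE] := energy_bounded oD cD.
by apply: le_lt_trans (energy_limit hg gcont (mpre oD) mU_ Ucvg UE) _; rewrite ltry.
Qed.

(** The local bound by |U_0| + M passes to the limit pointwise. *)
Lemma limit_Phi D : open D -> ccont D Om ->
  (\int[mu]_x (\1_(pre D) x * Phi g (U x))%:E < +oo)%E.
Proof.
move=> oD cD; have [cK _] := cD.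
have [M [V_ [V [[M0 _ _ _ Vcvg] [_ Vb _ V_ae]]]]] := exists_clean oD cD.
have ID : mu.-integrable setT (EFin \o (\1_(pre D) : T -> R)).
  apply: le_integrableT (integrable_indic_nbh 1 cK).
    by apply: measurable_indic; exact: mpre.
  move=> x; rewrite !indicE; have [/set_mem Dx|_] := boolP (x \in pre D).
    by rewrite mem_set ?normr1//; apply: sub_nbh => //; exact: subset_closure.
  by rewrite normr0.
have Vb' x : D (rv x) -> `|V x| <= `|U_ 0%N x| + M.
  move=> Dx; have c : (fun j => `|V_ j x|) @ \oo --> `|V x| by apply: cvg_norm; exact: Vcvg.
  rewrite -(cvg_lim _ c)//; apply: limr_le; first by apply/cvg_ex; exists `|V x|.
  by apply: nearW => j; exact: Vb.
have /integrableP[_] := integrable_bound oD cD M0 ID.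
apply: le_lt_trans; apply: ge0_ae_le_integral => [x|x|].
- by rewrite lee_fin mulr_ge0// indicE.
- by rewrite abse_ge0.
apply: filterS V_ae => x VU; rewrite /= lee_fin -VU ger0_norm; last first.
  by apply: mulr_ge0; rewrite // indicE.
rewrite indicE; have [/set_mem Dx|_] := boolP (x \in pre D); last by rewrite !mul0r.
by rewrite !mul1r; apply: (le_Phi hg); apply: le_trans (Vb' _ Dx) (ler_norm _).
Qed.

Lemma limit_super (f : 'rV[R]_n -> R) : testfun Om f -> (forall x, 0 <= f x) ->
  (0 <= \int[mu \x mu]_z (integrand s g k U (f \o @rv R n) z)%:E)%E.
Proof.
move=> tf f0; have [_ [K [cK [KOm fK]]]] := tf.
have [Cf Cf0 [fC flip]] := testfun_bdd_lip tf.
have [d d0 nOm] := collar oOm cK KOm.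
have [C C1 sep] := nbh_sep d0 cK.
pose D3 := nbh K (3 * d); have oD3 : open D3 by exact: open_nbh.
have cD3 : ccont D3 Om by exact: ccont_nbh.
have [M [V_ [V [[M0 mV_ mV VH Vcvg] [_ Vb V_ae V_ae']]]]] := exists_clean oD3 cD3.
have [rho rho0 Drho] := nbh_diam (3 * d) cK.
have [E UE] := energy_bounded oD3 cD3.
pose b x := `|U_ 0%N x| + M.
have mb : measurable_fun setT b.
  by apply: measurable_funD => //; apply: measurableT_comp.
have b0 x : 0 <= b x by rewrite addr_ge0.
have ID := integrable_indic_nbh (3 * d) cK.
have Ib := integrable_bound oD3 cD3 M0 ID.
have dd3 : 2 * d <= 3 * d by lra.
have S1D : pre (nbh K (2 * d)) `<=` pre D3 by move=> x; exact: le_nbh.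
have VE j : (\int[mu \x mu]_z (\1_(pre D3 `*` pre D3) z * en s g (V_ j) z)%:E <= E%:E)%E.
  by rewrite (en_ae _ (V_ae j)).
have mf : measurable_fun setT (f \o @rv R n).
  apply: measurable_continuous_rv; apply: bdd_lip_continuous; exact: testfun_bdd_lip tf.
have f_out x : ~ pre (nbh K (2 * d)) x -> (f \o @rv R n) x = 0.
  by move=> nx; apply: fK => Kx; apply: nx; apply: sub_nbh => //; rewrite mulr_gt0.
have L1 : 1 <= 1 + Cf by rewrite lerDl.
have lip (x y : T) : `|(f \o @rv R n) x - (f \o @rv R n) y| <= (1 + Cf) * `|rv x - rv y|.
  by apply: le_trans (flip _ _) _; rewrite ler_wpM2r// lerDr.
have super j : (0 <= \int[mu \x mu]_z (integrand s g k (V_ j) (f \o @rv R n) z)%:E)%E.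
  by rewrite (integrand_ae _ (V_ae j)); exact: Usuper.
rewrite -(integrand_ae _ V_ae').
exact: (limit_test mu_leb s01 hg gcont mk k_ge0 k_le (mpre oD3) S1D C1 sep IJ rho0
  (fun x y => @Drho (rv x) (rv y)) mb b0 ID Ib mV_ mV VH Vb Vcvg VE mf
  (fun x => fC (rv x)) f_out L1 lip super).
Qed.

End increasing_limit.

(** * Function spaces of the statement in terms of Borel representatives *)

Lemma ge0_ae_le_integral_in d (X : measurableType d) (R : realType) (m : {measure set X -> \bar R})
    (A : set X) (f g : X -> R) : (forall x, 0 <= f x) -> (forall x, 0 <= g x) ->
  {ae m, forall x, f x <= g x} ->
  (\int[m]_(x in A) (f x)%:E <= \int[m]_(x in A) (g x)%:E)%E.
Proof.
move=> f0 g0 fg; rewrite integral_mkcond [leRHS]integral_mkcond.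
apply: ge0_ae_le_integral => [x|x|]; try by rewrite patchE; case: ifP; rewrite // lee_fin.
by apply: filterS fg => x fgx; rewrite !patchE; case: ifP; rewrite // lee_fin.
Qed.

Lemma integral_in_indic d (X : measurableType d) (R : realType) (m : {measure set X -> \bar R})
    (A : set X) (f : X -> R) :
  (\int[m]_(x in A) (f x)%:E = \int[m]_x (\1_A x * f x)%:E)%E.
Proof.
rewrite integral_mkcond; apply: eq_integral => x _.
by rewrite patchE indicE; case: (x \in A); rewrite ?mul1r ?mul0r.
Qed.

Section representatives.
Context (R : realType) (n : nat).
Local Notation T := (n.-tuple R).
Variable mu : {sigma_finite_measure set T -> \bar R}.
Variables (s : R) (s01 : 0 < s < 1) (G g : R -> R) (m : nat) (q : R).
Hypothesis hg : doubling g m.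
Hypothesis gcont : continuous (fun t : R => g `|t|).
Hypothesis GPhi : forall t : R, 0 <= G `|t| <= Phi g t /\ Phi g t <= q * G `|t|.
Hypothesis q0 : 0 <= q.
Hypothesis dG : forall t : R, 0 < t -> is_derive t 1 G (g t).

Let P0 t : 0 <= Phi g t. Proof. exact: Phi_ge0 hg _. Qed.
Let G0 (t : R) : 0 <= G `|t|. Proof. by have [/andP[]] := GPhi t. Qed.
Let GP (t : R) : G `|t| <= Phi g t. Proof. by have [/andP[]] := GPhi t. Qed.
Let PG (t : R) : Phi g t <= q * G `|t|. Proof. by have [] := GPhi t. Qed.

Local Notation pre D := (@rv R n @^-1` D).

(** Away from 0 it follows from differentiability of [G]; at 0 the function is squeezed between 0
    and [Phi]. *)
Lemma continuous_young : continuous (fun t : R => G `|t|).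
Proof.
move=> t; have [->|t0] := eqVneq t 0.
  have G00 : G `|0 : R| = 0 by apply/le_anti; rewrite G0 (le_trans (GP 0))// Phi0.
  rewrite /continuous_at G00.
  have cP : Phi g x @[x --> (0 : R)] --> (0 : R).
    by rewrite -[X in _ --> X](Phi0 g); exact: (continuous_Phi gcont).
  apply: (squeeze_cvgr _ (@cvg_cst R (0 : R) _ _ _) cP).
  by apply: nearW => x; rewrite G0 GP.
have t1 : 0 < `|t| by rewrite normr_gt0.
have cG : {for `|t|, continuous G}.
  by apply: differentiable_continuous; apply/derivable1_diffP; have [] := dG t1.
have h := continuous_cvg _ cG (cvg_norm (@cvg_id _ (nbhs t))).
exact: h.
Qed.

Let mG (d : measure_display) (X : measurableType d) (f : X -> R) : measurable_fun setT f ->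
  measurable_fun setT (fun x => G `|f x|).
Proof.
by move=> mf; exact: (measurableT_comp (continuous_measurable_fun continuous_young) mf).
Qed.

Variables (Om : set 'rV[R]_n) (v : 'rV[R]_n -> R) (V : T -> R).
Hypothesis mV : measurable_fun setT V.
Hypothesis vV : {ae mu, forall x, v (rv x) = V x}.

Let vV2 : {ae (mu \x mu)%E, forall z, v (rv z.1) = V z.1 /\ v (rv z.2) = V z.2}.
Proof. exact: (ae_pair (V := v \o @rv R n)). Qed.

Lemma Wloc_Phi D : Wloc mu G s Om v -> open D -> ccont D Om ->
  (\int[mu]_x (\1_(pre D) x * Phi g (V x))%:E < +oo)%E.
Proof.
move=> [_ W] oD cD; have [h _] := W D oD cD.
have mD : measurable (pre D) by exact: measurable_preimage_open.
have m1 : measurable_fun setT (fun x => \1_(pre D) x * G `|V x|).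
  by apply: measurable_funM; [exact: measurable_indic|exact: mG].
apply: (@le_lt_trans _ _ (\int[mu]_x (q%:E * (\1_(pre D) x * G `|V x|)%:E))%E).
  apply: ge0_le_integralT => x; first by rewrite lee_fin mulr_ge0// indicE.
  by rewrite -EFinM lee_fin [leRHS]mulrCA; apply: ler_wpM2l => //; rewrite indicE.
rewrite ge0_integralZl//; last 2 first.
- exact/measurable_EFinP.
- by move=> x _; rewrite lee_fin mulr_ge0// indicE.
apply: lte_mul_pinfty => //.
rewrite -integral_in_indic; apply: le_lt_trans h.
by apply: ge0_ae_le_integral_in => //; apply: filterS vV => x ->.
Qed.

Lemma Wloc_en D : Wloc mu G s Om v -> open D -> ccont D Om ->
  (\int[mu \x mu]_z (\1_(pre D `*` pre D) z * en s g V z)%:E < +oo)%E.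
Proof.
move=> [_ W] oD cD; have [_ h] := W D oD cD.
have mD : measurable (pre D) by exact: measurable_preimage_open.
pose f z := G `|DT s V z| / dst z.1 z.2 ^+ n.
have f0 z : 0 <= f z by rewrite divr_ge0// exprn_ge0// dst_ge0.
have mf : measurable_fun setT (fun z => \1_(pre D `*` pre D) z * f z).
  apply: measurable_funM; first by apply: measurable_indic; exact: measurableX.
  by apply: measurable_funM; [apply: mG; exact: measurable_DT|exact: measurable_inv_dst].
apply: (@le_lt_trans _ _ (\int[mu \x mu]_z (q%:E * (\1_(pre D `*` pre D) z * f z)%:E))%E).
  apply: ge0_le_integralT => z.
    by rewrite lee_fin; apply: mulr_ge0; [rewrite indicE|exact: en_ge0 hg _ _].
  rewrite -EFinM lee_fin [leRHS]mulrCA; apply: ler_wpM2l; first by rewrite indicE.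
  by rewrite /en /f mulrA ler_wpM2r// invr_ge0 exprn_ge0// dst_ge0.
rewrite ge0_integralZl//; last 2 first.
- exact/measurable_EFinP.
- by move=> z _; rewrite lee_fin mulr_ge0// indicE.
apply: lte_mul_pinfty => //.
rewrite -integral_in_indic; apply: le_lt_trans h.
apply: ge0_ae_le_integral_in => //.
  by move=> z; rewrite divr_ge0// exprn_ge0// enorm_ge0.
by apply: filterS vV2 => z [h1 h2]; rewrite /Ds h1 h2.
Qed.

Lemma Wloc_of_Phi :
  (forall D, open D -> ccont D Om -> (\int[mu]_x (\1_(pre D) x * Phi g (V x))%:E < +oo)%E) ->
  (forall D, open D -> ccont D Om ->
    (\int[mu \x mu]_z (\1_(pre D `*` pre D) z * en s g V z)%:E < +oo)%E) ->
  Wloc mu G s Om v.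
Proof.
move=> hP he; split; first by exists V.
move=> D oD cD; split.
  apply: le_lt_trans (hP D oD cD); rewrite -integral_in_indic.
  by apply: ge0_ae_le_integral_in => //; apply: filterS vV => x ->.
apply: le_lt_trans (he D oD cD); rewrite -integral_in_indic.
apply: ge0_ae_le_integral_in => //.
- by move=> z; rewrite divr_ge0// exprn_ge0// enorm_ge0.
- by move=> z; exact: en_ge0 hg _ _.
apply: filterS vV2 => z [h1 h2]; rewrite /Ds h1 h2.
by apply: ler_wpM2r; [rewrite invr_ge0 exprn_ge0// enorm_ge0|exact: GP].
Qed.

Lemma Lgs_tailw : Lgs mu g s v -> mu.-integrable setT (EFin \o (fun y => tailw s g (V y) y)).
Proof.
move=> [_ [_ h]]; apply/integrableP; split.
  by apply/measurable_EFinP; exact: (measurable_J s gcont mV).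
apply: le_lt_trans h.
have [_ gge0 _ _] := hg.
have t0 y : 0 <= (1 + enorm (@rv R n y)) `^ s by exact: powR_ge0.
apply: ge0_ae_le_integral => [x|x|].
- exact: abse_ge0.
- by rewrite lee_fin divr_ge0 ?powR_ge0// gge0// divr_ge0.
apply: filterS vV => y vy; rewrite /= lee_fin ger0_norm; last exact: tailw_ge0 hg _ _.
by rewrite vy.
Qed.

(** From w <= v the negative part of v is at most |w|, so both integral conditions follow by
    monotonicity of [g]. *)
Lemma Lgs_negpart (w : 'rV[R]_n -> R) : Lgs mu g s w -> {ae mu, forall x, w (rv x) <= v (rv x)} ->
  Lgs mu g s (negpart v).
Proof.
move=> [_ [w1 w2]] wv; have [_ gge0 gm _] := hg.
have nw : {ae mu, forall x, `|negpart v (rv x)| <= `|w (rv x)|}.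
  apply: filterS wv => x wvx; rewrite /negpart ger0_norm; last by rewrite le_max lexx orbT.
  by rewrite ge_max normr_ge0 andbT; have := ler_norm (- w (rv x)); rewrite normrN; lra.
split; [|split].
- exists (fun x => Num.max (- V x) 0); split.
    by apply: measurable_maxr => //; exact: measurableT_comp.
  by apply: filterS vV => x vx; rewrite /= /negpart vx.
- move=> K cK; apply: le_lt_trans (w1 K cK); apply: ge0_ae_le_integral_in => [x|x|].
  + exact: gge0.
  + exact: gge0.
  + by apply: filterS nw => x nwx; exact: gm.
have t0 y r : 0 <= (1 + enorm (@rv R n y)) `^ r by exact: powR_ge0.
apply: le_lt_trans w2; apply: ge0_ae_le_integral => [x|x|].
- by rewrite lee_fin divr_ge0// gge0// divr_ge0.
- by rewrite lee_fin divr_ge0// gge0// divr_ge0.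
apply: filterS nw => x nwx; rewrite lee_fin; apply: ler_wpM2r; first by rewrite invr_ge0.
by apply: gm; [exact: divr_ge0|rewrite ler_wpM2r// invr_ge0].
Qed.

End representatives.

(** * Reduction to representatives with bounds valid everywhere *)

Unset Implicit Arguments.
Set Printing Implicit Defensive.

Theorem theorem5p6 (R : realType) (n : nat) (s Lambda p q : R)
  (G g : R -> R) (k : 'rV[R]_n -> 'rV[R]_n -> R)
  (mu : {sigma_finite_measure set (n.-tuple R) -> \bar R})
  (Om : set 'rV[R]_n) (h1 h2 u : 'rV[R]_n -> R)
  (uj : nat -> 'rV[R]_n -> R) :
  (* standing assumptions *)
  0 < s < 1 -> 1 <= Lambda ->
  young_pair G g ->
  (forall t : R, 0 < t -> is_derive t 1 G (g t)) ->
  (forall a b : R, 0 <= a -> a < b -> g a < g b) ->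
  G 1 = 1 ->
  1 < p -> p <= q ->
  (forall t : R, 0 <= t -> p * G t <= t * g t /\ t * g t <= q * G t) ->
  lmeas (mu \x mu)%E (fun z => k (rv z.1) (rv z.2)) ->
  {ae (mu \x mu)%E, forall z,
     Lambda^-1 <= k (rv z.1) (rv z.2) /\ k (rv z.1) (rv z.2) <= Lambda /\
     k (rv z.1) (rv z.2) = k (rv z.2) (rv z.1)} ->
  is_lebesgue mu ->
  (* hypotheses of the theorem *)
  (forall a b : R, 0 < a -> a <= b -> g b / b `^ (q - 1) <= g a / a `^ (q - 1)) ->
  open Om ->
  Lgs mu g s h1 -> Lgs mu g s h2 ->
  {ae mu, forall x, h1 (rv x) <= h2 (rv x)} ->
  (forall j, supersol mu G g s k Om (uj j)) ->
  (forall j, {ae mu, forall x, uj j (rv x) <= uj j.+1 (rv x)}) ->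
  (forall j, {ae mu, forall x, h1 (rv x) <= uj j (rv x) <= h2 (rv x)}) ->
  (forall D, open D -> ccont D Om ->
     exists M : R, forall j, {ae mu, forall x, D (rv x) -> uj j (rv x) <= M}) ->
  {ae mu, forall x, (fun j => uj j (rv x)) @ \oo --> u (rv x)} ->
  supersol mu G g s k Om u.
Proof.
move=> s01 Lam1 [g0 [gpos [gmono [gright _]]]] dG _ _ p1 pq Gg [k0 [mk0 kk0]] kae mu_leb gpow oOm
  Lh1 Lh2 h12 sup incr between UMae cvgae.
have gge0 t : 0 <= t -> 0 <= g t by move=> /(gmono _ _ (lexx 0)); rewrite g0.
pose m := (Num.truncn (q - 1)).+1.
have hg : doubling g m.
  by apply: (doubling_of_power g0 gmono gpow); apply: ltW; exact: truncnS_gt.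
have gcont := continuous_doubling g0 gmono hg (gright 0 (lexx 0)).
have GPhi := young_primitive_bounds p1 pq gge0 Gg.
have q0 : 0 <= q by lra.
have L0 : 0 < Lambda by exact: lt_le_trans Lam1.
have Li0 : 0 < Lambda^-1 by rewrite invr_gt0.
have LiL : Lambda^-1 <= Lambda by apply: (@le_trans _ _ 1) => //; rewrite invf_le1.
(* Clamping the Borel representative of the kernel makes the ellipticity bounds hold at every point,
   while changing it only on a null set. *)
pose k1 z := Num.max Lambda^-1 (Num.min (k0 z) Lambda).
have mk1 : measurable_fun setT k1.
  by apply: measurable_maxr => //; exact: measurable_minr.
have k1_ge z : Lambda^-1 <= k1 z by rewrite le_max lexx.
have k1_le z : k1 z <= Lambda by rewrite ge_max LiL/= ge_min lexx orbT.
have kk1 : {ae (mu \x mu)%E, forall z, k (rv z.1) (rv z.2) = k1 z}.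
  apply: filterS2 kk0 kae => z kz [ka [kb _]]; rewrite /k1 -kz.
  by rewrite (min_idPl kb) (max_idPr ka).
have [h1' [mh1 h1E]] := Lh1.1; have [h2' [mh2 h2E]] := Lh2.1.
have [V_ V_P] := @boolp.choice _ _ (fun j (V : n.-tuple R -> R) => measurable_fun setT V /\
  {ae mu, forall x, uj j (rv x) = V x}) (fun j => (sup j).1.1).
have [N [mN N0 subN]] : {ae mu, forall x, [/\ h1 (rv x) = h1' x, h2 (rv x) = h2' x,
    forall j, uj j (rv x) = V_ j x & forall j, uj j (rv x) <= uj j.+1 (rv x)] /\
    ((forall j, h1 (rv x) <= uj j (rv x) <= h2 (rv x)) /\
     (fun j => uj j (rv x)) @ \oo --> u (rv x))}.
  have e1 := ae_foralln (fun j => (V_P j).2); have e2 := ae_foralln incr.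
  have e3 := ae_foralln between.
  apply: filterS2 (filterI (filterI h1E h2E) (filterI e1 e2)) (filterI e3 cvgae).
  by move=> x [[? ?] [? ?]] [? ?].
have good x : ~ N x -> [/\ h1 (rv x) = h1' x, h2 (rv x) = h2' x,
    forall j, uj j (rv x) = V_ j x & forall j, uj j (rv x) <= uj j.+1 (rv x)] /\
    ((forall j, h1 (rv x) <= uj j (rv x) <= h2 (rv x)) /\
     (fun j => uj j (rv x)) @ \oo --> u (rv x)).
  by move=> Nx; apply: contrapT => h; apply: Nx; apply: subN => /=.
have aeN (P : n.-tuple R -> Prop) : (forall x, ~ N x -> P x) -> {ae mu, forall x, P x}.
  move=> h; exists N; split => // x /= nP; apply: contrapT => /h; exact: nP.
pose c : n.-tuple R -> R := \1_(~` N).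
have mc : measurable_fun setT c by apply: measurable_indic; exact: measurableC.
have cN x : ~ N x -> c x = 1 by move=> Nx; rewrite /c indicE mem_set.
have c0 x : N x -> c x = 0 by move=> Nx; rewrite /c indicE memNset// => h; exact: h.
pose U_ j x := V_ j x * c x.
(* No measurability of [u] is assumed; [U] obtains it as the everywhere limit of the [U_ j]. *)
pose U x := u (rv x) * c x.
(* The envelope |h1| + |h2| dominates every function between h1 and h2; its tail is integrable
   because [g] of a sum is bounded by a multiple of the sum of the values. *)
pose H x := (`|h1' x| + `|h2' x|) * c x.
have mH : measurable_fun setT H.
  by apply: measurable_funM => //; apply: measurable_funD; exact: measurableT_comp.
have mU_ j : measurable_fun setT (U_ j).
  by apply: measurable_funM => //; have [] := V_P j.
have Ucvg x : (fun j => U_ j x) @ \oo --> U x.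
  have [Nx|Nx] := pselect (N x).
    rewrite /U c0// mulr0; under eq_fun do rewrite /U_ c0// mulr0.
    exact: cvg_cst.
  have [[_ _ uV _] [_ cu]] := good x Nx.
  rewrite /U /U_; apply: cvgMl; under eq_fun do rewrite -uV; exact: cu.
have mU : measurable_fun setT U.
  by apply: (measurable_fun_cvg mU_) => x _; exact: Ucvg.
have UH j y : `|U_ j y| <= `|H y|.
  rewrite /U_ /H; have [Ny|Ny] := pselect (N y); first by rewrite c0// !mulr0.
  rewrite cN// !mulr1 [leRHS]ger0_norm ?addr_ge0//.
  have [[e1 e2 e3 _] [b _]] := good y Ny; have := b j; rewrite -e1 -e2 -e3 => /andP[b1 b2].
  rewrite ler_norml; have := ler_norm (h2 (rv y)); have := ler_norm (- h1 (rv y)).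
  have := normr_ge0 (h1 (rv y)); have := normr_ge0 (h2 (rv y)); rewrite normrN.
  by move=> ? ? ? ?; apply/andP; split; lra.
have Uincr j x : U_ j x <= U_ j.+1 x.
  rewrite /U_; have [Nx|Nx] := pselect (N x); first by rewrite c0// !mulr0.
  by have [[_ _ e3 e4] _] := good x Nx; rewrite cN// !mulr1 -!e3.
have ujU j : {ae mu, forall x, uj j (rv x) = U_ j x}.
  by apply: aeN => x Nx; rewrite /U_ cN// mulr1; have [[]] := good x Nx.
have uU : {ae mu, forall x, u (rv x) = U x} by apply: aeN => x Nx; rewrite /U cN// mulr1.
have h1u : {ae mu, forall x, h1 (rv x) <= u (rv x)}.
  apply: aeN => x Nx; have [_ [b cu]] := good x Nx.
  rewrite -(cvg_lim _ cu)//; apply: limr_ge; first by apply/cvg_ex; exists (u (rv x)).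
  by apply: nearW => j; have /andP[] := b j.
have IJ : mu.-integrable setT (EFin \o (fun y => tailw s g (H y) y)).
  have I1 := Lgs_tailw hg gcont mh1 h1E Lh1; have I2 := Lgs_tailw hg gcont mh2 h2E Lh2.
  apply: le_integrableT (integrableZT (2 ^+ m) (integrableDT I1 I2)).
    exact: (measurable_J s gcont mH).
  move=> y; rewrite ger0_norm; last exact: tailw_ge0 hg _ _.
  rewrite /tailw -mulrDl mulrA ler_wpM2r ?wgt_ge0//.
  have r0 : 0 <= ((1 + nrm y) `^ s)^-1 by rewrite invr_ge0 powR_ge0.
  apply: le_trans (g_add_le hg (mulr_ge0 (normr_ge0 _) r0) (mulr_ge0 (normr_ge0 _) r0)).
  apply: gmono; first exact: mulr_ge0.
  rewrite -mulrDl ler_wpM2r// /H normrM [X in X * _]ger0_norm ?addr_ge0// ler_piMr ?addr_ge0//.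
  by rewrite /c indicE; case: (_ \in _); rewrite ?normr1 ?normr0.
have UPhi j D : open D -> ccont D Om ->
    (\int[mu]_x (\1_(@rv R n @^-1` D) x * Phi g (U_ j x))%:E < +oo)%E.
  exact: (Wloc_Phi hg gcont GPhi q0 dG (mU_ j) (ujU j) (sup j).1).
have Uen j D : open D -> ccont D Om ->
    (\int[mu \x mu]_z (\1_((@rv R n @^-1` D) `*` (@rv R n @^-1` D)) z * en s g (U_ j) z)%:E < +oo)%E.
  exact: (Wloc_en hg gcont GPhi q0 dG (mU_ j) (ujU j) (sup j).1).
have UM D : open D -> ccont D Om ->
    exists M : R, forall j, {ae mu, forall x, D (rv x) -> U_ j x <= M}.
  move=> oD cD; have [M hM] := UMae D oD cD; exists M => j.
  by apply: filterS2 (hM j) (ujU j) => x hx <-.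
(* A null set of points gives a null set of pairs, so both integrals agree even though the left
   integrand need not be Borel. *)
have super_ae w W phi : {ae mu, forall x, w (rv x) = W x} ->
    (\int[(mu \x mu)%E]_z
       (gsign g (Ds s w (rv z.1) (rv z.2)) * Ds s phi (rv z.1) (rv z.2)
        * k (rv z.1) (rv z.2) / (enorm (rv z.1 - rv z.2)) ^+ n)%:E =
     \int[(mu \x mu)%E]_z (integrand s g k1 W (phi \o @rv R n) z)%:E)%E.
  move=> wW; apply: ae_eq_integralT.
  apply: filterS2 kk1 (ae_pair (V := w \o @rv R n) wW) => z kz [/= e1 e2].
  by rewrite /Ds e1 e2 kz.
have Usuper j (f : 'rV[R]_n -> R) : testfun Om f -> (forall x, 0 <= f x) ->
    (0 <= \int[mu \x mu]_z (integrand s g k1 (U_ j) (f \o @rv R n) z)%:E)%E.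
  by move=> tf f0; rewrite -(super_ae _ _ _ (ujU j)); exact: (sup j).2.2.
have g1 : 0 < g 1 by exact: gpos.
split; [|split].
- apply: (Wloc_of_Phi hg GPhi mU uU) => D oD cD.
    exact: (limit_Phi mu_leb hg gcont mU_ mU UH Uincr Ucvg UPhi UM oD cD).
  exact: (limit_en mu_leb s01 hg gcont g1 mk1 Li0 k1_ge k1_le mH IJ oOm mU_ mU UH Uincr Ucvg
    UPhi Uen UM Usuper oD cD).
- exact: (Lgs_negpart hg mU uU Lh1 h1u).
move=> phi tphi phi0; rewrite (super_ae _ _ _ uU).
exact: (limit_super mu_leb s01 hg gcont g1 mk1 Li0 k1_ge k1_le mH IJ oOm mU_ mU UH Uincr Ucvg
    UPhi Uen UM Usuper tphi phi0).
Qed.
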